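(* There exists a universal constant $C>1$ such that, for every analytic map $\phi\colon\mathbb{D}\to\mathbb{D}$, one has $$\frac1C\,\rho_{\phi,2}(h/C)\le\sup_{w\in\mathbb{D},\,|w|\ge1-h}N_{\phi,2}(w)\le C\,\rho_{\phi,2}(Ch)$$ for all $h\in(0,1)$ small enough (the smallness threshold may depend on $\phi$).
   Context: $\mathbb{D}$ is the open unit disk, $\mathbb{T}$ the unit circle, $\mathcal{A}$ the normalized area measure $dx\,dy/\pi$. For $\xi\in\mathbb{T}$ and $0<h\le 1$, $W(\xi,h)=\{z\in\mathbb{D}:|z|\ge1-h,\ |\arg(z\bar\xi)|\le\pi h\}$. $\rho_{\phi,2}(h)=\sup_{\xi\in\mathbb{T}}\mathcal{A}(\{z\in\mathbb{D}:\phi(z)\in W(\xi,h)\})$. The Nevanlinna counting function of order $2$ is $N_{\phi,2}(w)=\sum_{\phi(z)=w}(\log(1/|z|))^2$ for $w\in\mathbb{D}\setminus\{\phi(0)\}$, each preimage counted with multiplicity (the sum is $0$ if $w\notin\phi(\mathbb{D})$), and $N_{\phi,2}(\phi(0))=0$. *)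

(* Defs.v *)
From HB Require Import structures.
From mathcomp Require Import all_boot all_order all_algebra.
From mathcomp Require Import all_classical all_reals all_analysis.
From mathcomp Require Import complex.
Set Implicit Arguments. Unset Strict Implicit. Unset Printing Implicit Defensive.
Import Order.TTheory GRing.Theory Num.Theory.
Import numFieldNormedType.Exports.
Local Open Scope classical_set_scope.
Local Open Scope ring_scope.
Local Open Scope complex_scope.

Section Defs.
Variable R : realType.
Local Notation C := R[i].

Definition cmod (z : C) : R := Num.sqrt (complex.Re z ^+ 2 + complex.Im z ^+ 2).

Definition disk : set C := [set z | cmod z < 1].
Definition circle : set C := [set z | cmod z = 1].

Definition analytic_selfmap (phi : C -> C) : Prop :=
  (forall z, disk z -> derivable (phi : C^o -> C^o) z 1) /\ (forall z, disk z -> disk (phi z)).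

(* principal argument in (-pi, pi] (value pi/2 at 0, irrelevant) *)
Definition carg (u : C) : R :=
  if 0 <= complex.Im u then acos (complex.Re u / cmod u)
  else - acos (complex.Re u / cmod u).

Definition window (xi : C) (h : R) : set C :=
  [set z | disk z /\ 1 - h <= cmod z /\ `|carg (z * conjc xi)| <= pi * h].

Definition area (A : set C) : \bar R :=
  ((@lebesgue_measure R \x @lebesgue_measure R)%E
     [set p : R * R | A (p.1 +i* p.2)] * (pi^-1)%:E)%E.

Definition rho2 (phi : C -> C) (h : R) : \bar R :=
  ereal_sup [set area [set z | disk z /\ window xi h (phi z)] | xi in circle].

(* multiplicity of z as a solution of phi z = phi z (order of the zero of
   phi - phi z at z): least n >= 1 with phi^(n)(z) <> 0; 0 if none exists *)
Definition mult (phi : C -> C) (z : C) : nat :=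
  match pselect (exists n : nat, (0 < n)%N && (derive1n n (phi : C^o -> C^o) z != 0)) with
  | left H => ex_minn H
  | right _ => 0%N
  end.

Definition N2 (phi : C -> C) (w : C) : \bar R :=
  if w == phi 0 then 0%E
  else esum [set z | disk z /\ phi z = w]
         (fun z => ((mult phi z)%:R * (ln (cmod z)^-1) ^+ 2)%:E).

End Defs.

(* Main.v *)
(** The counting function is compared with areas of preimages through logarithmic potentials, so that
    no change of variables [w = phi z] is needed.  On the one hand, the mean of [zeta |-> ln (1/|c - zeta|)]
    over the disc [B(p, s)] is [ln (1/|c - p|)] minus a nonnegative quantity which vanishes for
    [|c - p| >= s] and is at least [(3/4) ln 2] for [|c - p| <= s/4].  On the other hand, Jensen's formula
    integrated over [|z| < r] expresses the integral of [ln (1/|phi z - zeta|)] as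
    [alpha r^2 ln (1/|phi 0 - zeta|)] minus the sum of [Kr r a] over the zeros [a] of [phi - zeta], where
    [Kr r a] is comparable to [(ln (1/|a|))^2]; here [alpha] is the area of the unit disc.

    Averaging Jensen's formula over the discs centred at a point [p] just outside the unit disc, for which
    [phi - p] has no zero, bounds the area of [{z : |phi z - p| <= s/4}] by the mean of [N] over [B(p, s)].
    Averaging it over [B(w, (1 - |w|)/4)] bounds [N w] by the mean of [N] over this disc.  Finally each zero
    [b] of [phi - zeta] is spread over [B(b, (1 - |b|)/64)]: a point [a] lies in at most
    [log_2 (M/|phi a - zeta|)] of these discs, by a Blaschke product estimate around [a] and the Schwarz
    lemma, and integrating over [zeta] leaves the area of [{a : |phi a - w| <= 1 - |w|}]. *)

Require Import Defs.
From HB Require Import structures.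
From mathcomp Require Import all_boot all_order all_algebra.
From mathcomp Require Import all_classical all_reals all_analysis.
From mathcomp Require Import measurable_realfun complex.
From mathcomp Require Import ring lra.
Import Order.TTheory GRing.Theory Num.Theory.
Import numFieldNormedType.Exports.
Local Open Scope classical_set_scope.
Local Open Scope ring_scope.
Set Implicit Arguments.
Unset Strict Implicit.
Unset Printing Implicit Defensive.

(** * Planar Lebesgue measure *)

(** Order two is what makes zeros and areas comparable: for [|b| >= 1/2] the weight [(ln (1/|b|))^2]
    of a zero [b] is of the order of the area of the disc of radius [(1 - |b|) / 64] about [b].
    Moreover one kernel, [Kr], is both the weight of a zero in the integrated Jensen formula and the
    loss incurred when a logarithm is averaged over a disc, so the two sides of each comparison are
    of the same kind. The obstacle is that averaging Jensen's formula bounds the counting function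
    only by its own means, never by an area; spreading the zeros over discs breaks this circle. The
    overlap of these discs at [a] is unbounded as [phi a] approaches [zeta], but only
    logarithmically, hence integrable in [zeta]. The threshold depends on [phi] through
    [1 - |phi 0|]. On the one hand [phi 0] must lie outside the averaging discs, where averaging
    causes no loss at [phi 0]. On the other hand the zeros must have modulus at least [1/2], so that
    [ln (1/|b|)] is of the order of [1 - |b|]. *)

Section leb1.
Context {R : realType}.
Local Open Scope ereal_scope.

(* Lebesgue measure as a measure on the type [R] itself, instead of the alias on which the library
   declares it, so that the product space is [R * R]. *)
Definition leb1 : set R -> \bar R := @lebesgue_measure R.

Let leb1_0 : leb1 set0 = 0. Proof. exact: (measure0 (@lebesgue_measure R)). Qed.
Let leb1_ge0 A : 0 <= leb1 A. Proof. exact: (measure_ge0 (@lebesgue_measure R)). Qed.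
Let leb1_sa : semi_sigma_additive leb1.
Proof. exact: (@measure_semi_sigma_additive _ _ _ (@lebesgue_measure R)). Qed.
HB.instance Definition _ := isMeasure.Build _ R R leb1 leb1_0 leb1_ge0 leb1_sa.
Let leb1_sf : sigma_finite setT leb1.
Proof. exact: (sigma_finiteT (@lebesgue_measure R)). Qed.
HB.instance Definition _ := Measure_isSigmaFinite.Build _ R R leb1 leb1_sf.

Lemma measurable_affine (a t : R) : measurable_fun setT (fun x : R => a * x + t)%R.
Proof.
apply: measurable_funD; last exact: measurable_cst.
exact: mulrl_measurable.
Qed.

(** Both sides are measures in [A] that agree on half-open intervals, and these determine Lebesgue
    measure. *)
Lemma lebesgue_measure_affine (a : R) (a0 : (0 < a)%R) (t : R) (A : set R) : measurable A ->
  lebesgue_measure A = (a%:E * lebesgue_measure ((fun x => a * x + t)%R @^-1` A)).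
Proof.
pose T := (fun x : measurableTypeR R => (a * x + t)%R : measurableTypeR R).
have mT : measurable_fun setT T by exact: measurable_affine.
pose HM := isMeasurableFun.Build _ _ _ _ T mT.
pose mfT : {mfun measurableTypeR R >-> measurableTypeR R} := HB.pack T HM.
pose k : {nonneg R} := NngNum (ltW a0).
move=> mA.
rewrite (@lebesgue_measure_unique R (mscale k (pushforward lebesgue_measure mfT)))//.
move=> X /ocitvP[->|[[x y]/= xy ->]]; first by rewrite !measure0.
rewrite /mscale/= /pushforward.
have -> : T @^-1` `]x, y]%classic = `]((x - t) / a)%R, ((y - t) / a)%R]%classic.
  apply/seteqP; split=> z /=; rewrite !in_itv/= /T ltr_pdivrMr// ler_pdivlMr//.
    by rewrite mulrC ltrBlDr lerBrDr.
  by rewrite ltrBlDr lerBrDr (mulrC z).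
rewrite !lebesgue_measure_itv/= !lte_fin xy ltr_pM2r ?invr_gt0// ltrD2r xy.
rewrite -!EFinB -EFinM; congr (_%:E).
rewrite -mulrBl mulrCA divff ?gt_eqF//; ring.
Qed.

Lemma ge0_integral_affine (a : R) (a0 : (0 < a)%R) (t : R) (f : R -> \bar R) :
  measurable_fun setT f -> (forall x, 0 <= f x) ->
  \int[leb1]_x f x = a%:E * \int[leb1]_x f (a * x + t)%R.
Proof.
move=> mf f0.
pose T := (fun x : R => (a * x + t)%R).
have mT : measurable_fun setT T by exact: measurable_affine.
pose k : {nonneg R} := NngNum (ltW a0).
pose nu : {measure set R -> \bar R} := pushforward leb1 T.
pose nu' : {measure set R -> \bar R} := mscale k (nu mT).
transitivity (\int[nu']_x f x).
  apply: eq_measure_integral => A mA _.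
  exact: (lebesgue_measure_affine a0 t).
rewrite ge0_integral_mscale//; congr (_ * _).
by rewrite (@ge0_integral_pushforward _ _ _ _ _ _ mT leb1 setT f measurableT mf).
Qed.

(** The identity is measurable between the two types that carry the measure, so the integral
    transfers as a pushforward along it. *)
Lemma leb1_integralE (f : R -> \bar R) : measurable_fun setT f -> (forall x, 0 <= f x) ->
  \int[lebesgue_measure]_x f x = \int[leb1]_x f x.
Proof.
move=> mf f0.
pose T := (fun x : R => x : measurableTypeR R).
have mT : measurable_fun setT T by move=> _ Y mY; rewrite setTI; exact: mY.
rewrite -(@ge0_integral_pushforward _ _ _ _ _ _ mT leb1 setT f measurableT mf)//.
Qed.

Lemma product_lebesgueE (A : set (R * R)) : measurable A ->
  (@lebesgue_measure R \x @lebesgue_measure R) A = (leb1 \x leb1) A.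
Proof.
move=> mA; rewrite /product_measure1 leb1_integralE//.
exact: (@measurable_fun_xsection _ _ R R R leb1 A).
Qed.
End leb1.

Section planar.
Context {R : realType}.
Local Notation mu := (@leb1 R).
Local Notation mu2 := ((@leb1 R) \x (@leb1 R))%E.
Local Open Scope ereal_scope.
Implicit Types f : R * R -> \bar R.

Lemma measurable_linear2 (a b c : R) :
  measurable_fun setT (fun p : R * R => a * p.1 + b * p.2 + c)%R.
Proof.
apply: measurable_funD; last exact: measurable_cst.
apply: measurable_funD; apply: measurable_funM; try exact: measurable_cst.
  exact: measurable_fst.
exact: measurable_snd.
Qed.

Lemma measurable_affine2 (a b c a' b' c' : R) :
  measurable_fun setT (fun p : R * R => (a * p.1 + b * p.2 + c, a' * p.1 + b' * p.2 + c')%R : R * R).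
Proof. by apply: measurable_fun_pair; exact: measurable_linear2. Qed.

Lemma tonelli2_xy f : measurable_fun setT f -> (forall p, 0 <= f p) ->
  \int[mu2]_p f p = \int[mu]_x \int[mu]_y f (x, y).
Proof. by move=> mf f0; rewrite fubini_tonelli1. Qed.

Lemma tonelli2_yx f : measurable_fun setT f -> (forall p, 0 <= f p) ->
  \int[mu2]_p f p = \int[mu]_y \int[mu]_x f (x, y).
Proof. by move=> mf f0; rewrite fubini_tonelli2. Qed.

(** For fixed [y] a shear is a translation in [x], which preserves the inner integral of Tonelli's
    theorem. *)
Lemma ge0_integral_shear1 (t : R) f : measurable_fun setT f -> (forall p, 0 <= f p) ->
  \int[mu2]_p f (p.1 + t * p.2, p.2)%R = \int[mu2]_p f p.
Proof.
move=> mf f0.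
have mg : measurable_fun setT (fun p : R * R => f (p.1 + t * p.2, p.2)%R).
  apply: (measurableT_comp mf); have := measurable_affine2 1 t 0 0 1 0.
  by apply: eq_measurable_fun => p _; rewrite !mul1r mul0r !addr0 add0r.
rewrite (tonelli2_yx mf f0) (tonelli2_yx mg (fun=> f0 _)); apply: eq_integral => y _.
rewrite (@ge0_integral_affine R 1 ltr01 (t * y) (fun x => f (x, y)))//.
  by rewrite mul1e; apply: eq_integral => x _; rewrite mul1r.
exact: measurableT_comp.
Qed.

Lemma ge0_integral_shear2 (t : R) f : measurable_fun setT f -> (forall p, 0 <= f p) ->
  \int[mu2]_p f (p.1, p.2 + t * p.1)%R = \int[mu2]_p f p.
Proof.
move=> mf f0.
have mg : measurable_fun setT (fun p : R * R => f (p.1, p.2 + t * p.1)%R).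
  apply: (measurableT_comp mf); have := measurable_affine2 1 0 0 t 1 0.
  by apply: eq_measurable_fun => p _; rewrite !mul1r mul0r !addr0 [(p.2 + _)%R]addrC.
rewrite (tonelli2_xy mf f0) (tonelli2_xy mg (fun=> f0 _)); apply: eq_integral => x _.
rewrite (@ge0_integral_affine R 1 ltr01 (t * x) (fun y => f (x, y)))//.
  by rewrite mul1e; apply: eq_integral => y _; rewrite mul1r.
exact: measurableT_comp.
Qed.

Lemma ge0_integral_translate2 (a b : R) f : measurable_fun setT f -> (forall p, 0 <= f p) ->
  \int[mu2]_p f (p.1 + a, p.2 + b)%R = \int[mu2]_p f p.
Proof.
move=> mf f0.
have mg : measurable_fun setT (fun p : R * R => f (p.1 + a, p.2 + b)%R).
  apply: (measurableT_comp mf); have := measurable_affine2 1 0 a 0 1 b.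
  by apply: eq_measurable_fun => p _; rewrite !mul1r !mul0r !addr0 add0r.
rewrite (tonelli2_xy mf f0) (tonelli2_xy mg (fun=> f0 _)).
rewrite (@ge0_integral_affine R 1 ltr01 a (fun x => \int[mu]_y f (x, y)))//.
- rewrite mul1e; apply: eq_integral => x _; rewrite mul1r.
  rewrite [RHS](@ge0_integral_affine R 1 ltr01 b (fun y => f (x + a, y)%R))//.
    by rewrite mul1e; apply: eq_integral => y _; rewrite mul1r.
  exact: measurableT_comp.
- exact: measurable_fun_fubini_tonelli_F.
- by move=> x; exact: integral_ge0.
Qed.

Lemma ge0_integral_scale2 (a : R) f : (0 < a)%R -> measurable_fun setT f -> (forall p, 0 <= f p) ->
  \int[mu2]_p f p = (a ^+ 2)%:E * \int[mu2]_p f (a * p.1, a * p.2)%R.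
Proof.
move=> a0 mf f0.
have mg : measurable_fun setT (fun p : R * R => f (a * p.1, a * p.2)%R).
  apply: (measurableT_comp mf); have := measurable_affine2 a 0 0 0 a 0.
  by apply: eq_measurable_fun => p _; rewrite !mul0r !addr0 add0r.
rewrite (tonelli2_xy mf f0) (tonelli2_xy mg (fun=> f0 _)).
rewrite (@ge0_integral_affine R a a0 0 (fun x => \int[mu]_y f (x, y))); last 2 first.
- exact: measurable_fun_fubini_tonelli_F.
- by move=> x; exact: integral_ge0.
- rewrite expr2 EFinM -muleA; congr (_ * _).
  rewrite -ge0_integralZl//; last 3 first.
  + exact: (@measurable_fun_fubini_tonelli_F _ _ _ _ _ mu (fun p : R * R => f (a * p.1, a * p.2)%R)).
  + by move=> x _; exact: integral_ge0.
  + by rewrite lee_fin ltW.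
  apply: eq_integral => x _; rewrite addr0.
  rewrite (@ge0_integral_affine R a a0 0 (fun y => f (a * x, y)%R))//.
    by congr (_ * _); apply: eq_integral => y _; rewrite addr0.
  exact: measurableT_comp.
Qed.

(** A rotation of angle [theta] with [sin theta != 0] is a product of three shears, with parameters
    [t], [s], [t] where [t = (c - 1) / s] is [- tan (theta / 2)]. *)
Lemma ge0_integral_rotate_neq0 (c s : R) f : (c ^+ 2 + s ^+ 2 = 1)%R -> s != 0%R ->
  measurable_fun setT f -> (forall p, 0 <= f p) ->
  \int[mu2]_p f (c * p.1 - s * p.2, s * p.1 + c * p.2)%R = \int[mu2]_p f p.
Proof.
move=> cs s0 mf f0; pose t := ((c - 1) / s)%R.
pose f1 (p : R * R) := f (p.1 + t * p.2, p.2)%R.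
pose f2 (p : R * R) := f1 (p.1, p.2 + s * p.1)%R.
have mf1 : measurable_fun setT f1.
  apply: (measurableT_comp mf); have := measurable_affine2 1 t 0 0 1 0.
  by apply: eq_measurable_fun => p _; rewrite !mul1r mul0r !addr0 add0r.
have mf2 : measurable_fun setT f2.
  apply: (measurableT_comp mf1); have := measurable_affine2 1 0 0 s 1 0.
  by apply: eq_measurable_fun => p _; rewrite !mul1r mul0r !addr0 [(p.2 + _)%R]addrC.
rewrite -(ge0_integral_shear1 t mf f0) -(@ge0_integral_shear2 s f1)//; last by move=> p; exact: f0.
rewrite -(@ge0_integral_shear1 t f2)//; last by move=> p; exact: f0.
apply: eq_integral => -[x y] _; rewrite /f2 /f1/=; congr (f (_, _)).
  rewrite /t; have -> : (c = 1 + t * s)%R by rewrite /t divfK//; ring.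
  have : ((1 + t * s) ^+ 2 + s ^+ 2 = 1)%R by rewrite /t divfK// addrCA subrr addr0.
  move=> h.
  have e : (t * s + t * s + s * s * t * t + s * s = 0)%R by lra.
  have h2 : (s * (t + t + s * t * t + s) = 0)%R by rewrite -e; ring.
  have h3 : (t + t + s * t * t + s = 0)%R.
    by move/eqP: h2; rewrite mulf_eq0 (negbTE s0)/= => /eqP.
  have -> : ((1 + t * s - 1) / s = t)%R by rewrite addrAC subrr add0r mulfK.
  have -> : (s * y = - (t + t + s * t * t) * y)%R by congr (_ * y)%R; lra.
  by ring.
have -> : (c = 1 + t * s)%R by rewrite /t divfK//; ring.
by ring.
Qed.

Lemma ge0_integral_rotate (c s : R) f : (c ^+ 2 + s ^+ 2 = 1)%R ->
  measurable_fun setT f -> (forall p, 0 <= f p) ->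
  \int[mu2]_p f (c * p.1 - s * p.2, s * p.1 + c * p.2)%R = \int[mu2]_p f p.
Proof.
move=> cs mf f0; have [s0|s0] := eqVneq s 0%R; last exact: ge0_integral_rotate_neq0.
have /eqP : (c ^+ 2 = 1)%R by rewrite -cs s0; ring.
rewrite -[X in _ == X -> _](expr1n _ 2) eqf_sqr => /orP[]/eqP cE.
  by apply: eq_integral => -[x y] _; rewrite cE s0/=; congr (f (_, _)); ring.
(* The half turn [c = -1] is the square of the quarter turn, which is covered by the case
   [s != 0]. *)
pose f1 (p : R * R) := f (0 * p.1 - 1 * p.2, 1 * p.1 + 0 * p.2)%R.
have mf1 : measurable_fun setT f1.
  apply: (measurableT_comp mf); have := measurable_affine2 0 (-1) 0 1 0 0.
  by apply: eq_measurable_fun => p _; rewrite mulN1r mul1r !addr0 ?mul1r.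
have h : (0 ^+ 2 + 1 ^+ 2 = 1 :> R)%R by ring.
rewrite -(ge0_integral_rotate_neq0 h _ mf f0) ?oner_eq0//.
rewrite -(@ge0_integral_rotate_neq0 _ _ f1 h) ?oner_eq0//; last by move=> p; exact: f0.
by apply: eq_integral => -[x y] _; rewrite /f1/= cE s0; congr (f (_, _)); ring.
Qed.
End planar.

(** * The real-valued modulus on [R[i]] *)

Section cmod.
Context {R : realType}.
Local Notation C := R[i].
Local Open Scope complex_scope.
Implicit Types (z w u : C) (x y r : R).

Lemma normCE z : `|z| = (cmod z)%:C. Proof. exact: normc_def. Qed.

Lemma cmod_ge0 z : 0 <= cmod z. Proof. exact: sqrtr_ge0. Qed.
Hint Resolve cmod_ge0 : core.

Lemma cmodM z w : cmod (z * w) = cmod z * cmod w.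
Proof. by apply: complexI; rewrite rmorphM/= -!normCE normrM. Qed.

Lemma cmod_real x : cmod x%:C = `|x|.
Proof. by rewrite /cmod/= expr0n addr0 sqrtr_sqr. Qed.

Lemma cmod0 : cmod (0 : C) = 0.
Proof. by rewrite -[0]/(0%:C) cmod_real normr0. Qed.

Lemma cmod1 : cmod (1 : C) = 1.
Proof. by rewrite -[1]/(1%:C) cmod_real normr1. Qed.

Lemma cmod_eq0 z : (cmod z == 0) = (z == 0).
Proof. by rewrite -[in RHS]normr_eq0 normCE -(inj_eq (@complexI R)). Qed.

Lemma cmod_gt0 z : (0 < cmod z) = (z != 0).
Proof. by rewrite lt0r cmod_eq0 cmod_ge0 andbT. Qed.

Lemma cmodN z : cmod (- z) = cmod z.
Proof. by apply: complexI; rewrite -!normCE normrN. Qed.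

Lemma cmodBC z w : cmod (z - w) = cmod (w - z).
Proof. by rewrite -cmodN opprB. Qed.

Lemma cmodD z w : cmod (z + w) <= cmod z + cmod w.
Proof. by rewrite -lecR rmorphD/= -!normCE ler_normD. Qed.

Lemma cmodB z w : cmod (z - w) <= cmod z + cmod w.
Proof. by rewrite -(cmodN w); exact: cmodD. Qed.

Lemma cmod_tri z w u : cmod (z - w) <= cmod (z - u) + cmod (u - w).
Proof. by have := cmodD (z - u) (u - w); rewrite addrA subrK. Qed.

Lemma cmodB_ge z w : cmod z - cmod w <= cmod (z - w).
Proof. by rewrite lerBlDr; have := cmodD (z - w) w; rewrite subrK. Qed.

Lemma cmodD_ge z w : cmod z - cmod w <= cmod (z + w).
Proof. by have := cmodB_ge z (- w); rewrite opprK cmodN. Qed.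

Lemma cmodX z n : cmod (z ^+ n) = cmod z ^+ n.
Proof. by elim: n => [|n ih]; rewrite ?expr0 ?cmod1// !exprS cmodM ih. Qed.

Lemma cmodV z : cmod z^-1 = (cmod z)^-1.
Proof.
have [->|z0] := eqVneq z 0; first by rewrite invr0 cmod0 invr0.
have cz0 : cmod z != 0 by rewrite cmod_eq0.
by apply: (mulfI cz0); rewrite -cmodM !divff// cmod1.
Qed.

Lemma cmod_div z w : cmod (z / w) = cmod z / cmod w.
Proof. by rewrite cmodM cmodV. Qed.

Lemma cmod_conj z : cmod (conjc z) = cmod z.
Proof. by case: z => a b; rewrite /cmod/= sqrrN. Qed.

Lemma cmod_prod (I : Type) (s : seq I) (F : I -> C) :
  cmod (\prod_(i <- s) F i) = \prod_(i <- s) cmod (F i).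
Proof. by apply: (big_morph (@cmod R)); [exact: cmodM|exact: cmod1]. Qed.

Lemma cmod_sqr z : cmod z ^+ 2 = complex.Re z ^+ 2 + complex.Im z ^+ 2.
Proof. by rewrite sqr_sqrtr// addr_ge0// sqr_ge0. Qed.

Lemma Re_le_cmod z : `|complex.Re z| <= cmod z.
Proof.
rewrite -(@ler_pXn2r _ 2)// ?nnegrE// cmod_sqr real_normK ?num_real//.
by rewrite lerDl sqr_ge0.
Qed.

Lemma Im_le_cmod z : `|complex.Im z| <= cmod z.
Proof.
rewrite -(@ler_pXn2r _ 2)// ?nnegrE// cmod_sqr real_normK ?num_real//.
by rewrite lerDr sqr_ge0.
Qed.

Lemma cmod_le_ReIm z : cmod z <= `|complex.Re z| + `|complex.Im z|.
Proof.
rewrite -(@ler_pXn2r _ 2)// ?nnegrE ?addr_ge0// cmod_sqr sqrrD.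
by rewrite !real_normK ?num_real// lerD2r lerDl mulrn_wge0// mulr_ge0.
Qed.

Lemma ReD z w : complex.Re (z + w) = complex.Re z + complex.Re w.
Proof. by case: z; case: w. Qed.
Lemma ImD z w : complex.Im (z + w) = complex.Im z + complex.Im w.
Proof. by case: z; case: w. Qed.
Lemma ReN z : complex.Re (- z) = - complex.Re z.
Proof. by case: z. Qed.
Lemma ImN z : complex.Im (- z) = - complex.Im z.
Proof. by case: z. Qed.
Lemma ReM z w : complex.Re (z * w) =
  complex.Re z * complex.Re w - complex.Im z * complex.Im w.
Proof. by case: z; case: w. Qed.
Lemma ImM z w : complex.Im (z * w) =
  complex.Re z * complex.Im w + complex.Im z * complex.Re w.
Proof. by case: z => a b; case: w => c d /=. Qed.

End cmod.
#[global] Hint Extern 0 (is_true (@Order.le _ _ _ (cmod _))) => solve [apply: cmod_ge0] : core.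

(** * Measurability of complex-valued functions through their real and imaginary parts *)

Section complex_measurability.
Context {R : realType} {d : measure_display} {T : measurableType d}.
Local Notation C := R[i].
Local Open Scope complex_scope.
Implicit Types f g : T -> C.

Definition cmeasurable f :=
  measurable_fun setT (fun t => complex.Re (f t)) /\
  measurable_fun setT (fun t => complex.Im (f t)).

Lemma cmeasurable_cst z : cmeasurable (fun=> z).
Proof. by split; exact: measurable_cst. Qed.

Lemma cmeasurableD f g : cmeasurable f -> cmeasurable g ->
  cmeasurable (fun t => f t + g t).
Proof.
move=> [f1 f2] [g1 g2]; split.
  by under [X in measurable_fun _ X]eq_fun do rewrite ReD; exact: measurable_funD.
by under [X in measurable_fun _ X]eq_fun do rewrite ImD; exact: measurable_funD.
Qed.

Lemma cmeasurableN f : cmeasurable f -> cmeasurable (fun t => - f t).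
Proof.
move=> [f1 f2]; split.
  by under [X in measurable_fun _ X]eq_fun do rewrite ReN; exact: measurable_funN.
by under [X in measurable_fun _ X]eq_fun do rewrite ImN; exact: measurable_funN.
Qed.

Lemma cmeasurableM f g : cmeasurable f -> cmeasurable g ->
  cmeasurable (fun t => f t * g t).
Proof.
move=> [f1 f2] [g1 g2]; split.
  under [X in measurable_fun _ X]eq_fun do rewrite ReM.
  by apply: measurable_funB; exact: measurable_funM.
under [X in measurable_fun _ X]eq_fun do rewrite ImM.
by apply: measurable_funD; exact: measurable_funM.
Qed.

Lemma cmeasurableX f n : cmeasurable f -> cmeasurable (fun t => f t ^+ n).
Proof.
move=> mf; elim: n => [|n ih]; first exact: cmeasurable_cst.
by under [X in cmeasurable X]eq_fun do rewrite exprS; exact: cmeasurableM.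
Qed.

Lemma cmeasurable_sum (I : Type) (s : seq I) (F : I -> T -> C) :
  (forall i, cmeasurable (F i)) -> cmeasurable (fun t => \sum_(i <- s) F i t).
Proof.
move=> mF; elim: s => [|i s ih].
  by under [X in cmeasurable X]eq_fun do rewrite big_nil; exact: cmeasurable_cst.
by under [X in cmeasurable X]eq_fun do rewrite big_cons; exact: cmeasurableD.
Qed.

Lemma measurable_sqrt : measurable_fun setT (@Num.sqrt R).
Proof. by apply: continuous_measurable_fun; exact: sqrt_continuous. Qed.

Lemma measurable_cmod f : cmeasurable f -> measurable_fun setT (fun t => cmod (f t)).
Proof.
move=> [f1 f2]; apply: (measurableT_comp measurable_sqrt).
by apply: measurable_funD; exact: measurable_funX.
Qed.

End complex_measurability.

Section leb2.
Context {R : realType}.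
Local Open Scope ereal_scope.

(** Planar measure under a name of its own, with its own sigma-finite structure, so that it can be a
    factor of a further product: Tonelli's theorem is applied to pairs of points of the plane. *)
Definition leb2 : set (R * R) -> \bar R := (@leb1 R \x @leb1 R).

Let leb2_0 : leb2 set0 = 0. Proof. exact: (measure0 (@leb1 R \x @leb1 R)). Qed.
Let leb2_ge0 A : 0 <= leb2 A. Proof. exact: (measure_ge0 (@leb1 R \x @leb1 R)). Qed.
Let leb2_sa : semi_sigma_additive leb2.
Proof. exact: (@measure_semi_sigma_additive _ _ _ (@leb1 R \x @leb1 R)). Qed.
HB.instance Definition _ := isMeasure.Build _ (R * R)%type R leb2 leb2_0 leb2_ge0 leb2_sa.
Let leb2_sf : sigma_finite setT leb2.
Proof.
have /sigma_finiteP[F [FT ndF Foo]] := sigma_finiteT (@leb1 R).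
exists (fun n => F n `*` F n).
  rewrite -setXTT FT predeqE => -[x y]; split.
    move=> [/= [n _ Fnx] [k _ Gky]]; exists (maxn n k) => //; split.
    - by move: x Fnx; exact/subsetPset/ndF/leq_maxl.
    - by move: y Gky; exact/subsetPset/ndF/leq_maxr.
  by move=> [n _ []/= ? ?]; split; exists n.
move=> k; have [? ?] := Foo k; split; first exact: measurableX.
by rewrite /leb2 product_measure1E// lte_mul_pinfty// ge0_fin_numE.
Qed.
HB.instance Definition _ := Measure_isSigmaFinite.Build _ (R * R)%type R leb2 leb2_sf.

Lemma leb2_setX (A B : set R) : measurable A -> measurable B ->
  leb2 (A `*` B) = leb1 A * leb1 B.
Proof. exact: product_measure1E. Qed.

Lemma leb2E (A : set (R * R)) : measurable A ->
  (@lebesgue_measure R \x @lebesgue_measure R) A = leb2 A.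
Proof. exact: product_lebesgueE. Qed.

Lemma leb2_integral_translate (a b : R) (f : R * R -> \bar R) :
  measurable_fun setT f -> (forall p, 0 <= f p) ->
  \int[leb2]_p f (p.1 + a, p.2 + b)%R = \int[leb2]_p f p.
Proof. exact: ge0_integral_translate2. Qed.

Lemma leb2_integral_scale (a : R) (f : R * R -> \bar R) : (0 < a)%R ->
  measurable_fun setT f -> (forall p, 0 <= f p) ->
  \int[leb2]_p f p = (a ^+ 2)%:E * \int[leb2]_p f (a * p.1, a * p.2)%R.
Proof. exact: ge0_integral_scale2. Qed.

Lemma leb2_integral_rotate (c s : R) (f : R * R -> \bar R) : (c ^+ 2 + s ^+ 2 = 1)%R ->
  measurable_fun setT f -> (forall p, 0 <= f p) ->
  \int[leb2]_p f (c * p.1 - s * p.2, s * p.1 + c * p.2)%R = \int[leb2]_p f p.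
Proof. exact: ge0_integral_rotate. Qed.

Lemma leb1_itv (a b : R) :
  leb1 (`[a, b]%classic : set R) = if (a < b)%R then (b - a)%:E else 0.
Proof. by rewrite /leb1 lebesgue_measure_itv/= lte_fin -EFinB. Qed.

End leb2.
#[global] Opaque leb1 leb2 cmod.

(** * Areas of discs and circles *)

Section discs.
Context {R : realType}.
Local Notation C := R[i].
Local Notation mu2 := (@leb2 R).
Local Open Scope complex_scope.

Definition c2 (p : R * R) : C := p.1 +i* p.2.

Lemma cmeasurable_c2 : cmeasurable c2.
Proof. by split; [exact: measurable_fst|exact: measurable_snd]. Qed.

Definition B (a : C) (r : R) : set (R * R) := [set p | cmod (c2 p - a) < r].
Arguments B (a r)%_ring_scope.

Lemma measurable_cmod_c2 a : measurable_fun setT (fun p => cmod (c2 p - a)).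
Proof.
by apply: measurable_cmod; apply: cmeasurableD; [exact: cmeasurable_c2|exact: cmeasurable_cst].
Qed.

Lemma measurable_B a r : measurable (B a r).
Proof.
rewrite -[B a r]setTI -[B a r]/((fun p => cmod (c2 p - a)) @^-1` [set x | x < r]).
apply: measurable_cmod_c2 => //; rewrite -set_itvNyo; exact: measurable_itv.
Qed.
Hint Resolve measurable_B : core.

Lemma c2_translate (a : C) (p : R * R) :
  c2 (p.1 + complex.Re a, p.2 + complex.Im a) = c2 p + a.
Proof. by case: a. Qed.

Lemma c2_scale (r : R) (p : R * R) : c2 (r * p.1, r * p.2) = r%:C * c2 p.
Proof. by rewrite /c2/=; apply/eqP; rewrite eq_complex/=; apply/andP; split; apply/eqP; ring. Qed.

Lemma measurable_EFin_indic (A : set (R * R)) : measurable A ->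
  measurable_fun setT (fun p : R * R => (\1_A p : R)%:E).
Proof. by move=> mA; apply/measurable_EFinP. Qed.

Lemma EFin_indic_ge0 (A : set (R * R)) p : (0 <= (\1_A p : R)%:E)%E.
Proof. by rewrite lee_fin. Qed.

Lemma mu2_translate (a b : R) (A : set (R * R)) : measurable A ->
  mu2 [set p | A (p.1 + a, p.2 + b)] = mu2 A.
Proof.
move=> mA.
have mA' : measurable [set p | A (p.1 + a, p.2 + b)].
  have := measurable_affine2 1 0 a 0 1 b.
  under [X in measurable_fun _ X]eq_fun do rewrite !mul1r !mul0r addr0 add0r.
  by move=> /(_ measurableT A mA); rewrite setTI.
have := leb2_integral_translate a b (measurable_EFin_indic mA) (EFin_indic_ge0 A).
rewrite [X in _ = X -> _]integral_indic; [|exact: measurableT|exact: mA].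
rewrite [X in X = _ -> _](integral_indic mu2 measurableT mA').
by rewrite !setIT.
Qed.

Lemma mu2_scale (a : R) (A : set (R * R)) : 0 < a -> measurable A ->
  mu2 A = ((a ^+ 2)%:E * mu2 [set p | A (a * p.1, a * p.2)%R])%E.
Proof.
move=> a0 mA.
have mA' : measurable [set p | A (a * p.1, a * p.2)].
  have := measurable_affine2 a 0 0 0 a 0.
  under [X in measurable_fun _ X]eq_fun do rewrite !mul0r !addr0 add0r.
  by move=> /(_ measurableT A mA); rewrite setTI.
have := leb2_integral_scale a0 (measurable_EFin_indic mA) (EFin_indic_ge0 A).
rewrite [X in X = _ -> _]integral_indic; [|exact: measurableT|exact: mA].
rewrite [X in _ = (_ * X)%E -> _](integral_indic mu2 measurableT mA').
by rewrite !setIT.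
Qed.

Definition alpha : R := fine (mu2 (B 0 1)).

Lemma mu2_B1_lty : (mu2 (B 0 1) < +oo)%E.
Proof.
have mI : measurable (`[- 1, 1]%classic : set R) by exact: measurable_itv.
apply: (@le_lt_trans _ _ (mu2 ((`[- 1, 1]%classic : set R) `*` (`[- 1, 1]%classic : set R)))).
  apply: le_measure; rewrite ?inE//; first exact: measurableX.
  move=> -[x y]; rewrite /B/= subr0 => h; split=> /=; rewrite in_itv/= -ler_norml.
    exact: le_trans (Re_le_cmod (x +i* y)) (ltW h).
  exact: le_trans (Im_le_cmod (x +i* y)) (ltW h).
by rewrite leb2_setX// !leb1_itv; case: ifP => _; rewrite ?mul0e// -EFinM ltry.
Qed.

Lemma alphaE : mu2 (B 0 1) = alpha%:E.
Proof. by rewrite /alpha fineK// ge0_fin_numE// mu2_B1_lty. Qed.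

Lemma alpha_gt0 : 0 < alpha.
Proof.
rewrite -lte_fin -alphaE.
have mI : measurable (`[0, 3^-1]%classic : set R) by exact: measurable_itv.
apply: (@lt_le_trans _ _ (mu2 ((`[0, 3^-1]%classic : set R) `*` (`[0, 3^-1]%classic : set R)))).
  by rewrite leb2_setX// !leb1_itv invr_gt0 ltr0n subr0 -EFinM lte_fin mulr_gt0// invr_gt0.
apply: le_measure; rewrite ?inE//; first exact: measurableX.
move=> -[x y] [/=]; rewrite !in_itv/= => /andP[x0 x1] /andP[y0 y1].
rewrite /B/= subr0; apply: le_lt_trans (cmod_le_ReIm _) _ => /=.
by rewrite !ger0_norm//; lra.
Qed.

Lemma mu2_B (a : C) (r : R) : 0 < r -> mu2 (B a r) = (alpha * r ^+ 2)%:E.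
Proof.
move=> r0; transitivity (mu2 (B 0 r)).
  rewrite -(mu2_translate (complex.Re a) (complex.Im a) (measurable_B a r)).
  congr (mu2 _); apply/seteqP; split=> p; rewrite /B/= subr0;
    by rewrite (c2_translate a p) addrK.
rewrite mulrC EFinM -alphaE (mu2_scale r0 (measurable_B _ _)); congr (_ * mu2 _)%E.
apply/seteqP; split=> p; rewrite /B/= !subr0 c2_scale cmodM cmod_real gtr0_norm//;
  by rewrite gtr_pMr.
Qed.

(** The circle and [B 0 r] are disjoint subsets of [B 0 (r + d)], so the measure of the circle is at
    most the area of a thin annulus, for every [d]. *)
Lemma mu2_circle (r : R) : 0 < r -> mu2 [set p | cmod (c2 p) = r] = 0%E.
Proof.
move=> r0.
have mS : measurable [set p : R * R | cmod (c2 p) = r].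
  have -> : [set p : R * R | cmod (c2 p) = r] = (fun p => cmod (c2 p - 0)) @^-1` [set r].
    by apply/seteqP; split=> p /=; rewrite subr0.
  by rewrite -[X in measurable X]setTI; apply: measurable_cmod_c2.
apply/eqP; rewrite eq_le measure_ge0 andbT; apply/lee_addgt0Pr => e e0; rewrite add0e.
have a0 := alpha_gt0.
pose d := Num.min 1 (e / (alpha * (2 * r + 1))).
have c0 : 0 < alpha * (2 * r + 1) by rewrite mulr_gt0//; lra.
have d0 : 0 < d by rewrite lt_min ltr01/= divr_gt0.
have h : (mu2 [set p | cmod (c2 p) = r] + mu2 (B 0 r) <= mu2 (B 0 (r + d)))%E.
  rewrite -measureU//; last first.
    by apply/seteqP; split=> // p []/= h; rewrite /B/= subr0 h ltxx.
  apply: le_measure; rewrite ?inE//; first exact: measurableU.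
  move=> p [/= h|]; rewrite /B/= subr0; first by rewrite h ltrDl.
  by move=> h; rewrite (lt_trans h)// ltrDl.
rewrite !mu2_B ?addr_gt0// in h.
have {}h : (mu2 [set p | cmod (c2 p) = r] <= (alpha * (r + d) ^+ 2)%:E - (alpha * r ^+ 2)%:E)%E.
  by rewrite leeBrDr.
rewrite (le_trans h)// -EFinB lee_fin -mulrBr.
have d1 : d <= 1 by rewrite ge_min lexx.
have d2 : d <= e / (alpha * (2 * r + 1)) by rewrite ge_min lexx orbT.
rewrite ler_pdivlMr// in d2.
apply: le_trans d2; rewrite mulrCA ler_pM2l//.
have -> : ((r + d) ^+ 2 - r ^+ 2 = d * (2 * r + d))%R by ring.
by rewrite ler_pM2l// lerD2l.
Qed.

End discs.
#[global] Hint Extern 0 (@measurable _ _ (B _ _)) => solve [apply: measurable_B] : core.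
Arguments B {R} (a r)%_ring_scope.

(** * Logarithmic potentials of discs *)

Section dyadic.
Context {R : realType}.

(* Number of dyadic levels above [x], an integrable majorant of the logarithmic singularity at [0]. *)
Definition dyad (x : R) : \bar R :=
  (\sum_(0 <= k <oo) (\1_[set t : R | t <= 2 ^- k] x : R)%:E)%E.

Lemma dyad_ge0 x : (0 <= dyad x)%E.
Proof. by apply: nneseries_ge0 => n _ _; rewrite lee_fin. Qed.

Lemma ln2_le1 : ln 2 <= 1 :> R.
Proof. by have := @le_ln1Dx R 1; apply; lra. Qed.

(** The levels [0, ..., n] all count, hence [n.+1] of them. *)
Lemma dyad_ge_nat n (x : R) : x <= 2 ^- n -> ((n.+1%:R)%:E <= dyad x)%E.
Proof.
move=> xn; apply: (@le_trans _ _ (\sum_(0 <= k < n.+1) (\1_[set t : R | (t <= 2 ^- k)%R] x : R)%:E)%E).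
  rewrite (_ : (\sum_(_ <= _ < _) _)%E = n.+1%:R%:E)//.
  rewrite big_nat; under eq_bigr => k /andP[_ kN].
    rewrite indicE mem_set/=; last first.
      by rewrite (le_trans xn)// lef_pV2 ?posrE ?exprn_gt0// ler_eXn2l ?ltr1n.
    over.
  by rewrite -big_nat sumEFin sumr_const_nat subn0.
by apply: nneseries_lim_ge => k _ _; rewrite lee_fin.
Qed.

(** If [2 ^- N.+1 < x <= 2 ^- N], then [ln x^-1] is below [N.+1] times [ln 2 <= 1], while [x] lies
    in at least [N.+1] levels. *)
Lemma lnV_le_dyad x : 0 < x -> ((ln x^-1)%:E <= dyad x)%E.
Proof.
move=> x0; have [N hN] : exists N, 2 ^- N < x.
  have := @cvg_geometric R 1 (2^-1).
  rewrite ger0_norm ?invr_ge0// invf_lt1// ltr1n => /(_ isT)/cvgrPdist_lt/(_ _ x0)[N _ /(_ N (leqnn _))].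
  rewrite /= sub0r normrN mul1r exprVn => h; exists N; exact: le_lt_trans (ler_norm _) h.
elim: N hN => [|N ih] hN.
  rewrite expr0 invr1 in hN; apply: le_trans (dyad_ge0 x).
  by rewrite lee_fin lnV// oppr_le0 ln_ge0// ltW.
have [xN|//] := leP x (2 ^- N); apply: le_trans (dyad_ge_nat xN).
rewrite lee_fin lnV//.
have : ln (2 ^- N.+1) < ln x by rewrite ltr_ln ?posrE// invr_gt0 exprn_gt0.
rewrite lnV ?posrE ?exprn_gt0// lnXn// => h1.
have h2 : ln 2 *+ N.+1 <= N.+1%:R :> R by rewrite lerMn2r ln2_le1 orbT.
by move: h1 h2; set a := ln 2 *+ N.+1; lra.
Qed.

Lemma measurable_indic_le (c : R) : measurable_fun setT (fun x => (\1_[set t : R | t <= c] x : R)%:E).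
Proof.
apply/measurable_EFinP; apply: measurable_indic.
by rewrite -set_itvNyc; exact: measurable_itv.
Qed.

Lemma measurable_dyad : measurable_fun setT dyad.
Proof.
apply: ge0_emeasurable_sum => [k x _ _|k _]; first by rewrite lee_fin.
exact: measurable_indic_le.
Qed.

(** Integrated term by term: the measures of the levels are dominated by a geometric series of ratio
    [1/2], whose sum is [2 * K]. *)
Lemma ge0_integral_dyad (d : measure_display) (T : measurableType d)
    (mu : {measure set T -> \bar R}) (A : set T) (f : T -> R) (K : R) :
  measurable A -> measurable_fun setT f -> 0 <= K ->
  (forall k, (mu (A `&` [set t | (f t <= 2 ^- k)%R]) <= (K * 2 ^- k)%:E)%E) ->
  (\int[mu]_(t in A) dyad (f t) <= (2 * K)%:E)%E.
Proof.
move=> mA mf K0 h.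
have mk k : measurable [set t | (f t <= 2 ^- k)%R].
  have -> : [set t | (f t <= 2 ^- k)%R] = f @^-1` `]-oo, 2 ^- k]%classic.
    by rewrite set_itvNyc.
  by rewrite -[X in measurable X]setTI; exact: mf.
rewrite integral_nneseries//; last first.
  by move=> k; apply: measurable_funTS; exact: (measurableT_comp (measurable_indic_le _) mf).
rewrite (@le_trans _ _ (\sum_(0 <= k <oo) (K * 2 ^- k)%:E)%E)//.
  apply: lee_nneseries; first by move=> *; apply: integral_ge0 => t _; rewrite lee_fin.
  move=> k *; apply: le_trans (h k); rewrite setIC -(integral_indic mu mA (mk k)).
  by rewrite le_eqVlt; apply/orP; left; apply/eqP; apply: eq_integral.
apply: lime_le; first by apply: is_cvg_nneseries => k _ _; rewrite lee_fin mulr_ge0// invr_ge0 exprn_ge0.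
apply: nearW => n; rewrite sumEFin lee_fin.
have := @geometric_le_lim R n K (2^-1) K0; rewrite /series/= invr_gt0 ltr0n => /(_ isT).
rewrite ger0_norm ?invr_ge0// invf_lt1// ltr1n => /(_ isT).
have -> : 1 - 2^-1 = 2^-1 :> R by lra.
rewrite invrK mulrC; apply: le_trans; apply: ler_sum => k _; by rewrite exprVn.
Qed.

End dyadic.

Section disc_integrals.
Context {R : realType}.
Local Notation C := R[i].
Local Notation mu2 := (@leb2 R).
Local Open Scope complex_scope.

Lemma c2K (z : C) : c2 (complex.Re z, complex.Im z) = z. Proof. by case: z. Qed.

Lemma B0E (r : R) p : B 0 r p = (cmod (c2 p) < r). Proof. by rewrite /B/= subr0. Qed.

Lemma measurable_mulc (u : C) :
  measurable_fun setT (fun p => (complex.Re (u * c2 p), complex.Im (u * c2 p)) : R * R).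
Proof.
have [m1 m2] := cmeasurableM (cmeasurable_cst u) (@cmeasurable_c2 R).
by apply: measurable_fun_pair.
Qed.

Lemma ge0_integral_disc_mulc (u : C) (s : R) (f : R * R -> \bar R) : cmod u = 1 ->
  measurable_fun setT f -> (forall p, 0 <= f p)%E ->
  (\int[mu2]_(p in B 0 s) f (complex.Re (u * c2 p), complex.Im (u * c2 p))%R =
   \int[mu2]_(p in B 0 s) f p)%E.
Proof.
move=> u1 mf f0.
rewrite integral_mkcond [RHS]integral_mkcond.
have mg : measurable_fun setT (f \_ (B 0 s)).
  by apply/(measurable_restrictT _ (measurable_B 0 s)); exact: measurable_funTS.
have g0 p : (0 <= (f \_ (B 0 s)) p)%E by rewrite patchE; case: ifP.
case: u u1 => c t /(congr1 (fun x => x ^+ 2)); rewrite cmod_sqr/= expr1n => cs.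
rewrite -(leb2_integral_rotate cs mg g0); apply: eq_integral => p _.
have e : c2 (c * p.1 - t * p.2, t * p.1 + c * p.2) = (c +i* t) * c2 p.
  by rewrite /c2; apply/eqP; rewrite eq_complex/= eqxx/= addrC.
have e2 : (c * p.1 - t * p.2, t * p.1 + c * p.2) =
    (complex.Re ((c +i* t) * c2 p), complex.Im ((c +i* t) * c2 p)).
  by rewrite -e.
rewrite !patchE e2; congr (if _ then _ else _).
have u1 : cmod (c +i* t) = 1.
  by apply/eqP; rewrite -(@eqrXn2 _ 2)// ?cmod_ge0// cmod_sqr/= cs expr1n.
by apply/idP/idP; rewrite !inE !B0E c2K cmodM u1 mul1r.
Qed.

Lemma integral_disc_mulc (u : C) (s : R) (f : R * R -> \bar R) : cmod u = 1 ->
  measurable_fun setT f ->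
  (\int[mu2]_(p in B 0 s) f (complex.Re (u * c2 p), complex.Im (u * c2 p))%R =
   \int[mu2]_(p in B 0 s) f p)%E.
Proof.
move=> u1 mf; rewrite integralE [RHS]integralE; congr (_ - _)%E.
  etransitivity; last exact: (ge0_integral_disc_mulc s u1 (measurable_funepos mf) (funepos_ge0 f)).
  by apply: eq_integral => p _; rewrite !funeposE.
etransitivity; last exact: (ge0_integral_disc_mulc s u1 (measurable_funeneg mf) (funeneg_ge0 f)).
by apply: eq_integral => p _; rewrite !funenegE.
Qed.

Lemma Rintegral_disc_mulc (u : C) (s : R) (g : C -> R) : cmod u = 1 ->
  measurable_fun setT (fun p => g (c2 p)) ->
  \int[mu2]_(p in B 0 s) g (u * c2 p) = \int[mu2]_(p in B 0 s) g (c2 p).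
Proof.
move=> u1 mg; rewrite /Rintegral; congr fine.
have /(integral_disc_mulc s u1) <- : measurable_fun setT (fun p => (g (c2 p))%:E).
  exact/measurable_EFinP.
by apply: eq_integral => p _; rewrite c2K.
Qed.

Lemma integral_translate (w : C) (s : R) (f : C -> \bar R) :
  measurable_fun setT (fun p => f (c2 p)) ->
  (\int[mu2]_(p in B w s) f (c2 p) = \int[mu2]_(p in B 0 s) f (c2 p + w)%R)%E.
Proof.
have ge0 (g : C -> \bar R) : measurable_fun setT (fun p => g (c2 p)) -> (forall z, 0 <= g z)%E ->
    (\int[mu2]_(p in B w s) g (c2 p) = \int[mu2]_(p in B 0 s) g (c2 p + w)%R)%E.
  move=> mg g0; rewrite integral_mkcond [RHS]integral_mkcond.
  have mg' : measurable_fun setT ((fun p => g (c2 p)) \_ (B w s)).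
    by apply/(measurable_restrictT _ (measurable_B w s)); exact: measurable_funTS.
  have g0' p : (0 <= ((fun p => g (c2 p)) \_ (B w s)) p)%E by rewrite patchE; case: ifP.
  rewrite -(leb2_integral_translate (complex.Re w) (complex.Im w) mg' g0').
  apply: eq_integral => p _; rewrite !patchE c2_translate; congr (if _ then _ else _).
  by apply/idP/idP; rewrite !inE /B/= c2_translate addrK subr0.
move=> mf; rewrite integralE [RHS]integralE; congr (_ - _)%E.
  have mp : measurable_fun setT (fun p => (f^\+)%E (c2 p)).
    by have := measurable_funepos mf; apply: eq_measurable_fun => p _; rewrite !funeposE.
  etransitivity; last (etransitivity; first exact: (ge0 _ mp (funepos_ge0 f))).
    by apply: eq_integral => p _; rewrite !funeposE.
  by apply: eq_integral => p _; rewrite !funeposE.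
have mp : measurable_fun setT (fun p => (f^\-)%E (c2 p)).
  by have := measurable_funeneg mf; apply: eq_measurable_fun => p _; rewrite !funenegE.
etransitivity; last (etransitivity; first exact: (ge0 _ mp (funeneg_ge0 f))).
  by apply: eq_integral => p _; rewrite !funenegE.
by apply: eq_integral => p _; rewrite !funenegE.
Qed.

Lemma integrable_bounded (A : set (R * R)) (f : R * R -> R) (K : R) :
  measurable A -> (mu2 A < +oo)%E -> measurable_fun A f ->
  (forall p, A p -> `|f p| <= K) -> mu2.-integrable A (EFin \o f).
Proof.
move=> mA Aoo mf fK.
apply: measurable_bounded_integrable => //.
exists K; split; first exact: num_real.
by move=> M KM p Ap /=; rewrite (le_trans (fK p Ap))// ltW.
Qed.

Lemma leb2_RintegralD (A : set (R * R)) (f g : R * R -> R) : measurable A ->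
  mu2.-integrable A (EFin \o f) -> mu2.-integrable A (EFin \o g) ->
  \int[mu2]_(p in A) (f p + g p) = \int[mu2]_(p in A) f p + \int[mu2]_(p in A) g p.
Proof. by move=> mA jf jg; apply: RintegralD. Qed.

Lemma leb2_RintegralZl (A : set (R * R)) (f : R * R -> R) (r : R) : measurable A ->
  mu2.-integrable A (EFin \o f) ->
  \int[mu2]_(p in A) (r * f p) = r * \int[mu2]_(p in A) f p.
Proof. by move=> mA jf; apply: RintegralZl. Qed.

Lemma leb2_le_Rintegral (A : set (R * R)) (f g : R * R -> R) : measurable A ->
  mu2.-integrable A (EFin \o f) -> mu2.-integrable A (EFin \o g) ->
  (forall p, A p -> f p <= g p) ->
  \int[mu2]_(p in A) f p <= \int[mu2]_(p in A) g p.
Proof. by move=> mA jf jg fg; apply: le_Rintegral. Qed.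

Lemma leb2_Rintegral_cst (a : C) (r k : R) : 0 < r ->
  \int[mu2]_(p in B a r) k = k * (alpha * r ^+ 2).
Proof. by move=> r0; rewrite Rintegral_cst//= mu2_B. Qed.

Lemma leb2D (A A' : set (R * R)) : measurable A -> measurable A' -> (mu2 A < +oo)%E ->
  A' `<=` A -> (mu2 (A `\` A') = mu2 A - mu2 A')%E.
Proof. by move=> mA mA' Aoo AA'; rewrite (measureD mA mA' Aoo) setIidr. Qed.

End disc_integrals.

(** * The area mean of [ln |z - b|] over a disc *)

Section log_potential.
Context {R : realType}.
Local Notation C := R[i].
Local Notation mu2 := (@leb2 R).
Local Open Scope complex_scope.

Lemma mu2_B_lty (a : C) (r : R) : 0 < r -> (mu2 (B a r) < +oo)%E.
Proof. by move=> r0; rewrite mu2_B// ltry. Qed.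

Lemma measurable_invr : measurable_fun setT (@GRing.inv R).
Proof.
have mD : measurable ([set 0 : R]) by exact: measurable_set1.
rewrite -(setvU [set 0 : R]); apply/measurable_funU => //; first exact: measurableC.
split; last exact: measurable_fun_set1.
apply: open_continuous_measurable_fun.
  by apply: closed_openC; exact: closed_eq.
move=> x; rewrite inE => /eqP x0; exact: inv_continuous.
Qed.

Section fixed.
Variables (b : C) (s : R).
Hypotheses (b0 : b != 0) (s0 : 0 < s).

Let Mx (z : C) := Num.max (cmod z) (cmod b).
Let Mn (z : C) := Num.min (cmod z) (cmod b).
Let gap (z : C) := 1 - Mn z / Mx z.

Let cb0 : 0 < cmod b. Proof. by rewrite cmod_gt0. Qed.
Let Mx0 z : 0 < Mx z. Proof. by rewrite lt_max cb0 orbT. Qed.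
Let Mn0 z : 0 <= Mn z. Proof. by rewrite le_min !cmod_ge0. Qed.

Let mcz : measurable_fun setT (fun p : R * R => cmod (c2 p)).
Proof. exact: measurable_cmod (@cmeasurable_c2 R). Qed.

Let mMx : measurable_fun setT (fun p => Mx (c2 p)).
Proof. by apply: measurable_maxr => //; exact: measurable_cst. Qed.

Let mgap : measurable_fun setT (fun p => gap (c2 p)).
Proof.
apply: measurable_funB; first exact: measurable_cst.
apply: measurable_funM.
  by apply: measurable_minr => //; exact: measurable_cst.
exact: (measurableT_comp measurable_invr mMx).
Qed.

Let gapE z : gap z = (Mx z - Mn z) / Mx z.
Proof. by rewrite /gap mulrBl divff// gt_eqF. Qed.

Let gap_gt0 z : cmod z != cmod b -> 0 < gap z.
Proof.
move=> h; rewrite gapE divr_gt0// /Mx /Mn; case: (ltgtP (cmod z) (cmod b)) h => // h _; rewrite subr_gt0//.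
Qed.

Let gap_le1 z : gap z <= 1.
Proof. by rewrite /gap lerBlDr lerDl divr_ge0// ltW. Qed.

(** A majorant independent of the exponent: for every [n > 0], [|z^n - b^n| / max(|z|, |b|)^n] lies
    between [gap z] and [2], so its logarithm is at most [E z] in absolute value. *)
Let E (z : C) := ln 2 + ln (gap z)^-1.

Let mE : measurable_fun setT (fun p => E (c2 p)).
Proof.
apply: measurable_funD; first exact: measurable_cst.
apply: (measurableT_comp (@measurable_ln R)); exact: (measurableT_comp measurable_invr mgap).
Qed.

Let E_ge0 z : 0 <= E z.
Proof.
rewrite addr_ge0//; first by rewrite ln_ge0// ler1n.
have [h|h] := eqVneq (cmod z) (cmod b); last by rewrite ln_ge0// invf_ge1 ?gap_le1 ?gap_gt0.
by rewrite gapE /Mx /Mn h maxxx minxx subrr mul0r invr0 ln0.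
Qed.

(** Level [0] is bounded by the whole disc, which accounts for [s ^+ 2]. At a later level put
    [d = 2 ^- k <= 1/2]: then [gap <= d] places [|z|] between [|b| (1 - d)] and
    [|b| / (1 - d) < |b| (1 + 3 d)], and [(1 + 3 d)^2 - (1 - d)^2 = d (8 + 8 d) <= 12 d]. *)
Let annulus k : (mu2 (B 0 s `&` [set p | (gap (c2 p) <= 2 ^- k)%R]) <=
  (alpha * (s ^+ 2 + 12 * cmod b ^+ 2) * 2 ^- k)%:E)%E.
Proof.
have a0 := @alpha_gt0 R.
have mk : measurable [set p : R * R | (gap (c2 p) <= 2 ^- k)%R].
  have -> : [set p : R * R | (gap (c2 p) <= 2 ^- k)%R] = (fun p => gap (c2 p)) @^-1` `]-oo, 2 ^- k]%classic.
    by rewrite set_itvNyc.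
  by rewrite -[X in measurable X]setTI; exact: mgap.
case: k mk => [|k] mk.
  rewrite expr0 invr1 in mk *; rewrite mulr1 (@le_trans _ _ (mu2 (B 0 s)))//.
    by apply: le_measure; rewrite ?inE//; exact: measurableI.
  by rewrite mu2_B// lee_fin ler_pM2l// lerDl mulr_ge0// sqr_ge0.
set d := 2 ^- k.+1; have d0 : 0 < d by rewrite invr_gt0 exprn_gt0.
have d1 : d <= 2^-1.
  by rewrite /d exprS invfM ler_piMr ?invr_ge0// invf_le1 ?exprn_gt0// exprn_ege1// ler1n.
have mA : measurable (B 0 (cmod b * (1 + 3 * d)) `\` B 0 (cmod b * (1 - d))).
  exact: measurableD.
apply: (@le_trans _ _ (mu2 (B 0 (cmod b * (1 + 3 * d)) `\` B 0 (cmod b * (1 - d))))).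
  apply: le_measure; rewrite ?inE//; first exact: measurableI.
  move=> p [_ /=]; rewrite -/d gapE ler_pdivrMr// => h.
  rewrite /setD/= !B0E; split; move: h; rewrite /Mx /Mn;
    case: (leP (cmod (c2 p)) (cmod b)) => hb h.
  - apply: le_lt_trans hb _; rewrite ltr_pMr//; lra.
  - have h1 : cmod (c2 p) * (1 - d) <= cmod b by lra.
    have : cmod b < cmod b * (1 + 3 * d) * (1 - d).
      by rewrite -mulrA ltr_pMr//; nra.
    move=> h2; have {h1 h2} := le_lt_trans h1 h2.
    by rewrite ltr_pM2r//; lra.
  - by apply/negP; rewrite -leNgt; lra.
  - by apply/negP; rewrite -leNgt; have := mulr_gt0 cb0 d0; lra.
rewrite leb2D//; last 2 first.
- by apply: mu2_B_lty; rewrite mulr_gt0//; lra.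
- move=> p; rewrite !B0E => h; apply: lt_le_trans h _; rewrite ler_pM2l//; lra.
have [p1 p2] : 0 < cmod b * (1 + 3 * d) /\ 0 < cmod b * (1 - d).
  by split; rewrite mulr_gt0//; lra.
rewrite !mu2_B//.
rewrite -EFinB lee_fin -mulrBr -mulrA ler_pM2l// !exprMn -mulrBr.
have q0 : 0 < cmod b ^+ 2 by rewrite exprn_gt0.
have s2 : 0 <= s ^+ 2 by rewrite exprn_ge0// ltW.
have -> : (1 + 3 * d) ^+ 2 - (1 - d) ^+ 2 = d * (8 + 8 * d) by ring.
have h1 : 8 + 8 * d <= 12 by lra.
have h2 : 0 <= s ^+ 2 * d by rewrite mulr_ge0// ltW.
have := ler_wpM2l (ltW (mulr_gt0 q0 d0)) h1; lra.
Qed.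

Let iE : mu2.-integrable (B 0 s) (fun p => (E (c2 p))%:E).
Proof.
apply/integrableP; split; first exact/measurable_EFinP/measurable_funTS.
apply: (@le_lt_trans _ _ (\int[mu2]_(p in B 0 s) ((ln 2)%:E + dyad (gap (c2 p))))%E).
  apply: ge0_le_integral => //.
  - by apply/measurable_EFinP; apply: measurableT_comp => //; exact: measurable_funTS.
  - apply: emeasurable_funD; first exact: measurable_cst.
    by apply: measurable_funTS; exact: (measurableT_comp measurable_dyad mgap).
  - move=> p _; rewrite gee0_abs ?lee_fin// EFinD; apply: leeD => //.
    have [h|h] := eqVneq (cmod (c2 p)) (cmod b); last exact: lnV_le_dyad (gap_gt0 h).
    by rewrite gapE /Mx /Mn h maxxx minxx subrr mul0r invr0 ln0// dyad_ge0.
rewrite ge0_integralD//; last 3 first.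
- by move=> p _; rewrite lee_fin ln_ge0// ler1n.
- by move=> p _; exact: dyad_ge0.
- by apply: measurable_funTS; exact: (measurableT_comp measurable_dyad mgap).
rewrite integral_cst//= mu2_B// -EFinM.
apply: lte_add_pinfty; first exact: ltry.
apply: le_lt_trans (ge0_integral_dyad _ mgap _ annulus) (ltry _) => //.
apply: mulr_ge0; first exact: ltW (@alpha_gt0 R).
by rewrite addr_ge0 ?sqr_ge0// mulr_ge0// sqr_ge0.
Qed.


(** The part of [ln |z - b|] that must integrate to zero is [u 0], its excess over
    [ln (max |z| |b|)]. The other [u k] replace [z] and [b] by their powers [2 ^ k] and rescale,
    which makes them small without changing the integral. *)
Let u (k : nat) (z : C) : R :=
  if cmod z == cmod b then 0
  else 2 ^- k * ln (cmod (z ^+ (2 ^ k) - b ^+ (2 ^ k)) / Mx z ^+ (2 ^ k)).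

Let mu_ k : measurable_fun setT (fun p => u k (c2 p)).
Proof.
apply: measurable_fun_ifT.
- by apply: measurable_fun_eqr => //; exact: measurable_cst.
- exact: measurable_cst.
- apply: measurable_funM; first exact: measurable_cst.
  apply: (measurableT_comp (@measurable_ln R)); apply: measurable_funM.
    apply: measurable_cmod; apply: cmeasurableD.
      exact: cmeasurableX (@cmeasurable_c2 R).
    exact: cmeasurable_cst.
  by apply: (measurableT_comp measurable_invr); exact: measurable_funX.
Qed.

Let u_le k z : `|u k z| <= 2 ^- k * E z.
Proof.
rewrite /u; case: ifPn => [_|h]; first by rewrite normr0 mulr_ge0// invr_ge0 exprn_ge0.
rewrite normrM ger0_norm ?invr_ge0 ?exprn_ge0// ler_pM2l ?invr_gt0 ?exprn_gt0//.
set n := (2 ^ k)%N; have n0 : (0 < n)%N by rewrite expn_gt0.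
have Mn_lt : Mn z < Mx z.
  by rewrite /Mx /Mn; case: (ltgtP (cmod z) (cmod b)) h.
have up : cmod (z ^+ n - b ^+ n) <= 2 * Mx z ^+ n.
  rewrite (le_trans (cmodB _ _))// !cmodX mulrDl mul1r lerD//;
    by rewrite lerXn2r ?nnegrE ?cmod_ge0 ?(ltW (Mx0 z))// le_max lexx ?orbT.
have lo : (Mx z - Mn z) / Mx z * Mx z ^+ n <= cmod (z ^+ n - b ^+ n).
  have h1 : Mx z ^+ n - Mn z ^+ n <= cmod (z ^+ n - b ^+ n).
    rewrite /Mx /Mn; case: (leP (cmod z) (cmod b)) => _.
      by rewrite cmodBC -!cmodX cmodB_ge.
    by rewrite -!cmodX cmodB_ge.
  apply: le_trans h1.
  case: n n0 {up} => // n _; rewrite !exprS mulrA divfK ?gt_eqF//.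
  rewrite mulrBl lerD2l lerN2 ler_wpM2l//.
  by rewrite lerXn2r ?nnegrE ?(ltW (Mx0 z))// ltW.
have Mxn : 0 < Mx z ^+ n by rewrite exprn_gt0.
have g0 := gap_gt0 h.
have lo' : gap z <= cmod (z ^+ n - b ^+ n) / Mx z ^+ n by rewrite ler_pdivlMr// gapE.
have up' : cmod (z ^+ n - b ^+ n) / Mx z ^+ n <= 2 by rewrite ler_pdivrMr.
have r0 : 0 < cmod (z ^+ n - b ^+ n) / Mx z ^+ n by exact: lt_le_trans lo'.
have l2 : 0 <= ln 2 :> R by rewrite ln_ge0// ler1n.
have lg : ln (gap z) <= 0 by rewrite ln_le0.
have l1 : ln (gap z) <= ln (cmod (z ^+ n - b ^+ n) / Mx z ^+ n) by rewrite ler_ln ?posrE.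
have l3 : ln (cmod (z ^+ n - b ^+ n) / Mx z ^+ n) <= ln 2 by rewrite ler_ln ?posrE.
by rewrite /E lnV ?posrE// ler_norml; lra.
Qed.

Let iu k : mu2.-integrable (B 0 s) (fun p => (u k (c2 p))%:E).
Proof.
apply: (le_integrable _ _ _ (integrableZl _ (2 ^- k) iE)) => //.
  exact/measurable_EFinP/measurable_funTS.
move=> p _; rewrite -EFinM !abse_EFin lee_fin (le_trans (u_le _ _))// ler_norm//.
Qed.

(** With [n = 2 ^ k] and [w ^+ n = -1], the product of [z^n - b^n] and [(w z)^n - b^n] is
    [- (z^(2n) - b^(2n))]. Thus [u k.+1] is the mean of [u k] at [z] and at [w z], and rotations
    preserve the integral. *)
Let uS k : \int[mu2]_(p in B 0 s) u k.+1 (c2 p) = \int[mu2]_(p in B 0 s) u k (c2 p).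
Proof.
pose w : C := (2 ^ k)%N.-root (-1).
have n0 : (0 < 2 ^ k)%N by rewrite expn_gt0.
have wn : w ^+ (2 ^ k) = -1 by rewrite /w rootCK.
have w1 : cmod w = 1.
  apply/eqP; rewrite -(@eqrXn2 _ (2 ^ k))// ?cmod_ge0// -cmodX wn cmodN cmod1 expr1n//.
have iuw : mu2.-integrable (B 0 s) (fun p => (u k (w * c2 p))%:E).
  apply: (le_integrable _ _ _ (integrableZl _ (2 ^- k) iE)) => //.
    apply/measurable_EFinP/measurable_funTS.
    have := measurableT_comp (mu_ k) (measurable_mulc w).
    by apply: eq_measurable_fun => p _ /=; rewrite c2K.
  move=> p _; rewrite -EFinM !abse_EFin lee_fin.
  rewrite (le_trans (u_le _ _))// /E /gap /Mn /Mx cmodM w1 mul1r ler_norm//.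
rewrite (_ : \int[mu2]_(p in B 0 s) u k.+1 (c2 p) =
   \int[mu2]_(p in B 0 s) (2^-1 * (u k (c2 p) + u k (w * c2 p)))); last first.
  apply: eq_Rintegral => p _; rewrite /u /Mx cmodM w1 mul1r.
  case: ifPn => [_|h]; first by rewrite addr0 mulr0.
  have ne : (cmod (c2 p) ^+ (2 ^ k) != cmod b ^+ (2 ^ k)).
    by rewrite eqrXn2// ?cmod_ge0.
  have p1 : 0 < cmod (c2 p ^+ (2 ^ k) - b ^+ (2 ^ k)).
    rewrite cmod_gt0 subr_eq0; apply: contra ne => /eqP e.
    by rewrite -!cmodX e.
  have p2 : 0 < cmod ((w * c2 p) ^+ (2 ^ k) - b ^+ (2 ^ k)).
    rewrite cmod_gt0 subr_eq0; apply: contra ne => /eqP e.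
    by rewrite -!cmodX -e exprMn wn mulN1r cmodN.
  have M0 : 0 < Num.max (cmod (c2 p)) (cmod b) ^+ (2 ^ k) by rewrite exprn_gt0// Mx0.
  rewrite -mulrDr -lnM ?posrE ?divr_gt0// [RHS]mulrA.
  rewrite (_ : 2^-1 * 2 ^- k = 2 ^- k.+1 :> R); last by rewrite -invfM -exprS.
  congr (_ * ln _).
  rewrite mulrACA -invfM -exprD -cmodM addnn -muln2 -expnSr; congr (_ / _).
  rewrite -cmodN; congr (cmod _).
  rewrite exprMn wn expnS mul2n -addnn !exprD; ring.
rewrite leb2_RintegralZl//; last first.
  have := integrableD _ (iu k) iuw; apply => //.
rewrite (leb2_RintegralD (measurable_B 0 s) (iu k) iuw) (Rintegral_disc_mulc s w1 (mu_ k)).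
by lra.
Qed.

(** The integral of [u k] does not depend on [k] and is at most [2 ^- k] times that of [E]. *)
Let u0 : \int[mu2]_(p in B 0 s) u 0 (c2 p) = 0.
Proof.
have h k : `|\int[mu2]_(p in B 0 s) u 0 (c2 p)| <= 2 ^- k * \int[mu2]_(p in B 0 s) E (c2 p).
  have -> : \int[mu2]_(p in B 0 s) u 0 (c2 p) = \int[mu2]_(p in B 0 s) u k (c2 p).
    by elim: k => // k ->; rewrite uS.
  apply: le_trans (le_normr_Rintegral _ (iu k)) _ => //.
  rewrite -leb2_RintegralZl//; apply: (leb2_le_Rintegral (measurable_B 0 s)).
  - exact: (integrable_norm (iu k)).
  - exact: (integrableZl (measurable_B 0 s) (2 ^- k) iE).
  - by move=> p _; exact: u_le.
have I0 : 0 <= \int[mu2]_(p in B 0 s) E (c2 p) by apply: Rintegral_ge0.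
apply/eqP; rewrite -normr_eq0 eq_le normr_ge0 andbT.
apply/ler_addgt0Pr => e e0; rewrite add0r.
set I := \int[mu2]_(p in B 0 s) E (c2 p) in h I0 *.
have := @cvg_geometric R I (2^-1).
rewrite ger0_norm ?invr_ge0// invf_lt1// ltr1n => /(_ isT)/cvgrPdist_lt/(_ _ e0)[N _ /(_ N (leqnn _))].
rewrite /= sub0r normrN exprVn => h2; apply: le_trans (h N) _.
by rewrite mulrC; apply: ltW; apply: le_lt_trans (ler_norm _) h2.
Qed.

Let iM : mu2.-integrable (B 0 s) (fun p => (ln (Mx (c2 p)))%:E).
Proof.
apply: (@integrable_bounded _ _ _ (`|ln (cmod b)| + `|ln (Num.max s (cmod b))|)) => //.
- exact: mu2_B_lty.
- by apply: measurable_funTS; exact: (measurableT_comp (@measurable_ln R) mMx).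
- move=> p; rewrite B0E => ps.
  have l1 : ln (cmod b) <= ln (Mx (c2 p)) by rewrite ler_ln ?posrE// le_max lexx orbT.
  have l2 : ln (Mx (c2 p)) <= ln (Num.max s (cmod b)).
    rewrite ler_ln ?posrE// ?lt_max ?s0// /Mx ge_max !le_max (ltW ps) lexx orbT//.
  have := ler_norm (ln (Num.max s (cmod b))); have := ler_norm (- ln (cmod b)).
  rewrite normrN ler_norml => ? ?; have := normr_ge0 (ln (cmod b)).
  have := normr_ge0 (ln (Num.max s (cmod b))); lra.
Qed.

Let aeP : {ae mu2, forall p, ln (cmod (c2 p - b)) = u 0 (c2 p) + ln (Mx (c2 p))}.
Proof.
exists [set p | cmod (c2 p) = cmod b]; split.
- have -> : [set p : R * R | cmod (c2 p) = cmod b] = (fun p => cmod (c2 p)) @^-1` [set cmod b].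
    by apply/seteqP; split=> p.
  by rewrite -[X in measurable X]setTI; apply: mcz.
- exact: mu2_circle.
- move=> p /= h; apply: contrapT => /eqP ne; apply: h.
  rewrite /u (negbTE ne) expr0 invr1 mul1r !expr1 ln_div ?posrE//; first by rewrite subrK.
  rewrite cmod_gt0 subr_eq0; apply: contra ne => /eqP ->//.
Qed.

Let mln : measurable_fun setT (fun p => ln (cmod (c2 p - b))).
Proof. exact: (measurableT_comp (@measurable_ln R) (measurable_cmod_c2 b)). Qed.

Lemma integrable_log_potential :
  mu2.-integrable (B 0 s) (fun p => (ln (cmod (c2 p - b)))%:E).
Proof.
have h : mu2.-integrable (B 0 s) (fun p => (u 0 (c2 p) + ln (Mx (c2 p)))%:E).
  by under eq_fun do rewrite EFinD; apply: integrableD.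
apply/integrableP; split; first exact/measurable_EFinP/measurable_funTS.
case/integrableP: h => mh; apply: le_lt_trans; rewrite le_eqVlt; apply/orP; left; apply/eqP.
apply: ge0_ae_eq_integral => //.
- by apply: measurableT_comp => //; exact/measurable_EFinP/measurable_funTS.
- exact: measurableT_comp.
- by apply: filterS aeP => p e _; rewrite e.
Qed.

(** This is the circle mean of [ln |z - b|] integrated over radii, obtained on the whole disc by the
    symmetry of [u] instead of circle by circle. *)
Lemma Rintegral_log_potential :
  \int[mu2]_(p in B 0 s) ln (cmod (c2 p - b)) =
  \int[mu2]_(p in B 0 s) ln (Num.max (cmod (c2 p)) (cmod b)).
Proof.
transitivity (\int[mu2]_(p in B 0 s) (u 0 (c2 p) + ln (Mx (c2 p)))); last first.
  by rewrite (leb2_RintegralD (measurable_B 0 s) (iu 0) iM) u0 add0r.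
congr fine; apply: ae_eq_integral => //.
- exact/measurable_EFinP/measurable_funTS.
- apply/measurable_EFinP; apply: measurable_funD; apply: measurable_funTS; first exact: mu_.
  exact: (measurableT_comp (@measurable_ln R) mMx).
- by apply: filterS aeP => p e _; rewrite e.
Qed.

End fixed.
End log_potential.

(** * Complex line integrals and Goursat's theorem *)

Section real_interval_integrals.
Context {R : realType}.
Local Notation mu := (@lebesgue_measure R).
Implicit Types (f g : R -> R) (a b : R).

Definition rcont_on f a b := forall x, a <= x <= b ->
  forall e, 0 < e -> exists2 d, 0 < d & forall t, `|t - x| < d -> `|f t - f x| < e.

Lemma rcont_on_within f a b : rcont_on f a b -> {within `[a, b], continuous f}.
Proof.
move=> cf; apply: continuous_in_subspaceT => x; rewrite inE/= in_itv/= => xab.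
apply/cvgrPdist_lt => e e0; have [d d0 h] := cf x xab e e0.
apply/nbhs_ballP; exists d => //= t; rewrite /ball/= => xt.
by rewrite distrC; apply: h; rewrite distrC.
Qed.

Lemma rcont_on_integrable f a b : rcont_on f a b ->
  mu.-integrable `[a, b] (EFin \o f).
Proof.
move=> cf; apply: continuous_compact_integrable; first exact: segment_compact.
exact: rcont_on_within.
Qed.

Lemma rint_split f a m b : a <= m -> m <= b -> mu.-integrable `[a, b] (EFin \o f) ->
  \int[mu]_(x in `[a, b]) f x = \int[mu]_(x in `[a, m]) f x + \int[mu]_(x in `[m, b]) f x.
Proof.
move=> am mb jf.
have := @Rintegral_itvB R f (BLeft a) (BRight b) m jf.
rewrite !bnd_simp => /(_ am mb) h.
rewrite -[X in _ + X]Rintegral_itv_obnd_cbnd.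
  by rewrite -h addrC subrK.
apply: integrableS jf => //; apply: subset_itv; rewrite bnd_simp//.
Qed.

Lemma rint_cst a b k : a <= b -> \int[mu]_(x in `[a, b]) k = k * (b - a).
Proof.
move=> ab; rewrite Rintegral_cst//= lebesgue_measure_itv/= lte_fin.
case: ltP => ab'; rewrite -?EFinB//=.
have -> : a = b by apply: le_anti; rewrite ab.
by rewrite subrr.
Qed.

Lemma integrable_itv_cst a b k : mu.-integrable `[a, b] (EFin \o (fun=> k)).
Proof.
apply: rcont_on_integrable => x _ e e0; exists 1 => // t _; by rewrite subrr normr0.
Qed.

Lemma rint_norm_le f a b k : a <= b -> mu.-integrable `[a, b] (EFin \o f) ->
  (forall x, a <= x <= b -> `|f x| <= k) -> `|\int[mu]_(x in `[a, b]) f x| <= k * (b - a).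
Proof.
move=> ab jf fk; apply: le_trans (le_normr_Rintegral _ jf) _ => //.
rewrite -(rint_cst k ab); apply: le_Rintegral => //.
- exact: integrable_norm.
- exact: integrable_itv_cst.
Qed.

Lemma measurable_Ritv a b : measurable (`[a, b]%classic : set (measurableTypeR R)).
Proof. exact: measurable_itv. Qed.

Lemma integrable_itvD f g a b : mu.-integrable `[a, b] (EFin \o f) ->
  mu.-integrable `[a, b] (EFin \o g) -> mu.-integrable `[a, b] (EFin \o (fun x => f x + g x)).
Proof. by move=> jf jg; have h := integrableD (measurable_Ritv a b) jf jg; exact: h. Qed.

Lemma integrable_itvZ f k a b : mu.-integrable `[a, b] (EFin \o f) ->
  mu.-integrable `[a, b] (EFin \o (fun x => k * f x)).
Proof. by move=> jf; have h := integrableZl (measurable_Ritv a b) k jf; exact: h. Qed.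

Lemma integrable_itvB f g a b : mu.-integrable `[a, b] (EFin \o f) ->
  mu.-integrable `[a, b] (EFin \o g) -> mu.-integrable `[a, b] (EFin \o (fun x => f x - g x)).
Proof. by move=> jf jg; have h := integrableB (measurable_Ritv a b) jf jg; exact: h. Qed.

End real_interval_integrals.

Section complex_interval_integrals.
Context {R : realType}.
Local Notation C := R[i].
Local Notation mu := (@lebesgue_measure R).
Local Open Scope complex_scope.
Implicit Types (f g : R -> C) (a b : R).

Definition cint f a b : C :=
  (\int[mu]_(x in `[a, b]) complex.Re (f x)) +i* (\int[mu]_(x in `[a, b]) complex.Im (f x)).

Definition cintegrable f a b :=
  mu.-integrable `[a, b] (EFin \o (fun x => complex.Re (f x))) /\
  mu.-integrable `[a, b] (EFin \o (fun x => complex.Im (f x))).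

Definition ccont_on f a b := forall x, a <= x <= b ->
  forall e, 0 < e -> exists2 d, 0 < d & forall t, `|t - x| < d -> cmod (f t - f x) < e.

Lemma ccont_on_Re f a b : ccont_on f a b -> rcont_on (fun x => complex.Re (f x)) a b.
Proof.
move=> cf x xab e e0; have [d d0 h] := cf x xab e e0; exists d => // t /h.
by apply: le_lt_trans; rewrite -ReN -ReD; exact: Re_le_cmod.
Qed.

Lemma ccont_on_Im f a b : ccont_on f a b -> rcont_on (fun x => complex.Im (f x)) a b.
Proof.
move=> cf x xab e e0; have [d d0 h] := cf x xab e e0; exists d => // t /h.
by apply: le_lt_trans; rewrite -ImN -ImD; exact: Im_le_cmod.
Qed.

Lemma ccont_on_integrable f a b : ccont_on f a b -> cintegrable f a b.
Proof.
move=> cf; split; apply: rcont_on_integrable; [exact: ccont_on_Re|exact: ccont_on_Im].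
Qed.

Lemma cintegrable_cst k a b : cintegrable (fun=> k) a b.
Proof. by split; exact: integrable_itv_cst. Qed.

Lemma cintegrableS f a b a' b' : a <= a' -> b' <= b -> cintegrable f a b -> cintegrable f a' b'.
Proof.
by move=> aa bb [h1 h2]; split; [apply: integrableS h1|apply: integrableS h2] => //;
  apply: subset_itv; rewrite bnd_simp.
Qed.

Lemma cint_cst k a b : a <= b -> cint (fun=> k) a b = k * (b - a)%:C.
Proof.
move=> ab; rewrite /cint !rint_cst//; case: k => x y /=.
by apply/eqP; rewrite eq_complex/= !mulr0 subr0 add0r !eqxx.
Qed.

Lemma eq_cint f g a b : (forall x, a <= x <= b -> f x = g x) -> cint f a b = cint g a b.
Proof.
by move=> fg; rewrite /cint; congr (_ +i* _); apply: eq_Rintegral => x;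
  rewrite inE/= in_itv/= => /fg ->.
Qed.

Lemma cintD f g a b : cintegrable f a b -> cintegrable g a b ->
  cint (fun x => f x + g x) a b = cint f a b + cint g a b.
Proof.
move=> [f1 f2] [g1 g2]; rewrite /cint.
under eq_Rintegral do rewrite ReD.
under [X in _ +i* X]eq_Rintegral do rewrite ImD.
by rewrite !RintegralD.
Qed.

Lemma cintegrableD f g a b : cintegrable f a b -> cintegrable g a b ->
  cintegrable (fun x => f x + g x) a b.
Proof.
move=> [f1 f2] [g1 g2]; split.
  by under [X in EFin \o X]eq_fun do rewrite ReD; exact: integrable_itvD.
by under [X in EFin \o X]eq_fun do rewrite ImD; exact: integrable_itvD.
Qed.

Lemma cintegrableZ f k a b : cintegrable f a b -> cintegrable (fun x => k * f x) a b.
Proof.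
move=> [f1 f2]; split.
  under [X in EFin \o X]eq_fun do rewrite ReM.
  by apply: integrable_itvB; exact: integrable_itvZ.
under [X in EFin \o X]eq_fun do rewrite ImM.
by apply: integrable_itvD; exact: integrable_itvZ.
Qed.

Lemma cintZ f k a b : cintegrable f a b ->
  cint (fun x => k * f x) a b = k * cint f a b.
Proof.
move=> [f1 f2]; rewrite /cint.
under eq_Rintegral do rewrite ReM.
under [X in _ +i* X]eq_Rintegral do rewrite ImM.
rewrite RintegralB//; try exact: integrable_itvZ.
rewrite RintegralD//; try exact: integrable_itvZ.
by rewrite !RintegralZl//; case: k.
Qed.

Lemma cintB f g a b : cintegrable f a b -> cintegrable g a b ->
  cint (fun x => f x - g x) a b = cint f a b - cint g a b.
Proof.
move=> jf jg.
have e : cint (fun x => f x - g x) a b = cint (fun x => f x + -1 * g x) a b.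
  by apply: eq_cint => x _; rewrite mulN1r.
by rewrite e cintD//; [rewrite cintZ// mulN1r|exact: cintegrableZ].
Qed.

Lemma cint_conj f a b : cintegrable f a b ->
  cint (fun x => conjc (f x)) a b = conjc (cint f a b).
Proof.
move=> [f1 f2]; rewrite /cint/=.
have -> : (fun x => complex.Re (conjc (f x))) = (fun x => complex.Re (f x)).
  by apply/funext => x; case: (f x).
have -> : (fun x => complex.Im (conjc (f x))) = (fun x => - 1 * complex.Im (f x)).
  by apply/funext => x; case: (f x) => ? ?; rewrite mulN1r.
by rewrite RintegralZl// mulN1r.
Qed.

Lemma cint_split f a m b : a <= m -> m <= b -> cintegrable f a b ->
  cint f a b = cint f a m + cint f m b.
Proof. by move=> am mb [f1 f2]; rewrite /cint !(rint_split am mb)//. Qed.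

(** The factor [2] comes from estimating the real and imaginary parts separately; it propagates to
    all the Cauchy estimates. *)
Lemma cint_bound f a b k : a <= b -> cintegrable f a b ->
  (forall x, a <= x <= b -> cmod (f x) <= k) -> cmod (cint f a b) <= 2 * k * (b - a).
Proof.
move=> ab [f1 f2] fk; rewrite (le_trans (cmod_le_ReIm _))//= -mulrA mulrDl mul1r lerD//.
  by apply: rint_norm_le => // x /fk; exact: le_trans (Re_le_cmod _).
by apply: rint_norm_le => // x /fk; exact: le_trans (Im_le_cmod _).
Qed.

Lemma cint_near f a b K e : a <= b -> cintegrable f a b ->
  (forall x, a <= x <= b -> cmod (f x - K) <= e) ->
  cmod (cint f a b - K * (b - a)%:C) <= 2 * e * (b - a).
Proof.
move=> ab jf fk; rewrite -(cint_cst K ab) -cintB//; last exact: cintegrable_cst.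
apply: cint_bound => //; apply: (@cintegrableD _ (fun=> - K)) => //; exact: cintegrable_cst.
Qed.

End complex_interval_integrals.

(** * Goursat's bisection argument for an additive function of rectangles *)

Section bisection.
Context {R : realType}.
Variable J : R -> R -> R -> R -> R[i].
Variables (a b c d : R).
Hypotheses (ab : a <= b) (cd : c <= d).

(* [J a b c d] stands for an integral over the boundary of the rectangle [a, b] x [c, d]. *)
Hypothesis J_split1 : forall x m y u v, a <= x -> x <= m -> m <= y -> y <= b ->
  c <= u -> u <= v -> v <= d -> J x y u v = J x m u v + J m y u v.
Hypothesis J_split2 : forall x y u m v, a <= x -> x <= y -> y <= b ->
  c <= u -> u <= m -> m <= v -> v <= d -> J x y u v = J x y u m + J x y m v.
Hypothesis J_local : forall s t, a <= s <= b -> c <= t <= d -> forall e, 0 < e ->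
  exists2 r, 0 < r & forall x y u v, a <= x -> x <= s -> s <= y -> y <= b ->
    c <= u -> u <= t -> t <= v -> v <= d -> y - x < r -> v - u < r ->
    cmod (J x y u v) <= e * (y - x + (v - u)) ^+ 2.

Let h n := (b - a) / 2 ^+ n.
Let k n := (d - c) / 2 ^+ n.
Let JJ n (p : R * R) := J p.1 (p.1 + h n) p.2 (p.2 + k n).

Let hS n : h n = h n.+1 + h n.+1.
Proof. by rewrite /h exprS invfM; lra. Qed.
Let kS n : k n = k n.+1 + k n.+1.
Proof. by rewrite /k exprS invfM; lra. Qed.
Let h_ge0 n : 0 <= h n. Proof. by rewrite divr_ge0 ?exprn_ge0// subr_ge0. Qed.
Let k_ge0 n : 0 <= k n. Proof. by rewrite divr_ge0 ?exprn_ge0// subr_ge0. Qed.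

(** Selects the corner of a quarter that carries at least a fourth of [|J|]; when the first three
    quarters fail, the triangle inequality forces the fourth. *)
Let step n (p : R * R) : R * R :=
  let q1 := (p.1, p.2) in let q2 := (p.1 + h n.+1, p.2) in
  let q3 := (p.1, p.2 + k n.+1) in let q4 := (p.1 + h n.+1, p.2 + k n.+1) in
  let big q := cmod (JJ n p) <= 4 * cmod (JJ n.+1 q) in
  if big q1 then q1 else if big q2 then q2 else if big q3 then q3 else q4.

Let ok n (p : R * R) := [/\ a <= p.1, p.1 + h n <= b, c <= p.2 & p.2 + k n <= d].

Let stepP n p : ok n p -> (ok n.+1 (step n p) /\ cmod (JJ n p) <= 4 * cmod (JJ n.+1 (step n p))) /\
  [/\ p.1 <= (step n p).1, (step n p).1 + h n.+1 <= p.1 + h n, p.2 <= (step n p).2 &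
  (step n p).2 + k n.+1 <= p.2 + k n].
Proof.
case: p => x u [/= ax xb cu ud].
have := h_ge0 n.+1; have := k_ge0 n.+1; have := hS n; have := kS n => eK eH k0 h0.
set q := step n (x, u).
have [qc1 qc2] : (q.1 = x \/ q.1 = x + h n.+1) /\ (q.2 = u \/ q.2 = u + k n.+1).
  by rewrite /q /step; case: ifP => _ /=; [tauto|case: ifP => _ /=; [tauto|case: ifP => _ /=; tauto]].
have E : cmod (JJ n (x, u)) <= 4 * cmod (JJ n.+1 q).
  rewrite /q /step /=; case: ifPn => //= n1; case: ifPn => //= n2; case: ifPn => //= n3.
  rewrite leNgt; apply/negP => n4; move: n1 n2 n3; rewrite -!ltNge => n1 n2 n3.
  have : JJ n (x, u) = JJ n.+1 (x, u) + JJ n.+1 (x + h n.+1, u) +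
      (JJ n.+1 (x, u + k n.+1) + JJ n.+1 (x + h n.+1, u + k n.+1)).
    have -> : JJ n (x, u) = J x (x + h n) u (u + k n.+1) + J x (x + h n) (u + k n.+1) (u + k n).
      by apply: J_split2 => /=; lra.
    have -> : J x (x + h n) u (u + k n.+1) =
        J x (x + h n.+1) u (u + k n.+1) + J (x + h n.+1) (x + h n) u (u + k n.+1).
      by apply: J_split1 => /=; lra.
    have -> : J x (x + h n) (u + k n.+1) (u + k n) =
        J x (x + h n.+1) (u + k n.+1) (u + k n) + J (x + h n.+1) (x + h n) (u + k n.+1) (u + k n).
      by apply: J_split1 => /=; lra.
    have eh : x + h n.+1 + h n.+1 = x + h n by lra.
    have ek : u + k n.+1 + k n.+1 = u + k n by lra.
    by rewrite /JJ/= eh ek.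
  move=> /(congr1 (@cmod R)) e.
  have := cmodD (JJ n.+1 (x, u) + JJ n.+1 (x + h n.+1, u)) (JJ n.+1 (x, u + k n.+1) + JJ n.+1 (x + h n.+1, u + k n.+1)).
  have := cmodD (JJ n.+1 (x, u)) (JJ n.+1 (x + h n.+1, u)).
  have := cmodD (JJ n.+1 (x, u + k n.+1)) (JJ n.+1 (x + h n.+1, u + k n.+1)).
  rewrite -e; lra.
clear J_split1 J_split2 J_local.
by split; [split=> //; split|split]; case: qc1 => e1; case: qc2 => e2; lra.
Qed.

Let f := fix f n := if n is m.+1 then step m (f m) else (a, c).

Let f_ok n : ok n (f n).
Proof.
elim: n => [|n /stepP[[]]//]; rewrite /ok/= /h /k expr0 !divr1.
by split; lra.
Qed.

Let f_big n : cmod (J a b c d) <= 4 ^+ n * cmod (JJ n (f n)).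
Proof.
elim: n => [|n ih].
  by rewrite expr0 mul1r /JJ/= /h /k !expr0 !divr1 !subrKC.
have [[_ +] _] := stepP (f_ok n).
rewrite -/(f n.+1) exprS [4 * _]mulrC -mulrA => h1; apply: le_trans ih _.
have := ler_wpM2l (exprn_ge0 n (ler0n R 4)) h1; lra.
Qed.

Let f_mono n m : (n <= m)%N -> [/\ (f n).1 <= (f m).1, (f m).1 + h m <= (f n).1 + h n,
   (f n).2 <= (f m).2 & (f m).2 + k m <= (f n).2 + k n].
Proof.
elim: m => [|m ih]; first by rewrite leqn0 => /eqP ->.
rewrite leq_eqVlt => /predU1P[->//|]; rewrite ltnS => /ih[i1 i2 i3 i4].
have [_ [j1 j2 j3 j4]] := stepP (f_ok m).
by split; [exact: le_trans j1|exact: le_trans i2|exact: le_trans j3|exact: le_trans i4].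
Qed.

Let lim_point (g : nat -> R) (w : nat -> R) : (forall n, 0 <= w n) ->
  (forall n m, (n <= m)%N -> g n <= g m /\ g m + w m <= g n + w n) ->
  exists s, forall n, g n <= s <= g n + w n.
Proof.
move=> w0 gw.
have ub n : ubound (range g) (g n + w n).
  move=> _ [m _ <-]; case: (leqP n m) => nm.
    by have [_] := gw _ _ nm; have := w0 m; lra.
  by have [] := gw _ _ (ltnW nm); have := w0 n; lra.
have hs : has_sup (range g).
  by split; [exists (g 0); exists 0|exists (g 0 + w 0); exact: ub].
exists (sup (range g)) => n; apply/andP; split.
  by apply: ub_le_sup; [case: hs|exists n].
by apply: ge_sup; [case: hs|exact: ub].
Qed.

(** The selected rectangles shrink to a point [(s, t)]. There [J_local] bounds the [n]-th one by
    [e'] times the square of its half-perimeter [S / 2 ^+ n], which exactly compensates the factor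
    [4 ^+ n] of [f_big]. *)
Lemma bisection : J a b c d = 0.
Proof.
have [s hs] : exists s, forall n, (f n).1 <= s <= (f n).1 + h n.
  by apply: (@lim_point (fun n => (f n).1)) => // n m /f_mono[].
have [t ht] : exists t, forall n, (f n).2 <= t <= (f n).2 + k n.
  by apply: (@lim_point (fun n => (f n).2)) => // n m /f_mono[].
have sab : a <= s <= b by have := hs 0; rewrite /= /h expr0 divr1; lra.
have tcd : c <= t <= d by have := ht 0; rewrite /= /k expr0 divr1; lra.
apply/eqP; rewrite -cmod_eq0 eq_le cmod_ge0 andbT; apply/ler_addgt0Pr => e e0; rewrite add0r.
pose S := b - a + (d - c).
have S0 : 0 <= S by rewrite /S; lra.
(* The summand [1] keeps the denominator positive for a degenerate rectangle, where [S = 0]. *)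
pose e' := e / (S ^+ 2 + 1).
have S1 : 0 < S ^+ 2 + 1 by rewrite ltr_wpDl// sqr_ge0.
have e'0 : 0 < e' by rewrite divr_gt0.
have [r r0 hr] := J_local sab tcd e'0.
have [n hn] : exists n, S / 2 ^+ n < r.
  have := @cvg_geometric R S (2^-1).
  rewrite ger0_norm ?invr_ge0// invf_lt1// ltr1n => /(_ isT)/cvgrPdist_lt/(_ _ r0)[N _ /(_ N (leqnn _))].
  by rewrite /= sub0r normrN exprVn => h2; exists N; exact: le_lt_trans (ler_norm _) h2.
have [ok1 ok2 ok3 ok4] := f_ok n.
have hk : h n + k n = S / 2 ^+ n by rewrite /h /k -mulrDl.
have := h_ge0 n; have := k_ge0 n => k0 h0.
have := hs n; have := ht n => /andP[t1 t2] /andP[s1 s2].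
have := hr _ _ _ _ ok1 s1 s2 ok2 ok3 t1 t2 ok4.
have -> : (f n).1 + h n - (f n).1 = h n by lra.
have -> : (f n).2 + k n - (f n).2 = k n by lra.
have hr1 : h n < r by lra.
have kr1 : k n < r by lra.
move=> /(_ hr1 kr1) hJ; apply: le_trans (f_big n) _.
have -> : e = e' * (S ^+ 2 + 1) by rewrite /e' divfK// gt_eqF.
apply: (@le_trans _ _ (4 ^+ n * (e' * (h n + k n) ^+ 2))).
  by rewrite ler_pM2l ?exprn_gt0.
rewrite hk mulrCA ler_pM2l// expr_div_n -exprM mulnC exprM.
have -> : 2 ^+ 2 = 4 :> R by rewrite expr2; lra.
rewrite mulrC divfK; last by rewrite expf_neq0// pnatr_eq0.
by rewrite lerDl.
Qed.

End bisection.

(** * Closed differential forms on rectangles *)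

Section closed_forms.
Context {R : realType}.
Local Notation C := R[i].
Local Open Scope complex_scope.
Implicit Types (P Q : R -> R -> C) (A B : C).

(** Real Frechet differentiability at [(s, y)], with partial derivatives [A] and [B]. *)
Definition diff2 P (s y : R) A B := forall e, 0 < e -> exists2 d, 0 < d &
  forall s' y', `|s' - s| < d -> `|y' - y| < d ->
    cmod (P s' y' - P s y - (A * (s' - s)%:C + B * (y' - y)%:C)) <= e * (`|s' - s| + `|y' - y|).

Lemma diff2_cont P s y A B : diff2 P s y A B -> forall e, 0 < e -> exists2 d, 0 < d &
  forall s' y', `|s' - s| < d -> `|y' - y| < d -> cmod (P s' y' - P s y) < e.
Proof.
move=> dP e e0; have [d d0 h] := dP 1 ltr01.
pose K := cmod A + cmod B + 2.
have K0 : 0 < K by rewrite /K; have := cmod_ge0 A; have := cmod_ge0 B; lra.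
pose d' := Num.min d (e / (2 * K)).
have d'0 : 0 < d' by rewrite lt_min d0/= divr_gt0// mulr_gt0.
exists d' => // s' y' hs hy.
have [hs1 hs2] : `|s' - s| < d /\ `|s' - s| < e / (2 * K) by move: hs; rewrite lt_min => /andP[].
have [hy1 hy2] : `|y' - y| < d /\ `|y' - y| < e / (2 * K) by move: hy; rewrite lt_min => /andP[].
have := h s' y' hs1 hy1; rewrite mul1r => h1.
have h2 := cmodD (P s' y' - P s y - (A * (s' - s)%:C + B * (y' - y)%:C)) (A * (s' - s)%:C + B * (y' - y)%:C).
rewrite subrK in h2.
have := cmodD (A * (s' - s)%:C) (B * (y' - y)%:C); rewrite !cmodM !cmod_real => h3.
have a0 := cmod_ge0 A; have b0 := cmod_ge0 B.
set u := `|s' - s| in hs2 h1 h3 *; set v := `|y' - y| in hy2 h1 h3 *.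
have u0 : 0 <= u by exact: normr_ge0.
have v0 : 0 <= v by exact: normr_ge0.
rewrite ltr_pdivlMr ?mulr_gt0// in hs2; rewrite ltr_pdivlMr ?mulr_gt0// in hy2.
have k1 : cmod A * u <= K * u by rewrite ler_wpM2r// /K; lra.
have k2 : cmod B * v <= K * v by rewrite ler_wpM2r// /K; lra.
have k3 : (1 + cmod A) * u <= K * u by rewrite ler_wpM2r// /K; lra.
have k4 : (1 + cmod B) * v <= K * v by rewrite ler_wpM2r// /K; lra.
lra.
Qed.

Lemma dist_itv (x y u v : R) : x <= u <= y -> x <= v <= y -> `|u - v| <= y - x.
Proof. by move=> h1 h2; rewrite ler_norml; lra. Qed.

Section stokes.
Variables (P Q Ps Py Qs Qy : R -> R -> C) (a b c d : R).
Hypotheses (ab : a <= b) (cd : c <= d).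
Hypothesis dP : forall s y, a <= s <= b -> c <= y <= d -> diff2 P s y (Ps s y) (Py s y).
Hypothesis dQ : forall s y, a <= s <= b -> c <= y <= d -> diff2 Q s y (Py s y) (Qy s y).

Let J x y u v := cint (fun s => P s u) x y - cint (fun s => P s v) x y +
  (cint (Q y) u v - cint (Q x) u v).

Let iP u : c <= u <= d -> cintegrable (fun s => P s u) a b.
Proof.
move=> ucd; apply: ccont_on_integrable => s sab e e0.
have [r r0 h] := diff2_cont (dP sab ucd) e0; exists r => // t /h; apply.
by rewrite subrr normr0.
Qed.

Let iQ x : a <= x <= b -> cintegrable (Q x) c d.
Proof.
move=> xab; apply: ccont_on_integrable => y ycd e e0.
have [r r0 h] := diff2_cont (dQ xab ycd) e0; exists r => // t th; apply: h => //.
by rewrite subrr normr0.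
Qed.

Let J_split1 x m y u v : a <= x -> x <= m -> m <= y -> y <= b ->
  c <= u -> u <= v -> v <= d -> J x y u v = J x m u v + J m y u v.
Proof.
move=> ax xm my yb cu uv vd; rewrite /J.
rewrite (@cint_split _ (fun s => P s u) x m y)//; last first.
  by apply: (cintegrableS ax yb); apply: iP; lra.
rewrite (@cint_split _ (fun s => P s v) x m y)//; last first.
  by apply: (cintegrableS ax yb); apply: iP; lra.
by ring.
Qed.

Let J_split2 x y u m v : a <= x -> x <= y -> y <= b ->
  c <= u -> u <= m -> m <= v -> v <= d -> J x y u v = J x y u m + J x y m v.
Proof.
move=> ax xy yb cu um mv vd; rewrite /J.
rewrite (@cint_split _ (Q x) u m v)//; last by apply: (cintegrableS cu vd); apply: iQ; lra.
rewrite (@cint_split _ (Q y) u m v)//; last by apply: (cintegrableS cu vd); apply: iQ; lra.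
by ring.
Qed.

Let J_local s t : a <= s <= b -> c <= t <= d -> forall e, 0 < e ->
  exists2 r, 0 < r & forall x y u v, a <= x -> x <= s -> s <= y -> y <= b ->
    c <= u -> u <= t -> t <= v -> v <= d -> y - x < r -> v - u < r ->
    cmod (J x y u v) <= e * (y - x + (v - u)) ^+ 2.
Proof.
move=> sab tcd e e0.
pose e' := e / 4.
have e'0 : 0 < e' by rewrite divr_gt0.
have [r1 r10 h1] := dP sab tcd e'0; have [r2 r20 h2] := dQ sab tcd e'0.
exists (Num.min r1 r2); first by rewrite lt_min r10.
move=> x y u v ax xs sy yb cu ut tv vd; rewrite !lt_min => /andP[yx1 yx2] /andP[vu1 vu2].
set h := y - x; set k := v - u.
have sxy : x <= s <= y by rewrite xs.
have tuv : u <= t <= v by rewrite ut.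
have xy := le_trans xs sy; have uv := le_trans ut tv.
have [uu vv] : u <= u <= v /\ u <= v <= v by rewrite !lexx uv.
have [xx yy] : x <= x <= y /\ x <= y <= y by rewrite !lexx xy.
(* To first order at [(s, t)], the horizontal edges contribute [- Py] times the area of the
   rectangle and the vertical edges [Py] times it. These cancel in [J], leaving the
   differentiability errors. *)
have hP s' : x <= s' <= y -> cmod (P s' u - P s' v - - (Py s t * (v - u)%:C)) <= 2 * (e' * (h + k)).
  move=> xs'y; have [xs' s'y] := andP xs'y.
  have a1 : `|s' - s| <= h by exact: dist_itv.
  have a2 : `|u - t| <= k by exact: dist_itv.
  have a3 : `|v - t| <= k by exact: dist_itv.
  have b1 := h1 s' u (le_lt_trans a1 yx1) (le_lt_trans a2 vu1).
  have b2 := h1 s' v (le_lt_trans a1 yx1) (le_lt_trans a3 vu1).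
  set X := _ - _ - _ in b1; set Y := _ - _ - _ in b2.
  have -> : P s' u - P s' v - - (Py s t * (v - u)%:C) = X - Y by rewrite /X /Y !rmorphB/=; ring.
  have c1 : e' * (`|s' - s| + `|u - t|) <= e' * (h + k) by rewrite ler_pM2l// lerD.
  have c2 : e' * (`|s' - s| + `|v - t|) <= e' * (h + k) by rewrite ler_pM2l// lerD.
  apply: le_trans (cmodB X Y) _; rewrite [2 * _]mulr_natl mulr2n.
  exact: lerD (le_trans b1 c1) (le_trans b2 c2).
have hQ y' : u <= y' <= v -> cmod (Q y y' - Q x y' - Py s t * (y - x)%:C) <= 2 * (e' * (h + k)).
  move=> uyv.
  have a1 : `|y' - t| <= k by exact: dist_itv.
  have a2 : `|x - s| <= h by exact: dist_itv.
  have a3 : `|y - s| <= h by exact: dist_itv.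
  have b1 := h2 y y' (le_lt_trans a3 yx2) (le_lt_trans a1 vu2).
  have b2 := h2 x y' (le_lt_trans a2 yx2) (le_lt_trans a1 vu2).
  set X := _ - _ - _ in b1; set Y := _ - _ - _ in b2.
  have -> : Q y y' - Q x y' - Py s t * (y - x)%:C = X - Y by rewrite /X /Y !rmorphB/=; ring.
  have c1 : e' * (`|y - s| + `|y' - t|) <= e' * (h + k) by rewrite ler_pM2l// lerD.
  have c2 : e' * (`|x - s| + `|y' - t|) <= e' * (h + k) by rewrite ler_pM2l// lerD.
  apply: le_trans (cmodB X Y) _; rewrite [2 * _]mulr_natl mulr2n.
  exact: lerD (le_trans b1 c1) (le_trans b2 c2).
have i1 : cintegrable (fun s => P s u) x y by apply: (cintegrableS ax yb); apply: iP; rewrite cu (le_trans uv).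
have i2 : cintegrable (fun s => P s v) x y by apply: (cintegrableS ax yb); apply: iP; rewrite vd (le_trans cu).
have i3 : cintegrable (Q x) u v by apply: (cintegrableS cu vd); apply: iQ; rewrite ax (le_trans xy).
have i4 : cintegrable (Q y) u v by apply: (cintegrableS cu vd); apply: iQ; rewrite yb (le_trans ax).
have iB (f g : R -> C) p q : cintegrable f p q -> cintegrable g p q ->
    cintegrable (fun x => f x - g x) p q.
  move=> jf jg; have -> : (fun x => f x - g x) = (fun x => f x + -1 * g x).
    by apply/funext => z; rewrite mulN1r.
  by apply: cintegrableD => //; exact: cintegrableZ.
have n1 := cint_near xy (iB _ _ _ _ i1 i2) hP.
have n2 := cint_near uv (iB _ _ _ _ i4 i3) hQ.
rewrite cintB// -/h in n1; rewrite cintB// -/k in n2.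
rewrite /J; set X := cint _ x y - _ in n1 *; set Y := cint _ u v - _ in n2 *.
have -> : X + Y = (X - - (Py s t * k%:C) * h%:C) + (Y - Py s t * h%:C * k%:C) by ring.
apply: le_trans (cmodD _ _) _.
have -> : e * (h + k) ^+ 2 = 2 * (2 * (e' * (h + k))) * h + 2 * (2 * (e' * (h + k))) * k.
  by rewrite /e'; field.
exact: lerD.
Qed.

(** The form [P ds + Q dy] is closed because [dP] and [dQ] share the cross derivative [Py];
    bisection then applies to its boundary integral [J]. *)
Lemma closed_form_rectangle :
  cint (fun s => P s c) a b - cint (fun s => P s d) a b + (cint (Q b) c d - cint (Q a) c d) = 0.
Proof. exact: (@bisection R J a b c d ab cd J_split1 J_split2 J_local). Qed.

End stokes.
End closed_forms.

(** * Complex differentiability in epsilon-delta form *)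

Section complex_derivative.
Context {R : realType}.
Local Notation C := R[i].
Local Open Scope complex_scope.
Implicit Types (f g : C -> C) (z w u L M : C) (A B : C).

Definition cder f z L := forall e, 0 < e -> exists2 d, 0 < d &
  forall w, cmod (w - z) < d -> cmod (f w - f z - L * (w - z)) <= e * cmod (w - z).

Lemma cder_cst k z : cder (fun=> k) z 0.
Proof. by move=> e e0; exists 1 => // w _; rewrite subrr mul0r subr0 cmod0 mulr_ge0// ltW. Qed.

Lemma cder_id z : cder id z 1.
Proof. by move=> e e0; exists 1 => // w _; rewrite mul1r subrr cmod0 mulr_ge0// ltW. Qed.

Lemma cder_lip f z L : cder f z L ->
  exists2 d, 0 < d & forall w, cmod (w - z) < d -> cmod (f w - f z) <= (cmod L + 1) * cmod (w - z).
Proof.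
move=> /(_ 1 ltr01)[d d0 h]; exists d => // w /h; rewrite mul1r => h1.
have := cmodD (f w - f z - L * (w - z)) (L * (w - z)); rewrite subrK cmodM; lra.
Qed.

Lemma cder_cont f z L : cder f z L -> forall e, 0 < e -> exists2 d, 0 < d &
  forall w, cmod (w - z) < d -> cmod (f w - f z) < e.
Proof.
move=> /cder_lip[d d0 h] e e0.
have K0 : 0 < cmod L + 1 by have := cmod_ge0 L; lra.
exists (Num.min d (e / (cmod L + 1))); first by rewrite lt_min d0 divr_gt0.
move=> w; rewrite lt_min => /andP[wd]; rewrite ltr_pdivlMr// => we.
by apply: le_lt_trans (h w wd) _; rewrite mulrC.
Qed.

Lemma cderD f g z L M : cder f z L -> cder g z M -> cder (fun w => f w + g w) z (L + M).
Proof.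
move=> df dg e e0; have e2 : 0 < e / 2 by rewrite divr_gt0.
have [d1 d10 h1] := df _ e2; have [d2 d20 h2] := dg _ e2.
exists (Num.min d1 d2); first by rewrite lt_min d10.
move=> w; rewrite lt_min => /andP[/h1 w1 /h2 w2].
have := cmodD (f w - f z - L * (w - z)) (g w - g z - M * (w - z)).
have -> : f w - f z - L * (w - z) + (g w - g z - M * (w - z)) =
  f w + g w - (f z + g z) - (L + M) * (w - z) by ring.
lra.
Qed.

Lemma cderM f g z L M : cder f z L -> cder g z M ->
  cder (fun w => f w * g w) z (L * g z + f z * M).
Proof.
move=> df dg e e0.
pose K := cmod (g z) + cmod (f z) + 1.
have K0 : 0 < K by rewrite /K; have := cmod_ge0 (g z); have := cmod_ge0 (f z); lra.
have e3 : 0 < e / (3 * K) by rewrite divr_gt0// mulr_gt0.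
have [d1 d10 h1] := df _ e3; have [d2 d20 h2] := dg _ e3.
have [d3 d30 h3] := cder_lip df; have [d4 d40 h4] := cder_lip dg.
pose KL := cmod L + 1; pose KM := cmod M + 1.
have KL0 : 0 < KL by rewrite /KL; have := cmod_ge0 L; lra.
have KM0 : 0 < KM by rewrite /KM; have := cmod_ge0 M; lra.
pose d5 := e / (3 * (KL * KM)).
have d50 : 0 < d5 by rewrite divr_gt0// !mulr_gt0.
exists (Num.min (Num.min d1 d2) (Num.min (Num.min d3 d4) d5)).
  by rewrite !lt_min d10 d20 d30 d40 d50.
move=> w; rewrite !lt_min => /andP[/andP[/h1 w1 /h2 w2] /andP[/andP[/h3 w3 /h4 w4] w5]].
set t := cmod (w - z) in w1 w2 w3 w4 w5 *.
have t0 : 0 <= t by exact: cmod_ge0.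
have -> : f w * g w - f z * g z - (L * g z + f z * M) * (w - z) =
  (f w - f z - L * (w - z)) * g z + f z * (g w - g z - M * (w - z)) +
  (f w - f z) * (g w - g z) by ring.
apply: le_trans (cmodD _ _) _.
have q1 : cmod ((f w - f z) * (g w - g z)) <= e / 3 * t.
  rewrite cmodM; apply: (@le_trans _ _ ((KL * t) * (KM * t))).
    by apply: ler_pM.
  rewrite mulrACA mulrA ler_wpM2r//.
  by rewrite /d5 ltr_pdivlMr ?mulr_gt0// in w5; rewrite mulrC; lra.
have q2 : cmod (f w - f z - L * (w - z)) * cmod (g z) <= e / 3 * t.
  apply: (@le_trans _ _ (e / (3 * K) * t * K)).
    by apply: ler_pM => //; rewrite /K; have := cmod_ge0 (f z); lra.
  by rewrite le_eqVlt; apply/orP; left; apply/eqP; field; rewrite gt_eqF.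
have q3 : cmod (f z) * cmod (g w - g z - M * (w - z)) <= e / 3 * t.
  apply: (@le_trans _ _ (K * (e / (3 * K) * t))).
    by apply: ler_pM => //; rewrite /K; have := cmod_ge0 (g z); lra.
  by rewrite le_eqVlt; apply/orP; left; apply/eqP; field; rewrite gt_eqF.
have := cmodD ((f w - f z - L * (w - z)) * g z) (f z * (g w - g z - M * (w - z))).
rewrite -cmodM in q2; rewrite -cmodM in q3; lra.
Qed.

Lemma cderN f z L : cder f z L -> cder (fun w => - f w) z (- L).
Proof.
move=> df; have -> : (fun w => - f w) = (fun w => -1 * f w) by apply/funext => w; rewrite mulN1r.
have -> : - L = 0 * f z + -1 * L by rewrite mul0r add0r mulN1r.
exact: (cderM (cder_cst (-1) z) df).
Qed.

Lemma cder_comp f g z L M : cder g z M -> cder f (g z) L -> cder (f \o g) z (L * M).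
Proof.
move=> dg df e e0.
have [d1 d10 h1] := cder_lip dg.
pose KM := cmod M + 1; have KM0 : 0 < KM by rewrite /KM; have := cmod_ge0 M; lra.
pose KL := cmod L + 1; have KL0 : 0 < KL by rewrite /KL; have := cmod_ge0 L; lra.
have e1 : 0 < e / (2 * KM) by rewrite divr_gt0// mulr_gt0.
have e2 : 0 < e / (2 * KL) by rewrite divr_gt0// mulr_gt0.
have [d2 d20 h2] := df _ e1; have [d3 d30 h3] := dg _ e2.
exists (Num.min (Num.min d1 d3) (d2 / KM)); first by rewrite !lt_min d10 d30 divr_gt0.
move=> w; rewrite !lt_min => /andP[/andP[/h1 w1 /h3 w3]]; rewrite ltr_pdivlMr// => w2.
rewrite mulrC in w2; have {}w2 := h2 (g w) (le_lt_trans w1 w2).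
have t0 := cmod_ge0 (w - z).
rewrite /= (_ : f (g w) - f (g z) - L * M * (w - z) =
  (f (g w) - f (g z) - L * (g w - g z)) + L * (g w - g z - M * (w - z))); last by ring.
apply: le_trans (cmodD _ _) _; rewrite cmodM.
have q1 : e / (2 * KM) * cmod (g w - g z) <= e / 2 * cmod (w - z).
  apply: (@le_trans _ _ (e / (2 * KM) * (KM * cmod (w - z)))); first by rewrite ler_pM2l.
  by rewrite le_eqVlt; apply/orP; left; apply/eqP; field; rewrite gt_eqF.
have q2 : cmod L * cmod (g w - g z - M * (w - z)) <= e / 2 * cmod (w - z).
  apply: (@le_trans _ _ (KL * (e / (2 * KL) * cmod (w - z)))).
    by apply: ler_pM => //; rewrite /KL; lra.
  by rewrite le_eqVlt; apply/orP; left; apply/eqP; field; rewrite gt_eqF.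
lra.
Qed.

Lemma cderV z : z != 0 -> cder (fun w => w^-1) z (- z^-2).
Proof.
move=> z0 e e0; have c0 : 0 < cmod z by rewrite cmod_gt0.
have q0 : 0 < e * cmod z ^+ 3 / 2 by rewrite divr_gt0// mulr_gt0// exprn_gt0.
exists (Num.min (cmod z / 2) (e * cmod z ^+ 3 / 2)); first by rewrite lt_min divr_gt0.
move=> w; rewrite lt_min => /andP[w1 w2].
have wz : cmod z / 2 <= cmod w.
  by have := cmodB_ge z (z - w); rewrite subKr cmodBC; lra.
have w0 : w != 0 by rewrite -cmod_gt0; lra.
rewrite (_ : w^-1 - z^-1 - - z^-2 * (w - z) = (w - z) * (w - z) * (w^-1 * z^-2)); last first.
  by field; rewrite w0 z0.
rewrite !cmodM cmodV cmodV cmodX.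
set t := cmod (w - z) in w1 w2 *; have t0 : 0 <= t by exact: cmod_ge0.
rewrite -mulrA mulrC ler_wpM2r//.
have cw : 0 < cmod w by lra.
have -> : t * ((cmod w)^-1 * (cmod z ^+ 2)^-1) = t / (cmod w * cmod z ^+ 2) by rewrite [in RHS]invfM.
rewrite ler_pdivrMr ?mulr_gt0// ?exprn_gt0//.
apply: (le_trans (ltW w2)).
have -> : e * cmod z ^+ 3 / 2 = e * (cmod z / 2 * cmod z ^+ 2) by field.
by rewrite ler_pM2l// ler_pM2r// exprn_gt0.
Qed.

Lemma cder_inv f z L : cder f z L -> f z != 0 -> cder (fun w => (f w)^-1) z (- (f z)^-2 * L).
Proof. by move=> df fz; exact: (cder_comp df (cderV fz)). Qed.

Lemma cder_unique f z L M : cder f z L -> cder f z M -> L = M.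
Proof.
move=> dL dM; apply/eqP; rewrite -subr_eq0 -cmod_eq0 eq_le cmod_ge0 andbT.
apply/ler_addgt0Pr => e e0; rewrite add0r.
have e2 : 0 < e / 2 by rewrite divr_gt0.
have [d1 d10 h1] := dL _ e2; have [d2 d20 h2] := dM _ e2.
pose t := Num.min d1 d2 / 2.
have t0 : 0 < t by rewrite divr_gt0// lt_min d10.
have [t1 t2] : t < d1 /\ t < d2.
  have := lt_min t d1 d2; have -> : t < Num.min d1 d2 by rewrite /t; move: t0; rewrite /t; lra.
  by move=> /esym/andP[].
have ct : cmod (z + t%:C - z) = t by rewrite addrC addKr cmod_real gtr0_norm.
have := h1 (z + t%:C); have := h2 (z + t%:C); rewrite ct => /(_ t2) b2 /(_ t1) b1.
move: b1 b2; set X := f _ - _ => b1 b2.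
have := cmodB (X - M * (z + t%:C - z)) (X - L * (z + t%:C - z)).
have -> : X - M * (z + t%:C - z) - (X - L * (z + t%:C - z)) = (L - M) * (z + t%:C - z) by ring.
rewrite cmodM ct => b3.
have : cmod (L - M) * t <= e * t by lra.
by rewrite ler_pM2r.
Qed.

Lemma cder_local f g z L r : 0 < r -> (forall w, cmod (w - z) < r -> f w = g w) ->
  cder f z L -> cder g z L.
Proof.
move=> r0 fg df e e0; have [d d0 h] := df _ e0.
exists (Num.min d r); first by rewrite lt_min d0.
move=> w; rewrite lt_min => /andP[wd wr].
rewrite -(fg w wr) -(fg z); first exact: h.
by rewrite subrr cmod0.
Qed.

Lemma cder_affine (k a : C) f z L : cder f (a + k * z) L -> cder (fun w => f (a + k * w)) z (L * k).
Proof.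
move=> df; apply: (@cder_comp f (fun w => a + k * w)) => //.
have := cderD (cder_cst a z) (cderM (cder_cst k z) (cder_id z)).
by rewrite mul0r !add0r mulr1.
Qed.

Lemma cderX z n : cder (fun w => w ^+ n) z (n%:R * z ^+ n.-1).
Proof.
elim: n => [|n ih].
  by rewrite mul0r; have := cder_cst 1 z; apply: cder_local ltr01 _ => w _; rewrite expr0.
have := cderM (cder_id z) ih.
have -> : 1 * z ^+ n + id z * (n%:R * z ^+ n.-1) = n.+1%:R * z ^+ n.+1.-1.
  case: n ih => [|n] _ /=; first by rewrite mul0r mulr0 addr0.
  by rewrite mulrCA -exprS -[n.+2]add1n natrD mulrDl.
by apply: cder_local ltr01 _ => w _; rewrite exprS.
Qed.

End complex_derivative.

Section homotopy.
Context {R : realType}.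
Local Notation C := R[i].
Local Open Scope complex_scope.
Implicit Types (P Q : R -> R -> C) (f g : C -> C) (A B : C).

Lemma diff2_cst k (s y : R) : diff2 (fun _ _ => k : C) s y 0 0.
Proof.
move=> e e0; exists 1 => // s' y' _ _.
by rewrite subrr !mul0r addr0 subr0 cmod0 mulr_ge0 ?(ltW e0)// addr_ge0.
Qed.

Lemma diff2_s (s y : R) : diff2 (fun s _ => s%:C) s y 1 0.
Proof.
move=> e e0; exists 1 => // s' y' _ _.
by rewrite mul1r mul0r addr0 rmorphB subrr cmod0 mulr_ge0 ?(ltW e0)// addr_ge0.
Qed.

Lemma diff2D P Q s y A B A' B' : diff2 P s y A B -> diff2 Q s y A' B' ->
  diff2 (fun s y => P s y + Q s y) s y (A + A') (B + B').
Proof.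
move=> dP dQ e e0; have e2 : 0 < e / 2 by rewrite divr_gt0.
have [d1 d10 h1] := dP _ e2; have [d2 d20 h2] := dQ _ e2.
exists (Num.min d1 d2); first by rewrite lt_min d10.
move=> s' y'; rewrite !lt_min => /andP[s1 s2] /andP[y1 y2].
have := h1 s' y' s1 y1; have := h2 s' y' s2 y2.
set X := _ - _ - _ => b1; set Y := _ - _ - _ => b2.
rewrite (_ : _ - _ = X + Y); last by rewrite /X /Y; ring.
have := cmodD X Y; lra.
Qed.

Lemma diff2_lip P s y A B : diff2 P s y A B -> exists2 d, 0 < d & forall s' y',
  `|s' - s| < d -> `|y' - y| < d ->
  cmod (P s' y' - P s y) <= (cmod A + cmod B + 1) * (`|s' - s| + `|y' - y|).
Proof.
move=> /(_ 1 ltr01)[d d0 h]; exists d => // s' y' hs hy.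
have := h s' y' hs hy; rewrite mul1r => h1.
have := cmodD (P s' y' - P s y - (A * (s' - s)%:C + B * (y' - y)%:C)) (A * (s' - s)%:C + B * (y' - y)%:C).
rewrite subrK => h2.
have := cmodD (A * (s' - s)%:C) (B * (y' - y)%:C); rewrite !cmodM !cmod_real => h3.
have u0 := normr_ge0 (s' - s); have v0 := normr_ge0 (y' - y).
have k1 : 0 <= cmod A * `|y' - y| by rewrite mulr_ge0.
have k2 : 0 <= cmod B * `|s' - s| by rewrite mulr_ge0.
lra.
Qed.

Lemma diff2_comp f P s y L A B : diff2 P s y A B -> cder f (P s y) L ->
  diff2 (fun s y => f (P s y)) s y (L * A) (L * B).
Proof.
move=> dP df e e0.
have [d1 d10 h1] := diff2_lip dP.
pose K := cmod A + cmod B + 1.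
have K0 : 0 < K by rewrite /K; have := cmod_ge0 A; have := cmod_ge0 B; lra.
pose KL := cmod L + 1; have KL0 : 0 < KL by rewrite /KL; have := cmod_ge0 L; lra.
have e1 : 0 < e / (2 * K) by rewrite divr_gt0// mulr_gt0.
have e2 : 0 < e / (2 * KL) by rewrite divr_gt0// mulr_gt0.
have [d2 d20 h2] := df _ e1; have [d3 d30 h3] := dP _ e2.
have d4 : 0 < d2 / (2 * K) by rewrite divr_gt0// mulr_gt0.
exists (Num.min (Num.min d1 d3) (d2 / (2 * K))); first by rewrite !lt_min d10 d30.
move=> s' y'; rewrite !lt_min => /andP[/andP[s1 s3] s2] /andP[/andP[y1 y3] y2].
rewrite !ltr_pdivlMr ?mulr_gt0// in s2 y2.
have := h1 _ _ s1 y1; rewrite -/K => w1; have w3 := h3 _ _ s3 y3.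
set t := `|s' - s| + `|y' - y| in w1 w3 *.
have t0 : 0 <= t by rewrite /t addr_ge0.
have tK : K * t < d2 by rewrite /t; lra.
have w2 := h2 _ (le_lt_trans w1 tK).
rewrite (_ : _ - _ = (f (P s' y') - f (P s y) - L * (P s' y' - P s y)) +
  L * (P s' y' - P s y - (A * (s' - s)%:C + B * (y' - y)%:C))); last by ring.
apply: le_trans (cmodD _ _) _; rewrite cmodM.
have q1 : e / (2 * K) * cmod (P s' y' - P s y) <= e / 2 * t.
  apply: (@le_trans _ _ (e / (2 * K) * (K * t))); first by rewrite ler_pM2l.
  by rewrite le_eqVlt; apply/orP; left; apply/eqP; field; rewrite gt_eqF.
have q2 : cmod L * cmod (P s' y' - P s y - (A * (s' - s)%:C + B * (y' - y)%:C)) <= e / 2 * t.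
  apply: (@le_trans _ _ (KL * (e / (2 * KL) * t))).
    by apply: ler_pM => //; rewrite /KL; lra.
  by rewrite le_eqVlt; apply/orP; left; apply/eqP; field; rewrite gt_eqF.
lra.
Qed.

Lemma diff2Z P k s y A B : diff2 P s y A B ->
  diff2 (fun s y => k * P s y) s y (k * A) (k * B).
Proof.
move=> dP; apply: (diff2_comp (f := fun w => k * w) dP).
have := cderM (cder_cst k (P s y)) (cder_id (P s y)).
by rewrite mul0r add0r mulr1.
Qed.

Lemma diff2M P Q s y A B A' B' : diff2 P s y A B -> diff2 Q s y A' B' ->
  diff2 (fun s y => P s y * Q s y) s y (A * Q s y + P s y * A') (B * Q s y + P s y * B').
Proof.
move=> dP dQ.
(* polarization reduces the product to squares *)
have sq (S : R -> R -> C) a b : diff2 S s y a b ->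
    diff2 (fun s y => S s y ^+ 2) s y (2%:R * S s y * a) (2%:R * S s y * b).
  by move=> dS; have := diff2_comp dS (cderX (S s y) 2); rewrite expr1.
have h1 := sq _ _ _ (diff2D dP dQ).
have h2 := sq _ _ _ (diff2D dP (diff2Z (-1) dQ)).
have := diff2D (diff2Z (4^-1) h1) (diff2Z (- 4^-1) h2).
have four : 4 != 0 :> C by rewrite pnatr_eq0.
set A1 := _ + _; set B1 := _ + _; set PP := fun _ _ => _.
have -> : A1 = A * Q s y + P s y * A' by rewrite /A1; field.
have -> : B1 = B * Q s y + P s y * B' by rewrite /B1; field.
have -> // : PP = fun s y => P s y * Q s y.
by apply/funext => s'; apply/funext => y'; rewrite /PP; field.
Qed.

(** The pullback of [f(z) dz] along [g] is closed, since the mixed derivative [gsy] is common to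
    [gs] and [gy]. Its integrals along the edges [y = c] and [y = d] cancel because each curve [g s]
    closes up. *)
Lemma cint_homotopy f (f' : C -> C) (g gs gy gss gsy gyy : R -> R -> C) (a b c d : R) :
  a <= b -> c <= d ->
  (forall s y, a <= s <= b -> c <= y <= d -> diff2 g s y (gs s y) (gy s y)) ->
  (forall s y, a <= s <= b -> c <= y <= d -> diff2 gs s y (gss s y) (gsy s y)) ->
  (forall s y, a <= s <= b -> c <= y <= d -> diff2 gy s y (gsy s y) (gyy s y)) ->
  (forall s y, a <= s <= b -> c <= y <= d -> cder f (g s y) (f' (g s y))) ->
  (forall s, g s c = g s d) -> (forall s, gs s c = gs s d) ->
  cint (fun y => f (g a y) * gy a y) c d = cint (fun y => f (g b y) * gy b y) c d.
Proof.
move=> ab cd dg dgs dgy df gcd gscd.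
pose P s y := f (g s y) * gs s y.
pose Q s y := f (g s y) * gy s y.
pose Ps s y := f' (g s y) * gs s y * gs s y + f (g s y) * gss s y.
pose Py s y := f' (g s y) * gy s y * gs s y + f (g s y) * gsy s y.
pose Qy s y := f' (g s y) * gy s y * gy s y + f (g s y) * gyy s y.
have dP s y : a <= s <= b -> c <= y <= d -> diff2 P s y (Ps s y) (Py s y).
  by move=> hs hy; apply: diff2M (diff2_comp (dg _ _ hs hy) (df _ _ hs hy)) (dgs _ _ hs hy).
have dQ s y : a <= s <= b -> c <= y <= d -> diff2 Q s y (Py s y) (Qy s y).
  move=> hs hy; have := diff2M (diff2_comp (dg _ _ hs hy) (df _ _ hs hy)) (dgy _ _ hs hy).
  by rewrite mulrAC.
have := closed_form_rectangle ab cd dP dQ.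
have -> : (fun s => P s d) = (fun s => P s c).
  by apply/funext => s; rewrite /P gcd gscd.
by rewrite subrr add0r => /eqP; rewrite subr_eq0 => /eqP ->.
Qed.

End homotopy.

(** * Cauchy's formula and Taylor expansions *)

Section cauchy.
Context {R : realType}.
Local Notation C := R[i].
Local Notation mu := (@lebesgue_measure R).
Local Open Scope complex_scope.
Implicit Types (f g : C -> C) (z w : C).

Definition holo f := forall z, cmod z < 1 -> exists L, cder f z L.

Definition cD f z : C := xget 0 [set L | cder f z L].

Lemma cderD_cD f z : (exists L, cder f z L) -> cder f z (cD f z).
Proof. by move=> [L hL]; exact: (xgetI 0 hL). Qed.

Lemma is_derive_eps (f : R -> R) (x l : R) : is_derive x 1 f l -> forall e, 0 < e ->
  exists2 d, 0 < d & forall y, `|y - x| < d -> `|f y - f x - l * (y - x)| <= e * `|y - x|.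
Proof.
move=> [df dl] e e0.
have /cvgrPdist_le /(_ _ e0) : (fun h : R => h^-1 *: ((f \o shift x) (h *: 1) - f x)) @ 0^' --> l.
  by rewrite -dl; exact: df.
rewrite near_withinE => /nbhs_ballP[d /= d0 h]; exists d => // y yd.
have [->|yx] := eqVneq y x; first by rewrite !subrr mulr0 subr0 normr0 mulr0.
have yx0 : y - x != 0 by rewrite subr_eq0.
have := h (y - x); rewrite /ball/= sub0r normrN => /(_ yd yx0).
rewrite /shift/= scaler1 subrK => h1.
have -> : f y - f x - l * (y - x) = - ((l - (y - x)^-1 *: (f y - f x)) * (y - x)).
  by rewrite /GRing.scale/=; field.
by rewrite normrN normrM ler_wpM2r.
Qed.

Definition circ (r y : R) : C := (r * cos y) +i* (r * sin y).

Lemma cmod_circ r y : 0 <= r -> cmod (circ r y) = r.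
Proof.
move=> r0; apply/eqP; rewrite -(@eqrXn2 _ 2)//.
by rewrite cmod_sqr/= !exprMn -mulrDr cos2Dsin2 mulr1.
Qed.

Lemma circ_2pi r : circ r (pi *+ 2) = circ r 0.
Proof. by rewrite /circ cos2pi sin2pi cos0 sin0. Qed.

Lemma diff2_circ r s y : diff2 (fun _ y => circ r y) s y 0 ('i * circ r y).
Proof.
move=> e e0; pose K := 2 * (`|r| + 1).
have K0 : 0 < K by rewrite /K; have := normr_ge0 r; lra.
have e1 : 0 < e / K by rewrite divr_gt0.
have [d1 d10 h1] := is_derive_eps (is_derive_cos y) e1.
have [d2 d20 h2] := is_derive_eps (is_derive_sin y) e1.
exists (Num.min d1 d2); first by rewrite lt_min d10.
move=> s' y' _; rewrite lt_min => /andP[/h1 b1 /h2 b2].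
apply: le_trans (cmod_le_ReIm _) _.
have -> : complex.Re (circ r y' - circ r y - (0 * (s' - s)%:C + 'i * circ r y * (y' - y)%:C)) =
   r * (cos y' - cos y - - sin y * (y' - y)).
  by rewrite mul0r add0r /circ/=; ring.
have -> : complex.Im (circ r y' - circ r y - (0 * (s' - s)%:C + 'i * circ r y * (y' - y)%:C)) =
   r * (sin y' - sin y - cos y * (y' - y)).
  by rewrite mul0r add0r /circ/=; ring.
rewrite !normrM.
have t0 := normr_ge0 (y' - y); have u0 := normr_ge0 (s' - s); have r0 := normr_ge0 r.
have q (X : R) : X <= e / K * `|y' - y| -> `|r| * X <= e / 2 * `|y' - y|.
  move=> hX; apply: (@le_trans _ _ (`|r| * (e / K * `|y' - y|))); first by rewrite ler_wpM2l.
  have -> : e / 2 * `|y' - y| = (`|r| + 1) * (e / K * `|y' - y|).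
    by rewrite /K; field; rewrite gt_eqF//; lra.
  by rewrite ler_wpM2r ?lerDl// mulr_ge0// ltW.
have := q _ b1; have := q _ b2.
have : 0 <= e * `|s' - s| by rewrite mulr_ge0// ltW.
lra.
Qed.

Let pi2 : 0 <= pi *+ 2 :> R. Proof. by rewrite mulrn_wge0// pi_ge0. Qed.

Lemma diff2_ccont (P : R -> R -> C) s a b (Ps Py : R -> C) :
  (forall y, a <= y <= b -> diff2 P s y (Ps y) (Py y)) -> ccont_on (P s) a b.
Proof.
move=> dP y yab e e0; have [d d0 h] := diff2_cont (dP y yab) e0; exists d => // t ht.
by apply: h => //; rewrite subrr normr0.
Qed.

Section fixed_circle.
Variables (r : R) (z : C).
Hypotheses (r0 : 0 < r) (zr : cmod z < r).
Let w y := circ r y.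

Let wr y : cmod (w y) = r. Proof. by rewrite cmod_circ// ltW. Qed.
Let wz y : w y - z != 0.
Proof. by rewrite -cmod_gt0; have := cmodB_ge (w y) z; have := zr; rewrite wr; lra. Qed.
Let w0 y : w y != 0. Proof. by rewrite -cmod_gt0 wr. Qed.

(** The pole [z] is moved to the centre by translating the circle: [w y - t z] never vanishes for
    [0 <= t <= 1] because [|z| < r], and at [t = 0] the integrand is constant. *)
Lemma cint_cauchy_kernel :
  cint (fun y => (w y - z)^-1 * ('i * w y)) 0 (pi *+ 2) = 'i * (pi *+ 2)%:C.
Proof.
have nz t y : 0 <= t <= 1 -> w y + t%:C * - z != 0.
  move=> /andP[t0 t1]; rewrite -cmod_gt0.
  have := cmodD_ge (w y) (t%:C * - z); rewrite wr cmodM cmodN cmod_real ger0_norm//.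
  have : t * cmod z <= 1 * cmod z by rewrite ler_wpM2r.
  have := zr; lra.
have e : cint (fun y => (w y + 0%:C * - z)^-1 * ('i * w y)) 0 (pi *+ 2) =
    cint (fun y => (w y + 1%:C * - z)^-1 * ('i * w y)) 0 (pi *+ 2).
  apply: (@cint_homotopy R (fun u => u^-1) (fun u => - u^-2)
    (fun t y => w y + t%:C * - z) (fun _ _ => - z) (fun _ y => 'i * w y)
    (fun _ _ => 0) (fun _ _ => 0) (fun _ y => 'i * ('i * w y)) 0 1 0 (pi *+ 2) ler01 pi2).
  - move=> s y _ _.
    have := diff2D (diff2_circ r s y) (diff2M (diff2_s s y) (diff2_cst (- z) s y)).
    by rewrite !mul1r !mulr0 !mul0r !addr0 add0r.
  - by move=> s y _ _; exact: diff2_cst.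
  - by move=> s y _ _; have := diff2Z 'i (diff2_circ r s y); rewrite mulr0.
  - by move=> s y hs _; apply: cderV; exact: nz.
  - by move=> s; rewrite /w circ_2pi.
  - by [].
transitivity (cint (fun y => (w y + 1%:C * - z)^-1 * ('i * w y)) 0 (pi *+ 2)).
  by apply: eq_cint => y _; rewrite mul1r.
rewrite -e; transitivity (cint (fun _ : R => 'i : C) 0 (pi *+ 2)).
  by apply: eq_cint => y _; rewrite mul0r addr0 mulrCA mulVf// mulr1.
by rewrite cint_cst// subr0.
Qed.

Variable f : C -> C.
Hypothesis hf : forall u, cmod u <= r -> exists L, cder f u L.

Let ker_cont : ccont_on (fun y => (w y - z)^-1 * ('i * w y)) 0 (pi *+ 2).
Proof.
apply: (@diff2_ccont (fun _ y => (w y - z)^-1 * ('i * w y)) 0) => y _.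
apply: diff2M; last exact: (diff2Z 'i (diff2_circ r 0 y)).
apply: (diff2_comp (f := fun u => u^-1)); last exact: (cderV (wz y)).
exact: (diff2D (diff2_circ r 0 y) (diff2_cst (- z) 0 y)).
Qed.

Let seg s y : 0 <= s <= 1 -> cmod (z + s%:C * (w y - z)) <= r.
Proof.
move=> /andP[s0 s1].
have -> : z + s%:C * (w y - z) = (1 - s)%:C * z + s%:C * w y by rewrite rmorphB/=; ring.
apply: le_trans (cmodD _ _) _; rewrite !cmodM !cmod_real wr !ger0_norm//; last by lra.
have : (1 - s) * cmod z <= (1 - s) * r by apply: ler_wpM2l; [lra|exact: ltW].
lra.
Qed.

Let dseg s y : diff2 (fun s y => z + s%:C * (w y - z)) s y (w y - z) (s%:C * ('i * w y)).
Proof.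
have h := diff2D (diff2_circ r s y) (diff2_cst (- z) s y).
have := diff2D (diff2_cst z s y) (diff2M (diff2_s s y) h).
by rewrite !addr0 mulr0 addr0 mul1r mul0r !add0r.
Qed.

Let Fcont s : 0 <= s <= 1 -> ccont_on (fun y => f (z + s%:C * (w y - z)) * ((w y - z)^-1 * ('i * w y))) 0 (pi *+ 2).
Proof.
move=> hs.
apply: (@diff2_ccont (fun s y => f (z + s%:C * (w y - z)) * ((w y - z)^-1 * ('i * w y))) s) => y _.
apply: diff2M; first exact: (diff2_comp (dseg s y) (cderD_cD (hf (seg y hs)))).
apply: diff2M; last exact: (diff2Z 'i (diff2_circ r s y)).
apply: (diff2_comp (f := fun u => u^-1)); last exact: (cderV (wz y)).
exact: (diff2D (diff2_circ r s y) (diff2_cst (- z) s y)).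
Qed.

(** The circle is contracted towards [z] along segments. In [f(u) du / (u - z)] the factor [s] of
    [du] cancels that of [u - z], so only the argument of [f] moves. *)
Let Kconst s : 0 < s <= 1 ->
  cint (fun y => f (z + s%:C * (w y - z)) * ((w y - z)^-1 * ('i * w y))) 0 (pi *+ 2) =
  cint (fun y => f (w y) * ((w y - z)^-1 * ('i * w y))) 0 (pi *+ 2).
Proof.
move=> /andP[s0 s1].
have sc : s%:C != 0 by rewrite -cmod_gt0 cmod_real normr_gt0 gt_eqF.
pose ff u := f u * (u - z)^-1.
pose f' u := cD f u * (u - z)^-1 + f u * (- (u - z)^-2 * 1).
have e : cint (fun y => ff (z + s%:C * (w y - z)) * (s%:C * ('i * w y))) 0 (pi *+ 2) =
    cint (fun y => ff (z + 1%:C * (w y - z)) * (1%:C * ('i * w y))) 0 (pi *+ 2).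
  apply: (@cint_homotopy R ff f'
  (fun t y => z + t%:C * (w y - z)) (fun _ y => w y - z) (fun t y => t%:C * ('i * w y))
  (fun _ _ => 0) (fun _ y => 'i * w y) (fun t y => t%:C * ('i * ('i * w y))) s 1 0 (pi *+ 2) s1 pi2).
  - by move=> t y _ _; exact: dseg.
  - move=> t y _ _; have := diff2D (diff2_circ r t y) (diff2_cst (- z) t y).
    by rewrite !addr0.
  - move=> t y _ _; have := diff2M (diff2_s t y) (diff2Z 'i (diff2_circ r t y)).
    by rewrite mul1r !mulr0 mul0r addr0 add0r.
  - move=> t y /andP[st t1] _; have t0 : 0 < t by exact: lt_le_trans st.
    apply: cderM; first by apply: cderD_cD; apply: hf; apply: seg; rewrite (ltW t0).
    apply: (cder_inv (f := fun u => u - z)).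
      have := cderD (cder_id (z + t%:C * (w y - z))) (cder_cst (- z) (z + t%:C * (w y - z))).
      by rewrite addr0.
    rewrite (_ : z + t%:C * (w y - z) - z = t%:C * (w y - z)); last by ring.
    rewrite mulf_neq0// -cmod_gt0 cmod_real normr_gt0 gt_eqF//.
  - by move=> t; rewrite /w circ_2pi.
  - by move=> t; rewrite /w circ_2pi.
transitivity (cint (fun y => ff (z + s%:C * (w y - z)) * (s%:C * ('i * w y))) 0 (pi *+ 2)).
  apply: eq_cint => y _; rewrite /ff (_ : z + s%:C * (w y - z) - z = s%:C * (w y - z)); last by ring.
  rewrite -mulrA; congr (_ * _).
  by rewrite invfM -mulrA [RHS]mulrCA; congr (_ * _); rewrite mulrA mulVf// mul1r.
rewrite e; apply: eq_cint => y _.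
by rewrite /ff !mul1r [z + _]addrC subrK -mulrA.
Qed.

(** Contracting the contour brings the argument of [f] as near to [z] as desired, where [f] may be
    replaced by [f z]. In the angular variable, [w / (w - z) dy] is [dw / ('i (w - z))]. *)
Lemma cauchy_formula :
  cint (fun y => f (w y) * (w y / (w y - z))) 0 (pi *+ 2) = (pi *+ 2)%:C * f z.
Proof.
have i0 : 'i != 0 :> C by rewrite eq_complex/= oner_eq0 andbF.
have main : cint (fun y => f (w y) * ((w y - z)^-1 * ('i * w y))) 0 (pi *+ 2) =
    f z * ('i * (pi *+ 2)%:C).
  rewrite -cint_cauchy_kernel.
  apply/eqP; rewrite -subr_eq0 -cmod_eq0 eq_le cmod_ge0 andbT.
  apply/ler_addgt0Pr => e e0; rewrite add0r.
  pose K := (r - cmod z)^-1 * r; have rz : 0 < r - cmod z by rewrite subr_gt0.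
  have K0 : 0 < K by rewrite mulr_gt0// invr_gt0.
  pose p2 : R := pi *+ 2; have p20 : 0 < p2 by rewrite /p2 mulrn_wgt0// pi_gt0.
  have e1 : 0 < e / (2 * K * p2) by rewrite divr_gt0// mulr_gt0// mulr_gt0.
  have [d d0 h] := cder_cont (cderD_cD (hf (ltW zr))) e1.
  (* As [|w y - z| <= r + r], the contracted circle lies within distance [d] of [z]. *)
  pose s := Num.min 1 (d / (2 * (r + r))).
  have s0 : 0 < s by rewrite lt_min ltr01 divr_gt0// mulr_gt0// addr_gt0.
  have s1 : s <= 1 by rewrite ge_min lexx.
  have s2 : s * (r + r) < d.
    have : s <= d / (2 * (r + r)) by rewrite ge_min lexx orbT.
    rewrite ler_pdivlMr; last by rewrite mulr_gt0// addr_gt0.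
    lra.
  have hs : 0 < s <= 1 by rewrite s0.
  have hs' : 0 <= s <= 1 by rewrite (ltW s0).
  rewrite -(Kconst hs).
  have ik := ccont_on_integrable ker_cont.
  rewrite -cintZ// -cintB//; [|exact: ccont_on_integrable (Fcont hs')|exact: cintegrableZ].
  have -> : e = 2 * (e / (2 * K * p2) * K) * (p2 - 0).
    have aux (k p : R) : k != 0 -> p != 0 -> e = 2 * (e / (2 * k * p) * k) * p.
      by move=> k0 p0; field; rewrite k0 p0.
    by rewrite subr0; apply: aux; rewrite gt_eqF.
  apply: cint_bound => //.
    have -> : (fun x => f (z + s%:C * (w x - z)) * ((w x - z)^-1 * ('i * w x)) - f z * ((w x - z)^-1 * ('i * w x))) =
       (fun x => f (z + s%:C * (w x - z)) * ((w x - z)^-1 * ('i * w x)) + - f z * ((w x - z)^-1 * ('i * w x))).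
      by apply/funext => x; rewrite mulNr.
    by apply: cintegrableD; [exact: ccont_on_integrable (Fcont hs')|exact: cintegrableZ].
  move=> y _; rewrite -mulrBl cmodM; apply: ler_pM => //.
    apply/ltW/h; rewrite addrC addKr cmodM cmod_real gtr0_norm//.
    apply: le_lt_trans s2; rewrite ler_pM2l//.
    by apply: le_trans (cmodB _ _) _; rewrite wr; lra.
  rewrite !cmodM cmodV wr /K.
  have -> : cmod ('i : C) = 1 by have := cmod_sqr ('i : C); rewrite /= expr0n add0r expr1n => /eqP; rewrite sqrp_eq1 ?cmod_ge0// => /eqP.
  rewrite mul1r ler_pM2r// lef_pV2 ?posrE// ?cmod_gt0//.
  by have := cmodB_ge (w y) z; rewrite wr.
have iF : cintegrable (fun y => f (w y) * ((w y - z)^-1 * ('i * w y))) 0 (pi *+ 2).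
  have h01 : (0 <= 1 :> R) && (1 <= 1 :> R) by rewrite ler01 lexx.
  have := ccont_on_integrable (Fcont h01); congr (cintegrable _ _ _).
  by apply/funext => y; rewrite mul1r [z + _]addrC subrK.
transitivity (cint (fun y => 'i^-1 * (f (w y) * ((w y - z)^-1 * ('i * w y)))) 0 (pi *+ 2)).
  by apply: eq_cint => y _; field; rewrite i0 wz.
by rewrite cintZ// main; field.
Qed.

Lemma circle_bounded : exists2 M, 0 <= M & forall y, 0 <= y <= pi *+ 2 -> cmod (f (w y)) <= M.
Proof.
have cf : {within `[0, pi *+ 2], continuous (fun y => cmod (f (w y)))}.
  apply: rcont_on_within => y yab e e0.
  have [d d0 h] := diff2_cont (diff2_comp (diff2_circ r 0 y) (cderD_cD (hf (eq_ind _ (fun t => t <= r) (lexx r) _ (esym (wr y)))))) e0.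
  exists d => // t ht; have {}ht := h 0 t _ ht; rewrite subrr normr0 in ht.
  apply: le_lt_trans (ht d0); rewrite ler_norml; have := cmodB_ge (f (w t)) (f (w y)).
  have := cmodB_ge (f (w y)) (f (w t)); rewrite cmodBC -/(w t) -/(w y); lra.
have [c _ hc] := EVT_max pi2 cf.
by exists (cmod (f (w c))) => // y yab; apply: hc; rewrite in_itv.
Qed.

End fixed_circle.
End cauchy.

(** * Taylor coefficients, remainders and the Borel-Caratheodory inequality *)

Section taylor.
Context {R : realType}.
Local Notation C := R[i].
Local Open Scope complex_scope.
Implicit Types (f g : C -> C) (z w : C) (r M : R) (n N : nat).

(** Cauchy's integral for the [n]-th Taylor coefficient at [0]. On the circle [du / u = 'i dy],
    whence the power [-n] and the absence of ['i]. *)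
Definition tcoef f r n : C :=
  ((pi *+ 2)^-1)%:C * cint (fun y => f (circ r y) * (circ r y)^-n) 0 (pi *+ 2).

Let pi2 : 0 < pi *+ 2 :> R. Proof. by rewrite mulrn_wgt0// pi_gt0. Qed.

Lemma circ_neq0 r y : 0 < r -> circ r y != 0.
Proof. by move=> r0; rewrite -cmod_gt0 cmod_circ// ltW. Qed.

Lemma cintegrable_circ f r : 0 < r -> (forall u, cmod u = r -> exists L, cder f u L) ->
  cintegrable (fun y => f (circ r y)) 0 (pi *+ 2).
Proof.
move=> r0 hf; apply/ccont_on_integrable/(@diff2_ccont _ (fun _ y => f (circ r y)) 0 0 (pi *+ 2)) => y _.
apply: (diff2_comp (diff2_circ r 0 y)); apply: cderD_cD; apply: hf.
by rewrite cmod_circ// ltW.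
Qed.

Lemma exists_cderM f g z : (exists L, cder f z L) -> (exists L, cder g z L) ->
  exists L, cder (fun w => f w * g w) z L.
Proof. by move=> [L hL] [M hM]; eexists; exact: cderM hL hM. Qed.

Lemma exists_cderX z n : exists L, cder (fun w => w ^+ n) z L.
Proof. by eexists; exact: cderX. Qed.

Lemma exists_cderVX z n : z != 0 -> exists L, cder (fun w => w ^- n) z L.
Proof. by move=> z0; eexists; apply: (cder_inv (cderX z n)); rewrite expf_neq0. Qed.

Lemma tcoef_integrable f r n : 0 < r -> (forall u, cmod u = r -> exists L, cder f u L) ->
  cintegrable (fun y => f (circ r y) * (circ r y)^-n) 0 (pi *+ 2).
Proof.
move=> r0 hf; apply: (@cintegrable_circ (fun u => f u * u ^- n)) => // u ur.
apply: exists_cderM; first exact: hf.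
by apply: exists_cderVX; rewrite -cmod_gt0 ur.
Qed.

Lemma tcoef_bound f r n M : 0 < r -> (forall u, cmod u = r -> exists L, cder f u L) ->
  (forall y, 0 <= y <= pi *+ 2 -> cmod (f (circ r y)) <= M) -> cmod (tcoef f r n) <= 2 * M * r ^- n.
Proof.
move=> r0 hf fM; rewrite /tcoef cmodM cmod_real gtr0_norm ?invr_gt0//.
rewrite -ler_pdivlMl ?invr_gt0// invrK.
rewrite (_ : pi *+ 2 * (2 * M / r ^+ n) = 2 * (M * r ^- n) * (pi *+ 2 - 0)); last by rewrite subr0; ring.
apply: cint_bound (ltW pi2) (tcoef_integrable n r0 hf) _ => y hy.
by rewrite cmodM cmodV cmodX cmod_circ ?(ltW r0)// ler_wpM2r ?invr_ge0 ?exprn_ge0 ?(ltW r0)// fM.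
Qed.

Lemma rint_norm_le_fun (f g : R -> R) a b :
  (@lebesgue_measure R).-integrable `[a, b] (EFin \o f) ->
  (@lebesgue_measure R).-integrable `[a, b] (EFin \o g) -> (forall x, `|f x| <= g x) ->
  `|\int[@lebesgue_measure R]_(x in `[a, b]) f x| <= \int[@lebesgue_measure R]_(x in `[a, b]) g x.
Proof.
move=> jf jg fg; apply: le_trans (le_normr_Rintegral (measurable_Ritv a b) jf) _.
apply: le_Rintegral => //; exact: integrable_norm.
Qed.

Section at_radius.
Variables (r : R) (f : C -> C) (M : R).
Hypotheses (r0 : 0 < r) (hf : forall u, cmod u <= r -> exists L, cder f u L)
  (fM : forall y, 0 <= y <= pi *+ 2 -> cmod (f (circ r y)) <= M).

Let hf' u : cmod u = r -> exists L, cder f u L. Proof. by move=> h; apply: hf; rewrite h. Qed.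
Let M0 : 0 <= M. Proof. by apply: le_trans (@fM 0 _); rewrite // lexx ltW. Qed.

(** Iterating [w / (w - z) = 1 + (z / w) (w / (w - z))] in Cauchy's formula produces one coefficient
    at each step and leaves the remainder as an integral with kernel [k N]. *)
Lemma taylor_remainder N z : cmod z < r ->
  cmod (f z - \sum_(n < N) tcoef f r n * z ^+ n) <= 2 * M * (cmod z / r) ^+ N * (r / (r - cmod z)).
Proof.
move=> zr.
pose w y := circ r y; pose k N u := f u * ((z / u) ^+ N * (u / (u - z))).
have wr y : cmod (w y) = r by rewrite cmod_circ// ltW.
have wz y : w y - z != 0 by rewrite -cmod_gt0; have := cmodB_ge (w y) z; rewrite wr; lra.
have w0 y : w y != 0 by exact: circ_neq0.
have hk n : cintegrable (fun y => k n (w y)) 0 (pi *+ 2).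
  apply: (@cintegrable_circ (k n)) => // u ur.
  have u0 : u != 0 by rewrite -cmod_gt0 ur.
  have uz : u - z != 0 by rewrite -cmod_gt0; have := cmodB_ge u z; rewrite ur; lra.
  apply: exists_cderM; first exact: hf'.
  apply: exists_cderM.
    have [L hL] := exists_cderVX n u0; exists (z ^+ n * L).
    have := cderM (cder_cst (z ^+ n) u) hL; rewrite mul0r add0r.
    by apply: cder_local ltr01 _ => v _; rewrite expr_div_n.
  apply: (@exists_cderM id (fun u => (u - z)^-1)); first by eexists; exact: cder_id.
  by eexists; apply: (cder_inv (cderD (cder_id u) (cder_cst (- z) u))).
have main n : (pi *+ 2)%:C * f z = (pi *+ 2)%:C * \sum_(i < n) tcoef f r i * z ^+ i +
    cint (fun y => k n (w y)) 0 (pi *+ 2).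
  elim: n => [|n ->].
    rewrite big_ord0 mulr0 add0r -(cauchy_formula r0 zr hf).
    by apply: eq_cint => y _; rewrite /k expr0 mul1r.
  rewrite big_ord_recr/= mulrDr -addrA; congr (_ + _).
  rewrite (_ : (pi *+ 2)%:C * (tcoef f r n * z ^+ n) =
    z ^+ n * cint (fun y => f (w y) * (w y)^-n) 0 (pi *+ 2)); last first.
    rewrite /tcoef mulrA [(pi *+ 2)%:C * _]mulrA -rmorphM/= divff ?gt_eqF// mul1r mulrC//.
  have hi := tcoef_integrable n r0 hf'.
  rewrite -cintZ// -cintD; [|exact: cintegrableZ|exact: hk].
  apply: eq_cint => y _; rewrite /k.
  have -> : w y / (w y - z) = 1 + z / w y * (w y / (w y - z)).
    by field; rewrite w0 wz.
  rewrite mulrDr mulr1 mulrDr; congr (_ + _); first by rewrite expr_div_n mulrCA mulrA.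
  by rewrite exprSr !mulrA; field; rewrite w0 wz.
have -> : f z - \sum_(n < N) tcoef f r n * z ^+ n = ((pi *+ 2)^-1)%:C * cint (fun y => k N (w y)) 0 (pi *+ 2).
  have := main N; set S := \sum_(n < N) _; set K := cint _ _ _ => h.
  have -> : K = (pi *+ 2)%:C * (f z - S) by rewrite mulrBr h addrC addKr.
  by rewrite mulrA -rmorphM/= mulVf ?gt_eqF// mul1r.
rewrite cmodM cmod_real gtr0_norm ?invr_gt0// -ler_pdivlMl ?invr_gt0// invrK.
rewrite (_ : pi *+ 2 * _ = 2 * (M * ((cmod z / r) ^+ N * (r / (r - cmod z)))) * (pi *+ 2 - 0)); last by rewrite subr0; ring.
apply: cint_bound (ltW pi2) (hk N) _ => y hy.
rewrite /k !cmodM cmodX cmodM !cmodV wr.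
have zr0 : 0 < r - cmod z by lra.
apply: ler_pM => //.
  by rewrite !mulr_ge0 ?invr_ge0 ?exprn_ge0 ?mulr_ge0 ?invr_ge0// ltW.
  exact: fM.
rewrite ler_wpM2l ?exprn_ge0 ?mulr_ge0 ?invr_ge0 ?(ltW r0)//.
rewrite ler_pM2l// lef_pV2 ?posrE ?cmod_gt0//.
by have := cmodB_ge (w y) z; rewrite wr.
Qed.

Lemma tcoef0 : tcoef f r 0 = f 0.
Proof.
have c0 : cmod (0 : C) < r by rewrite cmod0.
have := taylor_remainder 1 c0.
rewrite big_ord1 cmod0 mul0r expr1 mulr0 mul0r expr0 mulr1 => h.
have : cmod (f 0 - tcoef f r 0) == 0 by rewrite eq_le h cmod_ge0.
by rewrite cmod_eq0 subr_eq0 => /eqP.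
Qed.

Lemma taylor_remainder2 N z : cmod z <= r / 2 ->
  cmod (f z - \sum_(n < N) tcoef f r n * z ^+ n) <= 4 * M * (cmod z / r) ^+ N.
Proof.
move=> zr; have zr' : cmod z < r by have := r0; lra.
apply: le_trans (taylor_remainder N zr') _.
have h : r / (r - cmod z) <= 2 by rewrite ler_pdivrMr; have := r0; lra.
rewrite (_ : 4 * M * (cmod z / r) ^+ N = 2 * M * (cmod z / r) ^+ N * 2); last by ring.
rewrite ler_wpM2l// !mulr_ge0// exprn_ge0// divr_ge0// ltW//.
Qed.

Lemma tcoef1 : cder f 0 (tcoef f r 1).
Proof.
move=> e e0.
have K0 : 0 < 4 * M / r ^+ 2 + 1.
  by rewrite ltr_wpDl// divr_ge0 ?exprn_ge0 ?(ltW r0)// mulr_ge0.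
exists (Num.min (r / 2) (e / (4 * M / r ^+ 2 + 1))).
  by rewrite lt_min !divr_gt0.
move=> z; rewrite subr0 lt_min => /andP[/ltW zr]; rewrite ltr_pdivlMr// => ze.
have := taylor_remainder2 2 zr.
rewrite big_ord_recl big_ord1 expr0 mulr1 tcoef0 expr1 opprD addrA => h.
apply: le_trans h _.
rewrite (_ : 4 * M * (cmod z / r) ^+ 2 = (cmod z * (4 * M / r ^+ 2)) * cmod z); last first.
  by field; rewrite gt_eqF.
rewrite ler_wpM2r//; have := cmod_ge0 z; lra.
Qed.

End at_radius.

Section borel_caratheodory.
Variables (r : R) (f : C -> C).
Hypotheses (r0 : 0 < r) (hf : forall u, cmod u <= r -> exists L, cder f u L)
  (f0 : forall u, cmod u = r -> 0 <= complex.Re (f u)).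

Let hf' u : cmod u = r -> exists L, cder f u L. Proof. by move=> h; apply: hf; rewrite h. Qed.

Let rf (y : R) : R := complex.Re (f (circ r y)).
Let A := \int[@lebesgue_measure R]_(y in `[0, pi *+ 2]) rf y.

Let meanRe : A = (pi *+ 2) * complex.Re (f 0).
Proof.
have c0 : cmod (0 : C) < r by rewrite cmod0.
have := cauchy_formula r0 c0 hf.
have -> : cint (fun y => f (circ r y) * (circ r y / (circ r y - 0))) 0 (pi *+ 2) =
   cint (fun y => f (circ r y)) 0 (pi *+ 2).
  by apply: eq_cint => y _; rewrite subr0 divff ?mulr1// circ_neq0.
move=> /(congr1 (@complex.Re R)); rewrite ReM/= mul0r subr0//.
Qed.

Let icirc := @cintegrable_circ f r r0 hf'.

Lemma Re_conjc z : complex.Re (conjc z) = complex.Re z. Proof. by case: z. Qed.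
Lemma Im_conjc z : complex.Im (conjc z) = - complex.Im z. Proof. by case: z. Qed.

Lemma cintegrable_conj (g : R -> C) a b : cintegrable g a b -> cintegrable (fun y => conjc (g y)) a b.
Proof.
move=> [h1 h2]; split.
  by under [X in EFin \o X]eq_fun do rewrite Re_conjc.
have := integrable_itvZ (-1) h2.
by rewrite (_ : (fun y => complex.Im (conjc (g y))) = (fun y => -1 * complex.Im (g y)))//; apply/funext => y; rewrite mulN1r Im_conjc.
Qed.

(** For [n > 0] the integral of [f w^n] vanishes, hence so does that of [conjc f * w^-n]; adding it
    replaces [f] by [2 Re f] in the coefficient. As [Re f >= 0] on the circle, its absolute integral
    is its mean, namely [Re (f 0)]. The constant is [2] for this doubling, times [2] for the real
    and imaginary parts. *)
Lemma borel_caratheodory_coef n : (0 < n)%N -> cmod (tcoef f r n) <= 4 * complex.Re (f 0) * r ^- n.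
Proof.
move=> n0; pose w y := circ r y.
have wr y : cmod (w y) = r by rewrite cmod_circ// ltW.
have w0 y : w y != 0 by exact: circ_neq0.
have c0 : cmod (0 : C) < r by rewrite cmod0.
have hX u : cmod u <= r -> exists L, cder (fun u => f u * u ^+ n) u L.
  by move=> ur; apply: exists_cderM; [exact: hf|exact: exists_cderX].
have iX : cintegrable (fun y => f (w y) * w y ^+ n) 0 (pi *+ 2).
  by apply: (@cintegrable_circ (fun u => f u * u ^+ n)) => // u ur; apply: hX; rewrite ur.
have z0 : cint (fun y => f (w y) * w y ^+ n) 0 (pi *+ 2) = 0.
  have := cauchy_formula r0 c0 hX; rewrite expr0n eqn0Ngt n0 mulr0 mulr0 => <-.
  by apply: eq_cint => y _; rewrite subr0 divff ?mulr1.
have e : (fun y => conjc (f (w y)) * (w y)^-n) = (fun y => (r ^+ (2 * n))^-1%:C * conjc (f (w y) * w y ^+ n)).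
  apply/funext => y; rewrite rmorphM rmorphXn/= mulrCA; congr (_ * _).
  have ww : w y * conjc (w y) = (r ^+ 2)%:C.
    by rewrite -(wr y) cmod_sqr; case: (w y) => a b; apply/eqP; rewrite eq_complex/=; apply/andP; split; apply/eqP; ring.
  have rn : (r ^+ (2 * n))%:C = (w y) ^+ n * conjc (w y) ^+ n by rewrite exprM rmorphXn/= -ww exprMn.
  have -> : (r ^+ (2 * n))^-1%:C = ((w y) ^+ n * conjc (w y) ^+ n)^-1 by rewrite -rn -fmorphV.
  by rewrite invfM -mulrA mulVf ?mulr1// expf_neq0// conjc_eq0.
have ic := cintegrable_conj iX.
have z1 : cint (fun y => conjc (f (w y)) * (w y)^-n) 0 (pi *+ 2) = 0.
  by rewrite e cintZ// cint_conj// z0 conjc0 mulr0.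
have ic' : cintegrable (fun y => conjc (f (w y)) * (w y)^-n) 0 (pi *+ 2).
  by rewrite e; exact: cintegrableZ.
have i1 : cintegrable (fun y => f (w y) * (w y)^-n) 0 (pi *+ 2) by exact: tcoef_integrable.
have e2 : (fun y => f (w y) * (w y)^-n + conjc (f (w y)) * (w y)^-n) = (fun y => (2 * rf y)%:C * (w y)^-n).
  apply/funext => y; rewrite -mulrDl; congr (_ * _); rewrite /rf -/(w y); case: (f (w y)) => a b.
  by apply/eqP; rewrite eq_complex/=; apply/andP; split; apply/eqP; ring.
have iR : cintegrable (fun y => ((2 * rf y)%:C * (w y)^-n)) 0 (pi *+ 2).
  by rewrite -e2; exact: cintegrableD.
have e3 : cint (fun y => f (w y) * (w y)^-n) 0 (pi *+ 2) = cint (fun y => (2 * rf y)%:C * (w y)^-n) 0 (pi *+ 2).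
  by rewrite -e2 cintD// z1 addr0.
rewrite /tcoef e3 cmodM cmod_real gtr0_norm ?invr_gt0// -ler_pdivlMl ?invr_gt0// invrK.
have rn0 : 0 < r ^- n by rewrite invr_gt0 exprn_gt0.
have [irf _] := icirc.
have bnd y : cmod ((2 * rf y)%:C * (w y)^-n) <= (2 * r ^- n) * rf y.
  rewrite cmodM cmodV cmodX wr cmod_real ger0_norm; last by rewrite mulr_ge0// f0.
  by rewrite mulrAC.
have fin : \int[@lebesgue_measure R]_(y in `[0, pi *+ 2]) ((2 * r ^- n) * rf y) = (2 * r ^- n) * ((pi *+ 2) * complex.Re (f 0)).
  by rewrite -meanRe RintegralZl.
have [i2 i3] := iR; have ib := integrable_itvZ (2 * r ^- n) irf.
apply: le_trans (cmod_le_ReIm _) _.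
have := rint_norm_le_fun i2 ib (fun y => le_trans (Re_le_cmod _) (bnd y)).
have := rint_norm_le_fun i3 ib (fun y => le_trans (Im_le_cmod _) (bnd y)).
rewrite fin /cint/=; set X := `| _ |; set Y := `| _ |; set T := r ^- n; set S := complex.Re _; set p := pi *+ 2.
have -> : p * (4 * S * T) = 2 * T * (p * S) + 2 * T * (p * S) by ring.
lra.
Qed.

Lemma borel_caratheodory z : cmod z <= 2 / 3 * r ->
  cmod (f z - f 0) <= 12 * complex.Re (f 0) * (cmod z / r).
Proof.
move=> zr; have zr' : cmod z < r by have := r0; lra.
have [M M0 fM] := circle_bounded r0 hf.
pose t := cmod z / r; have t0 : 0 <= t by rewrite divr_ge0// ltW.
have t1 : t <= 2 / 3 by rewrite ler_pdivrMr.
pose a := complex.Re (f 0).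
have a0 : 0 <= a.
  have := borel_caratheodory_coef (n := 1) isT; move=> /(le_trans (cmod_ge0 _)).
  by rewrite pmulr_lge0 ?invr_gt0 ?exprn_gt0// pmulr_rge0.
(* The bound telescopes: for [t <= 2/3] the increment [12 a (t^(N+1) - t^(N+2))] is at least the new
   term [4 a t^(N+1)]. *)
have part N : cmod (\sum_(n < N) tcoef f r n.+1 * z ^+ n.+1) <= 12 * a * t - 12 * a * t ^+ N.+1.
  elim: N => [|N ih]; first by rewrite big_ord0 cmod0 expr1 subrr.
  rewrite big_ord_recr/=; apply: le_trans (cmodD _ _) _.
  have h : cmod (tcoef f r N.+1 * z ^+ N.+1) <= 4 * a * t ^+ N.+1.
    rewrite cmodM cmodX (_ : 4 * a * t ^+ N.+1 = 4 * a * r ^- N.+1 * cmod z ^+ N.+1); last by rewrite /t expr_div_n mulrA mulrAC.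
    rewrite ler_wpM2r ?exprn_ge0//.
    exact: borel_caratheodory_coef.
  have : a * (t ^+ N.+1 * t) <= a * (t ^+ N.+1 * (2 / 3)) by rewrite ler_wpM2l// ler_wpM2l// exprn_ge0.
  rewrite [t ^+ N.+2]exprSr; lra.
apply/ler_addgt0Pr => e e0.
pose K := 2 * M * (r / (r - cmod z)); have K0 : 0 <= K by rewrite !mulr_ge0 ?invr_ge0 ?subr_ge0// ltW.
have [N hN] : exists N, K * t ^+ N < e.
  have : (fun n => K * t ^+ n) @ \oo --> K * 0.
    by apply: cvgMr; apply: cvg_expr; rewrite ger0_norm//; lra.
  rewrite mulr0 => /cvgrPdist_lt /(_ _ e0)[N _ /(_ N (leqnn N))].
  by rewrite sub0r normrN ger0_norm => [h|]; [exists N|exact: (mulr_ge0 K0 (exprn_ge0 _ t0))].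
have h1 := taylor_remainder r0 hf fM N.+1 zr'.
rewrite big_ord_recl/= expr0 mulr1 (tcoef0 r0 hf fM) -/t in h1.
have := part N; have := cmodD (f z - (f 0 + \sum_(i < N) tcoef f r i.+1 * z ^+ i.+1)) (\sum_(i < N) tcoef f r i.+1 * z ^+ i.+1).
rewrite (_ : f z - (f 0 + \sum_(i < N) tcoef f r i.+1 * z ^+ i.+1) + (\sum_(i < N) tcoef f r i.+1 * z ^+ i.+1) = f z - f 0); last by ring.
have -> : 12 * a * (cmod z / r) = 12 * a * t by [].
have h2 : 2 * M * t ^+ N.+1 * (r / (r - cmod z)) <= e.
  rewrite (_ : _ * _ = K * t ^+ N * t); last by rewrite /K exprSr; ring.
  have : K * t ^+ N * t <= K * t ^+ N * 1 by apply: ler_wpM2l; [exact: (mulr_ge0 K0 (exprn_ge0 _ t0))|lra].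
  lra.
have : 0 <= 12 * a * t ^+ N.+1 by rewrite mulr_ge0 ?exprn_ge0// mulr_ge0.
rewrite -/(t) in h1 *; lra.
Qed.
End borel_caratheodory.

(** A Schwarz-Pick estimate that keeps the factor [1 - |psi 0|]. The unimodular [k] makes [k psi 0]
    real and nonnegative, so [1 - k psi] has nonnegative real part and value [1 - |psi 0|] at [0].
    The radius [3/4] turns [2/3 * r] into [1/2] and [12 / r] into [16]. *)
Lemma schwarz_lip (psi : C -> C) : (forall u, cmod u < 1 -> exists L, cder psi u L) ->
  (forall u, cmod u < 1 -> cmod (psi u) <= 1) -> forall u, cmod u <= 1 / 2 ->
  cmod (psi u - psi 0) <= 16 * (1 - cmod (psi 0)) * cmod u.
Proof.
move=> hpsi psi1 u u12.
have [k k1 hk] : exists2 k : C, cmod k = 1 & k * psi 0 = (cmod (psi 0))%:C.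
  have [->|p0] := eqVneq (psi 0) 0; first by exists 1; rewrite ?cmod1// mulr0 cmod0.
  exists ((cmod (psi 0))%:C / psi 0); last by rewrite divfK.
  by rewrite cmod_div cmod_real ger0_norm// divff// gt_eqF// cmod_gt0.
pose f v := 1 - k * psi v; pose r : R := 3 / 4.
have r0 : 0 < r by rewrite /r; lra.
have hf v : cmod v <= r -> exists L, cder f v L.
  move=> vr; have [|L hL] := hpsi v; first by rewrite /r in vr; lra.
  by eexists; apply: (cderD (cder_cst 1 v) (cderN (cderM (cder_cst k v) hL))).
have f0 v : cmod v = r -> 0 <= complex.Re (f v).
  move=> vr; rewrite /f ReD ReN/=.
  have := Re_le_cmod (k * psi v); rewrite cmodM k1 mul1r ler_norml => /andP[_].
  have := psi1 v; rewrite vr /r => /(_ _); have : 3 / 4 < 1 :> R by lra.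
  by move=> -> /(_ isT); lra.
have ur : cmod u <= 2 / 3 * r by rewrite /r; lra.
have := borel_caratheodory r0 hf f0 ur.
have -> : f u - f 0 = - (k * (psi u - psi 0)) by rewrite /f; ring.
rewrite cmodN cmodM k1 mul1r {1}/f hk ReD ReN/= /r => h.
by rewrite (_ : 16 * _ * _ = 12 * (1 - cmod (psi 0)) * (cmod u / (3 / 4))); [|field].
Qed.

End taylor.

(** * Zeros and multiplicities *)

Section link.
Context {R : realType}.
Local Notation C := R[i].
Local Open Scope complex_scope.
Lemma gt0_realC (e : C) : 0 < e -> exists2 d : R, 0 < d & e = d%:C.
Proof. by case: e => a b; rewrite ltcE/= => /andP[/eqP -> h]; exists a. Qed.

Lemma derivable_cder (f : C -> C) z : derivable (f : C^o -> C^o) z 1 -> exists L, cder f z L.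
Proof.
move=> /cvg_ex[/= L hL]; exists L => e e0.
have eC : 0 < e%:C by rewrite ltcE/= eqxx.
move/cvgrPdist_le : hL => /(_ _ eC).
rewrite near_withinE => /nbhs_ballP[d /= /gt0_realC[d' d0 ->] h]; exists d' => // y yd.
have [->|yx] := eqVneq y z; first by rewrite !subrr mulr0 subr0 cmod0 mulr0.
have yx0 : y - z != 0 by rewrite subr_eq0.
have := h (y - z); rewrite /ball/= sub0r normrN normCE ltcR => /(_ yd yx0).
rewrite /shift/= /GRing.scale/= mulr1 subrK normCE lecR => h1.
have -> : f y - f z - L * (y - z) = - ((L - (y - z)^-1 * (f y - f z)) * (y - z)) by field.
by rewrite cmodN cmodM ler_wpM2r.
Qed.

Lemma cder_derive1 (f : C -> C) z L : cder f z L -> derive1 (f : C^o -> C^o) z = L.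
Proof.
move=> hL; apply: cvg_lim => //.
apply/cvgrPdist_le => _ /gt0_realC[e e0 ->]; rewrite near_withinE.
have [d d0 h] := hL _ e0; apply/nbhs_ballP; exists d%:C => /=; first by rewrite ltcE/= eqxx.
move=> y; rewrite /ball/= sub0r normrN normCE ltcR => yd y0.
rewrite normCE lecR /GRing.scale/=.
have := h (y + z); rewrite addrK => /(_ yd) h1.
have -> : L - y^-1 * (f (y + z) - f z) = - ((f (y + z) - f z - L * y) / y) by field.
by rewrite cmodN cmod_div ler_pdivrMr// cmod_gt0.
Qed.

Lemma cauchy_estimate f (b : C) (s K : R) L : 0 < s -> cder f b L ->
  (forall u, cmod (u - b) <= s -> exists L, cder f u L) ->
  (forall u, cmod (u - b) <= s -> cmod (f u) <= K) -> cmod L <= 2 * K / s.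
Proof.
move=> s0 dL hf fK; pose g u := f (b + 1 * u).
have hg u : cmod u <= s -> exists L, cder g u L.
  move=> us; have [|M hM] := hf (b + 1 * u); first by rewrite mul1r addrC addKr.
  by exists (M * 1); exact: cder_affine.
have gK y : 0 <= y <= pi *+ 2 -> cmod (g (circ s y)) <= K.
  by move=> _; apply: fK; rewrite mul1r addrC addKr cmod_circ// ltW.
have d0 : cder g 0 (L * 1) by apply: cder_affine; rewrite mulr0 addr0.
rewrite -(mulr1 L) (cder_unique d0 (tcoef1 s0 hg gK)) -[s]expr1.
by apply: tcoef_bound => // u us; apply: hg; rewrite us.
Qed.

Section at_point.
Variables (f : C -> C) (a : C).
Hypotheses (hf : holo f) (a1 : cmod a < 1).

Let r := (1 - cmod a) / 2.
Let r0 : 0 < r. Proof. by rewrite divr_gt0// subr_gt0. Qed.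
Let g u := f (a + 1 * u).
Let in_disc u : cmod u <= r -> cmod (a + u) < 1.
Proof. by move=> ur; have := cmodD a u; rewrite /r in ur; have := a1; lra. Qed.
Let hg u : cmod u <= r -> exists L, cder g u L.
Proof.
move=> /in_disc/hf[M hM]; exists (M * 1); apply: cder_affine.
by rewrite mul1r.
Qed.


Lemma holo_taylor3 : exists c, exists2 M : R, 0 <= M & forall u, cmod u <= r / 2 ->
  cmod (f (a + u) - f a - cD f a * u - c * u ^+ 2) <= M * cmod u ^+ 3.
Proof.
have [M M0 hM] := circle_bounded r0 hg.
exists (tcoef g r 2), (4 * M / r ^+ 3); first by apply: divr_ge0; [rewrite mulr_ge0|apply/exprn_ge0/ltW].
move=> u ur; have := taylor_remainder2 r0 hg hM 3 ur.
rewrite !big_ord_recl big_ord0 /= !expr0 mulr1 (tcoef0 r0 hg hM) /bump/= !expr1 /=.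
have -> : tcoef g r (1 + 0)%N = cD f a.
  apply: cder_unique (tcoef1 r0 hg hM) _; rewrite -[cD f a]mulr1; apply: cder_affine.
  by rewrite mulr0 addr0; apply/cderD_cD/hf.
rewrite /g mulr0 addr0 mul1r.
rewrite (_ : f a + _ = f a + cD f a * u + tcoef g r 2 * u ^+ 2); last by rewrite addr0 addrA.
rewrite expr_div_n !opprD !addrA => h; apply: le_trans h _.
by rewrite le_eqVlt; apply/orP; left; apply/eqP; field; rewrite gt_eqF.
Qed.

(** The difference [k] of [f] and its second order Taylor polynomial at [a] is cubic in the distance
    to [a]. Cauchy's estimate on the disc about [z] of radius [|z - a|] then makes its derivative at
    [z] quadratic, which is differentiability of [cD f] at [a]. *)
Lemma holo_cD : exists L, cder (cD f) a L.
Proof.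
have [c [M M0 h]] := holo_taylor3; exists (2 * c) => e e0.
have K0 : 0 < 16 * M + 1 by have := M0; lra.
have r4 : 0 < r / 4 by have := r0; lra.
exists (Num.min (r / 4) (e / (16 * M + 1))); first by rewrite lt_min r4 divr_gt0.
move=> z; rewrite lt_min => /andP[zr]; rewrite ltr_pdivlMr// => ze.
have [->|za] := eqVneq z a; first by rewrite !subrr mulr0 subr0 cmod0 mulr0.
set u := z - a in zr ze *; have u0 : 0 < cmod u by rewrite cmod_gt0 subr_eq0.
have zE : z = a + u by rewrite /u addrC subrK.
pose k v := f v - f a - cD f a * (v - a) - c * (v - a) ^+ 2.
have dk v : cmod v < 1 -> cder k v (cD f v - cD f a - 2 * c * (v - a)).
  move=> v1; have hv := cderD_cD (hf v1).
  have d1 := cderD (cder_id v) (cder_cst (- a) v).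
  have d2 := cderD (cderD (cderD hv (cder_cst (- f a) v)) (cderN (cderM (cder_cst (cD f a) v) d1))) (cderN (cderM (cder_cst c v) (cderM d1 d1))).
  move: d2; rewrite !addr0 !mul0r !add0r !mulr1 !mul1r => d2.
  have -> : cD f v - cD f a - 2 * c * (v - a) = cD f v - cD f a - c * (v - a + (v - a)) by ring.
  by apply: cder_local ltr01 _ d2 => w _; rewrite /k expr2.
have disc v : cmod (v - z) <= cmod u -> cmod (v - a) <= 2 * cmod u.
  by move=> vz; have := cmod_tri v a z; rewrite -/u; lra.
have hk v : cmod (v - z) <= cmod u -> exists L, cder k v L.
  move=> /disc vz; eexists; apply: dk.
  by have := in_disc (u := v - a); rewrite [a + _]addrC subrK; apply; have := r0; lra.
have bk v : cmod (v - z) <= cmod u -> cmod (k v) <= M * (2 * cmod u) ^+ 3.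
  move=> /disc vz; have := h (v - a); rewrite [a + _]addrC subrK => /(_ _) h'.
  have := r0; move=> r0'; apply: le_trans (h' _) _; first by lra.
  by rewrite ler_wpM2l// lerXn2r// nnegrE// mulr_ge0.
have z1 : cmod z < 1 by rewrite zE; apply: in_disc; have := r0; lra.
have := cauchy_estimate u0 (dk z z1) hk bk.
rewrite -/u => hb; apply: le_trans hb _.
rewrite (_ : 2 * (M * (2 * cmod u) ^+ 3) / cmod u = (cmod u * (16 * M)) * cmod u); last first.
  by field; rewrite gt_eqF.
rewrite ler_wpM2r//; have := cmod_ge0 u; lra.
Qed.

Hypothesis fa : f a = 0.

Definition quot u := if u == a then cD f a else f u / (u - a).

Lemma quotE u : f u = (u - a) * quot u.
Proof.
rewrite /quot; case: eqVneq => [->|ua]; first by rewrite subrr mul0r fa.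
by rewrite mulrC divfK// subr_eq0.
Qed.

Lemma holo_quot : holo quot.
Proof.
move=> z z1; have [->|za] := eqVneq z a.
  have [c [M M0 h]] := holo_taylor3; exists c => e e0.
  have K0 : 0 < M + 1 by have := M0; lra.
  have r2 : 0 < r / 2 by have := r0; lra.
  exists (Num.min (r / 2) (e / (M + 1))); first by rewrite lt_min r2 divr_gt0.
  move=> w; rewrite lt_min => /andP[wr]; rewrite ltr_pdivlMr// => we.
  have [->|wa] := eqVneq w a; first by rewrite !subrr mulr0 subr0 cmod0 mulr0.
  have := h (w - a) (ltW wr); rewrite [a + _]addrC subrK fa subr0 => hb.
  rewrite {2}/quot eqxx /quot (negbTE wa).
  have wa0 : w - a != 0 by rewrite subr_eq0.
  have -> : f w / (w - a) - cD f a - c * (w - a) = (f w - cD f a * (w - a) - c * (w - a) ^+ 2) / (w - a).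
    by field.
  rewrite cmod_div ler_pdivrMr ?cmod_gt0//; apply: le_trans hb _.
  have -> : M * cmod (w - a) ^+ 3 = M * cmod (w - a) * cmod (w - a) ^+ 2 by ring.
  rewrite -[e * _ * _]mulrA -expr2 ler_wpM2r ?exprn_ge0//; have := cmod_ge0 (w - a); lra.
have za0 : z - a != 0 by rewrite subr_eq0.
have [L hL] := hf z1.
eexists; apply: (@cder_local _ (fun u => f u * (u - a)^-1) quot z _ (cmod (z - a))).
- by rewrite cmod_gt0.
- move=> w wz; rewrite /quot; case: eqVneq => // wa.
  by move: wz; rewrite wa cmodBC ltxx.
- exact: (cderM hL (cder_inv (cderD (cder_id z) (cder_cst (- a) z)) za0)).
Qed.

End at_point.

(** Each derivative lowers the power of [u - a] by one, and its cofactor stays holomorphic by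
    [holo_cD]. The induction starts at the first derivative, which removes the constant [w]; the
    values at [a] collect a falling factorial, nonzero at order [m]. *)
Lemma derive1n_factor (phi q : C -> C) (a w : C) m : cmod a < 1 -> holo q ->
  (forall u, cmod u < 1 -> phi u = w + (u - a) ^+ m * q u) ->
  forall k, (k < m)%N -> exists2 p, holo p & [/\ p a = (m ^_ k.+1)%:R * q a &
    forall u, cmod u < 1 -> derive1n k.+1 (phi : C^o -> C^o) u = (u - a) ^+ (m - k.+1) * p u].
Proof.
move=> a1 hq hphi.
have step (f p : C -> C) (c : C) n : holo p -> (forall u, cmod u < 1 -> f u = c + (u - a) ^+ n.+1 * p u) ->
  forall u, cmod u < 1 -> derive1 (f : C^o -> C^o) u = (u - a) ^+ n * (n.+1%:R * p u + (u - a) * cD p u).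
  move=> hp fE u u1; apply: cder_derive1.
  have d1 := cderD (cder_id u) (cder_cst (- a) u).
  have d2 := cder_comp d1 (cderX _ n.+1).
  have d3 := cderD (cder_cst c u) (cderM d2 (cderD_cD (hp u u1))).
  have e : 0 + (n.+1%:R * (id u - a) ^+ n.+1.-1 * (1 + 0) * p u + ((fun w : R[i] => w ^+ n.+1) \o (fun w : R[i] => id w + - a)) u * cD p u) =
    (u - a) ^+ n * (n.+1%:R * p u + (u - a) * cD p u) by rewrite /= exprS; ring.
  rewrite -e; apply: (cder_local (r := 1 - cmod u)) d3; first by rewrite subr_gt0.
  move=> v vu; rewrite /= fE//; have := cmodB_ge v (v - u); rewrite subKr.
  have := cmodD (v - u) u; rewrite subrK; lra.
elim=> [|k ih] km.
  case: m km hphi => // m _ hphi.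
  exists (fun u => m.+1%:R * q u + (u - a) * cD q u).
    move=> z z1; have [L hL] := hq z z1; have [M hM] := holo_cD hq z1.
    eexists; apply: (cderD (cderM (cder_cst _ z) hL) (cderM (cderD (cder_id z) (cder_cst (- a) z)) hM)).
  by split=> [|u u1]; [rewrite subrr mul0r addr0 ffactn1|rewrite subSS subn0; exact: (step _ _ w)].
have [p hp [pa pE]] := ih (ltnW km).
have mk : (m - k.+1 = (m - k.+2).+1)%N by rewrite subnSK.
exists (fun u => (m - k.+1)%:R * p u + (u - a) * cD p u).
  move=> z z1; have [L hL] := hp z z1; have [M hM] := holo_cD hp z1.
  eexists; apply: (cderD (cderM (cder_cst _ z) hL) (cderM (cderD (cder_id z) (cder_cst (- a) z)) hM)).
split=> [|u u1]; first by rewrite subrr mul0r addr0 pa mulrA -natrM mulnC -ffactnSr.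
rewrite mk; apply: (step _ p 0) => // v v1.
by rewrite add0r -mk; exact: pE.
Qed.

Lemma mult_factor (phi q : C -> C) (a w : C) m : (0 < m)%N -> cmod a < 1 -> holo q -> q a != 0 ->
  (forall u, cmod u < 1 -> phi u = w + (u - a) ^+ m * q u) -> mult phi a = m.
Proof.
move=> m0 a1 hq qa hphi; have D := derive1n_factor a1 hq hphi.
have dm : derive1n m (phi : C^o -> C^o) a != 0.
  case: m m0 D {hphi} => // m _ D.
  have [p hp [pa pE]] := D m (ltnSn m).
  rewrite pE// subnn expr0 mul1r pa ffactnn mulf_neq0// pnatr_eq0 -lt0n fact_gt0.
have dk k : (0 < k)%N -> (k < m)%N -> derive1n k (phi : C^o -> C^o) a = 0.
  case: k => // k _ km; have [p hp [pa pE]] := D k (ltnW km).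
  rewrite pE// subrr expr0n subn_eq0 leqNgt km/= mul0r//.
rewrite /mult; case: pselect => [H|nH]; last by case: nH; exists m; rewrite m0.
case: ex_minnP => n /andP[n0 dn] nmin.
have nm : (n <= m)%N by apply: nmin; rewrite m0.
case: (ltngtP n m) nm => // nm _.
by rewrite dk ?eqxx in dn.
Qed.

End link.

(** * Area means of log |f| and Jensen's formula *)

Section approximation.
Context {R : realType}.
Local Notation C := R[i].
Local Open Scope complex_scope.
Implicit Types (f q : C -> C) (z w : C) (r : R).

Lemma cvg_expr_small (t K e : R) : 0 <= t < 1 -> 0 <= K -> 0 < e -> exists N, K * t ^+ N < e.
Proof.
move=> /andP[t0 t1] K0 e0.
have : (fun n => K * t ^+ n) @ \oo --> K * 0.
  by apply: cvgMr; apply: cvg_expr; rewrite ger0_norm.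
rewrite mulr0 => /cvgrPdist_lt /(_ _ e0)[N _ /(_ N (leqnn N))].
by rewrite sub0r normrN ger0_norm => [h|]; [exists N|exact: (mulr_ge0 K0 (exprn_ge0 _ t0))].
Qed.

(** Taylor polynomials on the larger circle. They agree exactly with [f] at [0], so a mean value
    formula for polynomials passes to [f]. *)
Lemma poly_approx f r r1 e : 0 <= r -> r < r1 -> (forall u, cmod u <= r1 -> exists L, cder f u L) ->
  0 < e -> exists2 p : {poly C}, p.[0] = f 0 & forall z, cmod z <= r -> cmod (f z - p.[z]) < e.
Proof.
move=> r0 rr1 hf e0; have r10 : 0 < r1 by exact: le_lt_trans rr1.
have [M M0 fM] := circle_bounded r10 hf.
pose t := r / r1; pose K := 2 * M * (r1 / (r1 - r)).
have tb : 0 <= t < 1 by rewrite divr_ge0 ?(ltW r10)//= ltr_pdivrMr// mul1r.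
have rr : 0 < r1 - r by rewrite subr_gt0.
have K0 : 0 <= K by apply: mulr_ge0; [exact: mulr_ge0|apply: divr_ge0; exact: ltW].
have [N hN] := cvg_expr_small tb K0 e0.
exists (\poly_(i < N.+1) tcoef f r1 i).
  rewrite horner_poly big_ord_recl big1 ?addr0 ?expr0 ?mulr1 ?(tcoef0 r10 hf fM)// => i _.
  by rewrite expr0n mulr0.
move=> z zr; rewrite horner_poly; have zr1 : cmod z < r1 by exact: le_lt_trans rr1.
apply: le_lt_trans (taylor_remainder r10 hf fM N.+1 zr1) _; apply: le_lt_trans hN.
rewrite (_ : K * t ^+ N = 2 * M * (t ^+ N * (r1 / (r1 - r)))); last by rewrite /K; ring.
rewrite -mulrA ler_wpM2l ?mulr_ge0//.
have /andP[t0 t1] := tb.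
have h1 : (cmod z / r1) ^+ N.+1 <= t ^+ N.
  apply: (@le_trans _ _ (t ^+ N.+1)).
    by rewrite lerXn2r// ?nnegrE ?divr_ge0// ?(ltW r10)// ler_pM2r ?invr_gt0.
  by rewrite exprSr ler_piMr ?exprn_ge0// ltW.
have h2 : r1 / (r1 - cmod z) <= r1 / (r1 - r).
  by rewrite ler_pM2l// lef_pV2 ?posrE; lra.
apply: ler_pM => //; first by rewrite exprn_ge0 ?divr_ge0// ltW.
by rewrite divr_ge0 ?(ltW r10)//; lra.
Qed.

Lemma closed_disc_bounded f r r1 : 0 <= r -> r < r1 -> (forall u, cmod u <= r1 -> exists L, cder f u L) ->
  exists2 M, 0 < M & forall z, cmod z <= r -> cmod (f z) <= M.
Proof.
move=> r0 rr1 hf; have r10 : 0 < r1 by exact: le_lt_trans rr1.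
have [M M0 fM] := circle_bounded r10 hf.
have rr : 0 < r1 - r by rewrite subr_gt0.
exists (2 * M * (r1 / (r1 - r)) + 1).
  apply: ltr_wpDl => //; apply: mulr_ge0; [exact: mulr_ge0|apply: divr_ge0; exact: ltW].
move=> z zr; have zr1 : cmod z < r1 by exact: le_lt_trans rr1.
have := taylor_remainder r10 hf fM 0 zr1; rewrite big_ord0 subr0 expr0 mulr1 => h.
apply: le_trans h _; apply: ler_wpDr => //; apply: ler_wpM2l; first by rewrite mulr_ge0.
by rewrite ler_pM2l// lef_pV2 ?posrE; lra.
Qed.

Lemma cmeasurable_cvg (d : measure_display) (T : measurableType d) (h : nat -> T -> C) (f : T -> C) :
  (forall n, cmeasurable (h n)) ->
  (forall t e, 0 < e -> exists N, forall n, (N <= n)%N -> cmod (h n t - f t) < e) -> cmeasurable f.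
Proof.
move=> mh hf; split.
- apply: (measurable_fun_cvg (h := fun n t => complex.Re (h n t))) => [n|t _]; first exact: (mh n).1.
  apply/cvgrPdist_lt => e e0; have [N hN] := hf t e e0; exists N => // n /= /hN.
  by rewrite cmodBC; apply: le_lt_trans; rewrite -ReN -ReD; exact: Re_le_cmod.
- apply: (measurable_fun_cvg (h := fun n t => complex.Im (h n t))) => [n|t _]; first exact: (mh n).2.
  apply/cvgrPdist_lt => e e0; have [N hN] := hf t e e0; exists N => // n /= /hN.
  by rewrite cmodBC; apply: le_lt_trans; rewrite -ImN -ImD; exact: Im_le_cmod.
Qed.

(* The values of [f] outside the disc are arbitrary, and [f] itself need not be measurable. *)
Definition cut r f (p : R * R) : C := if cmod (c2 p) < r then f (c2 p) else 0.

Lemma cmeasurable_poly (P : {poly C}) : cmeasurable (fun p : R * R => P.[c2 p]).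
Proof.
have e : (fun p : R * R => P.[c2 p]) = (fun p => \sum_(i < size P) P`_i * c2 p ^+ i).
  by apply/funext => p; rewrite horner_coef.
rewrite e; apply: cmeasurable_sum => i; apply: cmeasurableM; first exact: cmeasurable_cst.
exact: cmeasurableX (@cmeasurable_c2 R).
Qed.

Lemma cmeasurable_cut_poly r (P : {poly C}) : cmeasurable (cut r (horner P)).
Proof.
have e : cut r (horner P) = (fun p => P.[c2 p] * ((\1_(B 0 r) p : R))%:C).
  apply/funext => p; rewrite /cut indicE; case: ifPn => h.
    by rewrite mem_set ?B0E// mulr1.
  by rewrite memNset ?mulr0// B0E; apply/negP.
rewrite e; apply: cmeasurableM; first exact: cmeasurable_poly.
split; last exact: measurable_cst.
exact: measurable_indic.
Qed.

Lemma cmeasurable_cut_lt f r r1 : 0 <= r -> r < r1 -> (forall u, cmod u <= r1 -> exists L, cder f u L) ->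
  cmeasurable (cut r f).
Proof.
move=> r0 rr1 hf.
have ex n : exists P : {poly C}, forall z, cmod z <= r -> cmod (f z - P.[z]) < n.+1%:R^-1.
  by have [//|P _ hP] := poly_approx r0 rr1 hf (e := n.+1%:R^-1); exists P.
have [P hP] := choice ex.
apply: (cmeasurable_cvg (h := fun n => cut r (horner (P n)))) => [n|p e e0].
  exact: cmeasurable_cut_poly.
have [N hN] : exists N : nat, e^-1 < N%:R by exists (Num.bound e^-1); apply: archi_boundP; rewrite invr_ge0 ltW.
exists N => n Nn; rewrite /cut; case: ifPn => h; last by rewrite subrr cmod0.
rewrite cmodBC; apply: lt_le_trans (hP n _ (ltW h)) _.
rewrite -[e]invrK lef_pV2 ?posrE ?invr_gt0//; apply/ltW/(lt_le_trans hN).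
by rewrite ler_nat (leq_trans Nn).
Qed.

(** A radius below [1] leaves room for a larger circle of holomorphy, and at each point the cuts at
    radius [1 - 1 / (n + 2)] are eventually equal to [cut 1 f]. *)
Lemma cmeasurable_cut1 f : holo f -> cmeasurable (cut 1 f).
Proof.
move=> hf; have rn n : 0 < n.+2%:R^-1 :> R by rewrite invr_gt0.
have rn1 n : n.+2%:R^-1 <= 1 :> R by rewrite invf_le1// ler1n.
apply: (cmeasurable_cvg (h := fun n => cut (1 - n.+2%:R^-1) f)) => [n|p e e0].
  apply: (@cmeasurable_cut_lt f _ (1 - n.+2%:R^-1 / 2)).
  - by have := rn1 n; set t := _^-1; lra.
  - by have := rn n; set t := _^-1; lra.
  - by move=> u; have := rn n; set t := _^-1 => t0 hu; apply: hf; lra.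
rewrite /cut; case: ifPn => h1; last first.
  exists 0%N => n _; case: ifPn => [h|_]; last by rewrite subrr cmod0.
  by rewrite -leNgt in h1; move: h (rn n); set t := _^-1; lra.
have c0 : 0 < 1 - cmod (c2 p) by rewrite subr_gt0.
exists (Num.bound (1 - cmod (c2 p))^-1) => n Nn; case: ifPn; first by rewrite subrr cmod0.
rewrite -leNgt => h; exfalso; have : 1 - cmod (c2 p) <= n.+2%:R^-1 by move: h; set t := _^-1; lra.
rewrite -[1 - _]invrK lef_pV2 ?posrE ?invr_gt0// leNgt => /negP; apply.
apply: lt_le_trans (archi_boundP _) _; first by rewrite invr_ge0 ltW.
by rewrite ler_nat (leq_trans Nn)// leqW.
Qed.

Lemma measurable_cut_dist f z : holo f -> measurable_fun setT (fun p => cmod (cut 1 f p - z)).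
Proof.
move=> hf; apply: measurable_cmod; apply: cmeasurableD; first exact: cmeasurable_cut1.
exact: cmeasurable_cst.
Qed.

Lemma measurable_cut_cmod f r : cmeasurable (cut r f) ->
  measurable_fun (B 0 r) (fun p => cmod (f (c2 p))).
Proof.
move=> /measurable_cmod/(@measurable_funTS _ _ _ _ (B 0 r)).
by apply: eq_measurable_fun => p; rewrite inE B0E /cut => ->.
Qed.

End approximation.

(** * The mean value property of [ln |q|] for nonvanishing [q] *)

Section area_mean.
Context {R : realType}.
Local Notation C := R[i].
Local Notation mu2 := (@leb2 R).
Local Open Scope complex_scope.
Implicit Types (f q : C -> C) (z w : C) (r : R) (s : seq C).

Lemma integrable_ln_sum s r : 0 < r -> 0 \notin s ->
  mu2.-integrable (B 0 r) (EFin \o (fun p => \sum_(b <- s) ln (cmod (c2 p - b)))) /\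
  \int[mu2]_(p in B 0 r) (\sum_(b <- s) ln (cmod (c2 p - b))) =
  \sum_(b <- s) \int[mu2]_(p in B 0 r) ln (Num.max (cmod (c2 p)) (cmod b)).
Proof.
move=> r0; elim: s => [_|b s ih].
  split; last by rewrite big_nil; under eq_Rintegral do rewrite big_nil; rewrite leb2_Rintegral_cst// mul0r.
  apply: (@integrable_bounded _ _ _ 0) => //.
  - exact: mu2_B_lty.
  - by under eq_fun do rewrite big_nil; exact: measurable_cst.
  - by move=> p _; rewrite big_nil normr0.
rewrite inE negb_or eq_sym => /andP[b0 /ih[i1 i2]].
have ib := integrable_log_potential b0 r0.
have e : (fun p => \sum_(b <- b :: s) ln (cmod (c2 p - b))) = (fun p => ln (cmod (c2 p - b)) + \sum_(b <- s) ln (cmod (c2 p - b))).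
  by apply/funext => p; rewrite big_cons.
rewrite e; split; first by have h := integrableD (measurable_B 0 r) ib i1; exact: h.
by rewrite leb2_RintegralD// i2 big_cons (Rintegral_log_potential b0 r0).
Qed.

Lemma mean_ln_max b r : 0 < r -> r <= cmod b ->
  \int[mu2]_(p in B 0 r) ln (Num.max (cmod (c2 p)) (cmod b)) = alpha * r ^+ 2 * ln (cmod b).
Proof.
move=> r0 rb; rewrite mulrC -(leb2_Rintegral_cst 0 _ r0); apply: eq_Rintegral => p.
rewrite inE B0E => pr; congr ln; rewrite max_r//; apply: ltW; exact: lt_le_trans rb.
Qed.

(** All roots lie outside the disc, so each factor contributes its potential at the centre. *)
Lemma mean_ln_poly (P : {poly C}) r : 0 < r -> (forall z, cmod z < r -> P.[z] != 0) ->
  \int[mu2]_(p in B 0 r) ln (cmod P.[c2 p]) = alpha * r ^+ 2 * ln (cmod P.[0]).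
Proof.
move=> r0 hP; have [s sE] := closed_field_poly_normal P.
have P0 : P.[0] != 0 by apply: hP; rewrite cmod0.
have lP : lead_coef P != 0 by rewrite lead_coef_eq0; apply: contraNneq P0 => ->; rewrite horner0.
have hs z : P.[z] = lead_coef P * \prod_(b <- s) (z - b).
  by rewrite {1}sE hornerZ horner_prod; congr (_ * _); apply: eq_bigr => b _; rewrite hornerXsubC.
have sr b : b \in s -> r <= cmod b.
  move=> bs; rewrite leNgt; apply/negP => /hP; rewrite hs mulf_eq0 negb_or => /andP[_ /negP[]].
  by rewrite prodf_seq_eq0; apply/hasP; exists b; rewrite // subrr eqxx.
have s0 : 0 \notin s by apply/negP => /sr; rewrite cmod0 leNgt r0.
have lnE z : P.[z] != 0 -> ln (cmod P.[z]) = ln (cmod (lead_coef P)) + \sum_(b <- s) ln (cmod (z - b)).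
  rewrite hs mulf_eq0 negb_or => /andP[_ hz].
  rewrite cmodM lnM ?posrE ?cmod_gt0//; congr (_ + _); rewrite cmod_prod.
  elim: s {sE hs sr s0} hz => [|b s ih]; first by rewrite !big_nil ln1.
  rewrite !big_cons mulf_eq0 negb_or => /andP[hb /[dup] hz /ih <-].
  by rewrite lnM ?posrE ?cmod_gt0// -cmod_prod cmod_gt0.
have [i1 i2] := integrable_ln_sum r0 s0.
have -> : \int[mu2]_(p in B 0 r) ln (cmod P.[c2 p]) =
   \int[mu2]_(p in B 0 r) (ln (cmod (lead_coef P)) + \sum_(b <- s) ln (cmod (c2 p - b))).
  by apply: eq_Rintegral => p; rewrite inE B0E => /hP/lnE.
rewrite leb2_RintegralD//; last first.
  apply: (@integrable_bounded _ _ _ `|ln (cmod (lead_coef P))|) => //; first exact: mu2_B_lty.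
rewrite i2 leb2_Rintegral_cst// lnE// mulrDr [alpha * _ * ln _]mulrC; congr (_ + _).
rewrite mulr_sumr !big_seq; apply: eq_bigr => b /sr rb.
by rewrite mean_ln_max// sub0r cmodN.
Qed.

Lemma ln_dist (x y c : R) : 0 < c -> c <= x -> c <= y -> `|ln x - ln y| <= `|x - y| / c.
Proof.
have h (u v : R) : 0 < c -> c <= u -> c <= v -> ln u - ln v <= `|u - v| / c.
  move=> c0 cu cv; have u0 : 0 < u by lra. have v0 : 0 < v by lra.
  rewrite -ln_div ?posrE//; apply: (@le_trans _ _ ((u - v) / v)).
    have -> : u / v = 1 + (u - v) / v by field; rewrite gt_eqF.
    apply: le_ln1Dx; rewrite mulrBl divff ?gt_eqF//.
    by have := divr_gt0 u0 v0; lra.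
  apply: (@le_trans _ _ (`|u - v| / v)); first by rewrite ler_pM2r ?invr_gt0// ler_norm.
  by rewrite ler_wpM2l// lef_pV2 ?posrE.
move=> c0 cx cy; rewrite ler_norml; have := h x y c0 cx cy; have := h y x c0 cy cx.
rewrite distrC; lra.
Qed.

(** Polynomial approximation takes the place of a holomorphic logarithm: since [|q|] is bounded
    below, polynomials close to [q] have no zero in the disc and logarithms uniformly close to
    [ln |q|]. *)
Lemma mean_ln_nonvanishing q r r1 : 0 < r -> r < r1 ->
  (forall u, cmod u <= r1 -> exists L, cder q u L) -> (forall u, cmod u <= r1 -> q u != 0) ->
  mu2.-integrable (B 0 r) (EFin \o (fun p => ln (cmod (q (c2 p))))) /\
  \int[mu2]_(p in B 0 r) ln (cmod (q (c2 p))) = alpha * r ^+ 2 * ln (cmod (q 0)).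
Proof.
move=> r0 rr1 hq q0.
have [M M0 qM] := closed_disc_bounded (ltW r0) rr1 hq.
have hV u : cmod u <= r1 -> exists L, cder (fun u => (q u)^-1) u L.
  by move=> ur; have [L hL] := hq u ur; eexists; apply: (cder_inv hL); exact: q0.
have [M' M'0 qM'] := closed_disc_bounded (ltW r0) rr1 hV.
have ql u : cmod u <= r -> M'^-1 <= cmod (q u).
  move=> ur; have := qM' u ur; rewrite cmodV -{1}[M']invrK lef_pV2 ?posrE ?invr_gt0//.
  by rewrite cmod_gt0 q0// (le_trans ur)// ltW.
pose c := M'^-1; have c0 : 0 < c by rewrite invr_gt0.
have mq := cmeasurable_cut_lt (ltW r0) rr1 hq.
have bnd (x : R) : c <= x -> x <= M -> `|ln x| <= `|ln c| + `|ln M|.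
  move=> cx xM; rewrite ler_norml.
  have h1 : ln c <= ln x by rewrite ler_ln ?posrE//; lra.
  have h2 : ln x <= ln M by rewrite ler_ln ?posrE//; lra.
  have := ler_norm (ln M); have := ler_norm (- ln c); rewrite normrN.
  have := normr_ge0 (ln M); have := normr_ge0 (ln c); lra.
have iq : mu2.-integrable (B 0 r) (EFin \o (fun p => ln (cmod (q (c2 p))))).
  apply: (@integrable_bounded _ _ _ (`|ln c| + `|ln M|)) => //.
  - exact: mu2_B_lty.
  - by apply: measurableT_comp; [exact: measurable_ln|exact: measurable_cut_cmod].
  - by move=> p; rewrite B0E => /ltW pr; apply: bnd; [exact: ql|exact: qM].
split=> //; apply/eqP; rewrite -subr_eq0 -normr_eq0 eq_le normr_ge0 andbT.
apply/ler_addgt0Pr => e e0; rewrite add0r.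
pose D := alpha * r ^+ 2; have D0 : 0 < D by rewrite mulr_gt0 ?alpha_gt0// exprn_gt0.
(* The first bound keeps [|P| >= c / 2]. The second, with the Lipschitz constant [2 / c] of [ln]
   there, makes the logarithms differ by at most [e / D], hence the integrals by [e]. *)
pose d := Num.min (c / 2) (e * (c / 2) / D).
have d0 : 0 < d by rewrite lt_min !divr_gt0// mulr_gt0// divr_gt0.
have [P P0 hP] := poly_approx (ltW r0) rr1 hq d0.
have dc : d <= c / 2 by rewrite ge_min lexx.
have Pl u : cmod u <= r -> c / 2 <= cmod P.[u].
  move=> ur; have := hP u ur; have := ql u ur; rewrite -/c.
  have := cmodB_ge (q u) (q u - P.[u]); rewrite subKr; lra.
have Pn u : cmod u < r -> P.[u] != 0 by move=> /ltW/Pl h; rewrite -cmod_gt0; lra.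
have mP := cmeasurable_cut_poly r P.
have iP : mu2.-integrable (B 0 r) (EFin \o (fun p => ln (cmod P.[c2 p]))).
  apply: (@integrable_bounded _ _ _ (`|ln (c / 2)| + `|ln (M + c)|)) => //.
  - exact: mu2_B_lty.
  - by apply: measurableT_comp; [exact: measurable_ln|exact: measurable_cut_cmod].
  - move=> p; rewrite B0E => /ltW pr.
    have l1 := Pl _ pr; have l2 : cmod P.[c2 p] <= M + c.
      have := hP _ pr; have := qM _ pr; have := cmodB (q (c2 p)) (q (c2 p) - P.[c2 p]); rewrite subKr; lra.
    rewrite ler_norml.
    have h1 : ln (c / 2) <= ln (cmod P.[c2 p]) by rewrite ler_ln ?posrE//; lra.
    have h2 : ln (cmod P.[c2 p]) <= ln (M + c) by rewrite ler_ln ?posrE//; lra.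
    have := ler_norm (ln (M + c)); have := ler_norm (- ln (c / 2)); rewrite normrN.
    have := normr_ge0 (ln (M + c)); have := normr_ge0 (ln (c / 2)); lra.
have mean := mean_ln_poly r0 Pn; rewrite P0 in mean; rewrite -mean.
pose k : R := e / D.
have close p : B 0 r p -> `|ln (cmod (q (c2 p))) - ln (cmod P.[c2 p])| <= k.
  rewrite B0E => /ltW pr; have c20 : 0 < c / 2 by rewrite divr_gt0.
  apply: le_trans (ln_dist c20 _ (Pl _ pr)) _; first by have := ql _ pr; rewrite -/c; lra.
  rewrite ler_pdivrMr//; apply: (@le_trans _ _ d).
    have := hP _ pr; rewrite ler_norml; have := cmodB_ge (q (c2 p)) (P.[c2 p]).
    have := cmodB_ge P.[c2 p] (q (c2 p)); rewrite cmodBC; lra.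
  by rewrite /k mulrAC ge_min lexx orbT.
have ik (x : R) : mu2.-integrable (B 0 r) (EFin \o (fun=> x)).
  by apply: (@integrable_bounded _ _ _ `|x|) => //; exact: mu2_B_lty.
have i2 (x : R) : mu2.-integrable (B 0 r) (EFin \o (fun p => ln (cmod P.[c2 p]) + x)).
  by have h := integrableD (measurable_B 0 r) iP (ik x); exact: h.
have kD : k * D = e by rewrite divfK// gt_eqF.
have u1 : \int[mu2]_(p in B 0 r) ln (cmod (q (c2 p))) <= \int[mu2]_(p in B 0 r) (ln (cmod P.[c2 p]) + k).
  apply: leb2_le_Rintegral => // p /close; rewrite ler_norml; clear; lra.
have u2 : \int[mu2]_(p in B 0 r) (ln (cmod P.[c2 p]) + - k) <= \int[mu2]_(p in B 0 r) ln (cmod (q (c2 p))).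
  apply: leb2_le_Rintegral => // p /close; rewrite ler_norml; clear; lra.
rewrite !leb2_RintegralD// !leb2_Rintegral_cst// -/D mulNr kD in u1 u2.
by rewrite ler_distl u2 u1.
Qed.

Lemma mu2_point (z : C) : mu2 [set p | c2 p = z] = 0%E.
Proof.
have mz : measurable [set p : R * R | c2 p = z].
  have := measurable_cmod_c2 z measurableT (measurable_set1 0); rewrite setTI.
  congr measurable; apply/seteqP; split => p /=; last by move=> ->; rewrite subrr cmod0.
  by move=> /eqP; rewrite cmod_eq0 subr_eq0 => /eqP.
apply/eqP; rewrite eq_le measure_ge0 andbT; apply/lee_addgt0Pr => e e0; rewrite add0e.
have a0 := @alpha_gt0 R.
have r0 : 0 < Num.sqrt (e / alpha) :> R by rewrite sqrtr_gt0 divr_gt0.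
have : (mu2 [set p | c2 p = z] <= mu2 (B z (Num.sqrt (e / alpha))))%E.
  apply: le_measure; [by apply: mem_set|by apply: mem_set|].
  by move=> p /= pz; rewrite /B/= pz subrr cmod0.
rewrite mu2_B// sqr_sqrtr; last by apply: divr_ge0; exact: ltW.
by rewrite (_ : alpha * (e / alpha) = e)//; field; rewrite gt_eqF.
Qed.

End area_mean.

(** * The integrated Jensen formula and factorization by zeros *)

Section jensen.
Context {R : realType}.
Local Notation C := R[i].
Local Notation mu2 := (@leb2 R).
Local Open Scope complex_scope.
Implicit Types (f g q : C -> C) (z w a : C) (r : R) (s : seq C).

(* The integral of [ln^+ (|z|/|a|)] over the disc, i.e. the weight of the zero [a] in the integrated Jensen formula. *)
Definition Kr r a : R :=
  \int[mu2]_(p in B 0 r) ln (Num.max (cmod (c2 p)) (cmod a)) - alpha * r ^+ 2 * ln (cmod a).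

Lemma negligible_seq s : mu2.-negligible [set p | c2 p \in s].
Proof.
elim: s => [|b s ih].
  by rewrite (_ : [set p | _] = set0); [exact: negligible_set0|apply/seteqP; split].
apply: (@negligibleS _ _ _ _ ([set p | c2 p = b] `|` [set p | c2 p \in s])).
  by move=> p /=; rewrite inE => /orP[/eqP|]; [left|right].
apply: negligibleU => //; exists [set p | c2 p = b]; split => //; last exact: mu2_point.
have := measurable_cmod_c2 b measurableT (measurable_set1 0); rewrite setTI.
congr measurable; apply/seteqP; split => p /=; last by move=> ->; rewrite subrr cmod0.
by move=> /eqP; rewrite cmod_eq0 subr_eq0 => /eqP.
Qed.

Lemma ln_cmod_prod z s : z \notin s -> ln (cmod (\prod_(b <- s) (z - b))) = \sum_(b <- s) ln (cmod (z - b)).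
Proof.
elim: s => [|b s ih]; first by rewrite !big_nil cmod1 ln1.
rewrite inE negb_or => /andP[zb zs]; rewrite !big_cons -(ih zs) cmodM lnM ?posrE ?cmod_gt0 ?subr_eq0//.
by rewrite prodf_seq_neq0; apply/allP => c cs /=; rewrite subr_eq0; apply: contraNneq zs => ->.
Qed.

(** Each zero contributes a logarithmic potential and [q] its value at [0]. The constant [A]
    prepares for [ln M], with which the integrand is nonnegative and Tonelli's theorem is
    available. *)
Lemma jensen_area g q s r r1 A : 0 < r -> r < r1 ->
  (forall u, cmod u <= r1 -> exists L, cder q u L) -> (forall u, cmod u <= r1 -> q u != 0) ->
  (forall u, cmod u <= r1 -> g u = \prod_(b <- s) (u - b) * q u) -> 0 \notin s ->
  (\int[mu2]_(p in B 0 r) (A - ln (cmod (g (c2 p))))%:E + (\sum_(b <- s) Kr r b)%:E =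
   (alpha * r ^+ 2 * (A - ln (cmod (g 0))))%:E)%E.
Proof.
move=> r0 rr1 hq q0 gE s0.
have [i1 e1] := integrable_ln_sum r0 s0.
have [i2 e2] := mean_ln_nonvanishing r0 rr1 hq q0.
have iA : mu2.-integrable (B 0 r) (EFin \o (fun=> A)).
  by apply: (@integrable_bounded _ _ _ `|A|) => //; exact: mu2_B_lty.
pose S p := \sum_(b <- s) ln (cmod (c2 p - b)).
pose h p := A - (S p + ln (cmod (q (c2 p)))).
have i3 : mu2.-integrable (B 0 r) (EFin \o (fun p => S p + ln (cmod (q (c2 p))))).
  by have h' := integrableD (measurable_B 0 r) i1 i2; exact: h'.
have ih : mu2.-integrable (B 0 r) (EFin \o h).
  by have h' := integrableB (measurable_B 0 r) iA i3; exact: h'.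
have lnE z : cmod z <= r1 -> z \notin s -> A - ln (cmod (g z)) = A - (\sum_(b <- s) ln (cmod (z - b)) + ln (cmod (q z))).
  move=> zr zs; rewrite gE// cmodM.
  have p0 : 0 < cmod (\prod_(b <- s) (z - b)).
    by rewrite cmod_gt0 prodf_seq_neq0; apply/allP => c cs /=; rewrite subr_eq0; apply: contraNneq zs => ->.
  have q00 : 0 < cmod (q z) by rewrite cmod_gt0 q0.
  by rewrite lnM// ln_cmod_prod.
have mg : measurable_fun (B 0 r) (fun p => A - ln (cmod (g (c2 p)))).
  have hg u : cmod u <= (r + r1) / 2 -> exists L, cder g u L.
    move=> ur; have ur1 : cmod u < r1 by lra.
    have [L hL] : exists L, cder (fun u => \prod_(b <- s) (u - b) * q u) u L.
      apply: exists_cderM; last by apply: hq; exact: ltW.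
      elim: (s) => [|b s' [M hM]].
        by exists 0; apply: cder_local ltr01 _ (cder_cst 1 u) => v _; rewrite big_nil.
      eexists; apply: (cder_local ltr01) (cderM (cderD (cder_id u) (cder_cst (- b) u)) hM).
      by move=> v _; rewrite big_cons.
    exists L; apply: (cder_local (r := r1 - cmod u)) hL; first by rewrite subr_gt0.
    move=> v vu; rewrite gE//; have := cmodD (v - u) u; rewrite subrK; lra.
  apply: measurable_funB; first exact: measurable_cst.
  apply: measurableT_comp; first exact: measurable_ln.
  apply: measurable_cut_cmod; apply: (cmeasurable_cut_lt (r1 := (r + r1) / 2)) => //; [exact: ltW|lra].
(* At a zero the convention [ln 0 = 0] breaks the additivity of [ln], so the integrands are compared
   off the finite list [s] only. *)
have -> : (\int[mu2]_(p in B 0 r) (A - ln (cmod (g (c2 p))))%:E = \int[mu2]_(p in B 0 r) (h p)%:E)%E.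
  apply: ae_eq_integral => //.
  - exact/measurable_EFinP.
  - exact: measurable_int ih.
  apply: (negligibleS _ (negligible_seq s)) => p /= /not_implyP[+ H].
  rewrite B0E => pr; apply: contrapT => /negP ps; apply: H; rewrite lnE//.
  by apply: ltW; exact: lt_trans rr1.
have fi := integrable_fin_num (measurable_B 0 r) ih.
rewrite -(fineK fi) -EFinD; congr EFin.
have -> : fine (\int[mu2]_(p in B 0 r) ((EFin \o h) p))%E = \int[mu2]_(p in B 0 r) h p by [].
have -> : \int[mu2]_(p in B 0 r) h p = \int[mu2]_(p in B 0 r) (A + -1 * (S p + ln (cmod (q (c2 p))))).
  by apply: eq_Rintegral => p _; rewrite mulN1r.
rewrite leb2_RintegralD//; last first.
  have h' := integrableZl (measurable_B 0 r) (-1) i3; exact: h'.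
rewrite leb2_RintegralZl// leb2_RintegralD// e1 e2 leb2_Rintegral_cst//.
rewrite lnE ?cmod0//; last by rewrite ltW// (lt_trans r0).
rewrite /Kr sumrB -mulr_sumr.
under [in RHS]eq_bigr do rewrite sub0r cmodN.
by ring.
Qed.

Lemma exists_cder_prod s u : exists L, cder (fun u => \prod_(b <- s) (u - b)) u L.
Proof.
elim: s => [|b s' [M hM]].
  by exists 0; apply: cder_local ltr01 _ (cder_cst 1 u) => v _; rewrite big_nil.
eexists; apply: (cder_local ltr01) (cderM (cderD (cder_id u) (cder_cst (- b) u)) hM).
by move=> v _; rewrite big_cons.
Qed.

(** Serves twice: to show that finitely many zeros can be split off, and to count the zeros close to
    a given point. The factor [2] is that of [tcoef_bound]. *)
Lemma zero_count f q s r r1 M : 0 <= r -> 0 < r1 ->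
  (forall u, cmod u <= r1 -> exists L, cder q u L) ->
  (forall u, cmod u <= r1 -> f u = \prod_(b <- s) (u - b) * q u) ->
  (forall b, b \in s -> cmod b <= r) -> (forall u, cmod u = r1 -> cmod (f u) <= M) ->
  cmod (f 0) <= 2 * M * (r / r1) ^+ size s.
Proof.
move=> r0 r10 hq fE sr fM.
have r1c : r1%:C != 0 :> C by rewrite -cmod_gt0 cmod_real normr_gt0 gt_eqF.
(* [f] divided by the Blaschke product of the disc of radius [r1], so that [|F| = |f|] on its boundary *)
pose F u := q u * \prod_(b <- s) (r1%:C - (conjc b / r1%:C) * u).
have hF u : cmod u <= r1 -> exists L, cder F u L.
  move=> ur; apply: exists_cderM; first exact: hq.
  elim: (s) => [|b s' [L hL]].
    by exists 0; apply: cder_local ltr01 _ (cder_cst 1 u) => v _; rewrite big_nil.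
  eexists; apply: (cder_local ltr01) (cderM (cderD (cder_cst r1%:C u) (cderN (cderM (cder_cst (conjc b / r1%:C) u) (cder_id u)))) hL).
  by move=> v _; rewrite big_cons.
have circle_eq u b : cmod u = r1 -> cmod (r1%:C - (conjc b / r1%:C) * u) = cmod (u - b).
  move=> ur; have uu : r1%:C * r1%:C = u * conjc u.
    by rewrite -rmorphM/= -expr2 -ur cmod_sqr; case: (u) => x y; apply/eqP; rewrite eq_complex/=; apply/andP; split; apply/eqP; ring.
  have -> : r1%:C - (conjc b / r1%:C) * u = u * conjc (u - b) / r1%:C.
    by rewrite rmorphB/= mulrBr -uu mulrBl mulfK//; congr (_ - _); rewrite mulrC mulrA.
  by rewrite cmod_div cmodM cmod_conj cmod_real ur ger0_norm ?(ltW r10)// mulrAC divff ?mul1r// gt_eqF.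
have FM y : 0 <= y <= pi *+ 2 -> cmod (F (circ r1 y)) <= M.
  move=> _; have cr : cmod (circ r1 y) = r1 by rewrite cmod_circ// ltW.
  have -> : cmod (F (circ r1 y)) = cmod (f (circ r1 y)); last exact: fM.
  rewrite fE ?cr// /F mulrC !cmodM !cmod_prod; congr (_ * _).
  by apply: eq_bigr => b _; exact: circle_eq.
have := tcoef_bound 0 r10 (fun u ur => hF u (eq_ind_r (fun t => t <= r1) (lexx r1) ur)) FM.
rewrite (tcoef0 r10 hF FM) expr0 invr1 mulr1 /F cmodM cmod_prod.
have -> : \prod_(b <- s) cmod (r1%:C - conjc b / r1%:C * 0) = r1 ^+ size s.
  under eq_bigr do rewrite mulr0 subr0 cmod_real ger0_norm ?(ltW r10)//.
  by rewrite big_const_seq count_predT iter_mulr_1.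
rewrite -ler_pdivlMr ?exprn_gt0// => h.
rewrite fE ?cmod0 ?(ltW r10)// cmodM cmod_prod.
have h2 : \prod_(b <- s) cmod (0 - b) <= r ^+ size s.
  elim: (s) sr => [|b s' ih] sr; first by rewrite big_nil.
  rewrite big_cons exprS; apply: ler_pM => //.
  - by apply: prodr_ge0.
  - by rewrite sub0r cmodN sr// mem_head.
  - by apply: ih => c cs; apply: sr; rewrite inE cs orbT.
apply: (@le_trans _ _ (r ^+ size s * (2 * M / r1 ^+ size s))).
  by apply: ler_pM => //; apply: prodr_ge0.
by rewrite expr_div_n mulrCA.
Qed.

(** Zeros are divided out one at a time. If this never stopped, lists of every length [N] would
    exist, and [zero_count] would bound [|f 0|] by [2 M (r / r2)^N], which tends to [0]. *)
Lemma zero_factorization f r : holo f -> f 0 != 0 -> 0 < r -> r < 1 ->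
  exists s q, [/\ holo q, forall b, b \in s -> cmod b < r,
    forall u, f u = \prod_(b <- s) (u - b) * q u & forall u, cmod u < r -> q u != 0].
Proof.
move=> hf f0 r0 r1.
pose ok s q := [/\ holo q, forall b, b \in s -> cmod b < r & forall u, f u = \prod_(b <- s) (u - b) * q u].
apply: contrapT => nex.
have grow n : exists s q, size s = n /\ ok s q.
  elim: n => [|n [s [q [sn [hq sr fE]]]]].
    by exists [::], f; split => //; split => // u; rewrite big_nil mul1r.
  have [a ar qa] : exists2 a, cmod a < r & q a = 0.
    apply: contrapT => na; apply: nex; exists s, q; split => // u ur.
    by apply/eqP => qu; apply: na; exists u.
  have a1 : cmod a < 1 by exact: lt_trans r1.
  exists (a :: s), (quot q a); split; first by rewrite /= sn.
  split=> [|b|u]; first exact: holo_quot.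
    by rewrite inE => /orP[/eqP ->|/sr].
  by rewrite fE big_cons {1}(quotE qa u) mulrA [(_ - a) * _]mulrC.
pose r2 := (1 + r) / 2; have r20 : 0 < r2 by rewrite /r2; lra.
have r21 : r2 < (1 + r2) / 2 by rewrite /r2; lra.
have hfr u : cmod u <= (1 + r2) / 2 -> exists L, cder f u L by move=> ur; apply: hf; rewrite /r2 in ur; lra.
have [M M0 fM] := closed_disc_bounded (ltW r20) r21 hfr.
have tb : 0 <= r / r2 < 1.
  by rewrite divr_ge0 ?(ltW r0) ?(ltW r20)//= ltr_pdivrMr// mul1r /r2; lra.
have fp : 0 < cmod (f 0) by rewrite cmod_gt0.
have K0 : 0 <= 2 * M by rewrite mulr_ge0// ltW.
have [N hN] := cvg_expr_small tb K0 fp.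
have [s [q [sN [hq sr fE]]]] := grow N.
have := @zero_count f q s r r2 M (ltW r0) r20.
have hq2 u : cmod u <= r2 -> exists L, cder q u L by move=> ur; apply: hq; rewrite /r2 in ur; lra.
have fM2 u : cmod u = r2 -> cmod (f u) <= M by move=> ur; apply: fM; rewrite ur.
move=> /(_ hq2 (fun u _ => fE u) (fun b bs => ltW (sr b bs)) fM2).
by rewrite sN leNgt hN.
Qed.

Lemma mult_count (phi q : C -> C) w s a : holo q -> a \in s -> cmod a < 1 -> q a != 0 ->
  (forall u, phi u - w = \prod_(b <- s) (u - b) * q u) -> mult phi a = count_mem a s.
Proof.
move=> hq sa a1 qa fE.
apply: (@mult_factor _ phi (fun u => \prod_(b <- s | b != a) (u - b) * q u) a w) => //.
- by rewrite -has_count has_pred1.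
- move=> u u1; apply: exists_cderM; last exact: hq.
  have [L hL] := exists_cder_prod [seq b <- s | b != a] u; exists L.
  by apply: (cder_local ltr01) hL => v _; rewrite big_filter.
- rewrite mulf_neq0// prodf_seq_neq0; apply/allP => b bs; apply/implyP => ba.
  by rewrite subr_eq0 eq_sym.
move=> u u1; rewrite mulrA -[phi u](subrK w) fE addrC; congr (_ + _ * _).
rewrite (bigID (pred1 a)) /=; congr (_ * _).
rewrite -big_filter (eq_big_seq (fun=> u - a)); last by move=> b; rewrite mem_filter => /andP[/eqP ->].
by rewrite big_const_seq count_predT size_filter iter_mulr_1.
Qed.

End jensen.

(** * Size of the Jensen weight [Kr] and averages of logarithms *)

Section kernel.
Context {R : realType}.
Local Notation C := R[i].
Local Notation mu2 := (@leb2 R).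
Local Open Scope complex_scope.
Implicit Types (z w a b c : C) (r s k : R).

Lemma ln_le_subr1 (x : R) : 0 < x -> ln x <= x - 1.
Proof.
by move=> x0; rewrite -{1}[x](subrK 1) addrC; apply: le_ln1Dx; rewrite ltrBrDr addrC subrr.
Qed.

Lemma Rintegral_disc_annulus r rho k : 0 < r -> 0 < rho -> rho <= r ->
  mu2.-integrable (B 0 r) (EFin \o (fun p => k - k * \1_(B 0 rho) p)) /\
  \int[mu2]_(p in B 0 r) (k - k * \1_(B 0 rho) p) = k * (alpha * (r ^+ 2 - rho ^+ 2)).
Proof.
move=> r0 rho0 rr.
have i0 x : mu2.-integrable (B 0 r) (EFin \o (fun=> x)).
  by apply: (@integrable_bounded _ _ _ `|x|) => //; exact: mu2_B_lty.
have i1 : mu2.-integrable (B 0 r) (EFin \o (\1_(B 0 rho) : _ -> R)).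
  apply: (@integrable_bounded _ _ _ 1) => //; first exact: mu2_B_lty.
  by move=> p _; rewrite indicE; case: (_ \in _); rewrite ?normr1 ?normr0.
have i2 : mu2.-integrable (B 0 r) (EFin \o (fun p => - k * \1_(B 0 rho) p)).
  by have h := integrableZl (measurable_B 0 r) (- k) i1; exact: h.
have e : (fun p => k - k * \1_(B 0 rho) p) = (fun p => k + - k * \1_(B 0 rho) p).
  by apply/funext => p; rewrite mulNr.
have e1 : \int[mu2]_(p in B 0 r) \1_(B 0 rho) p = alpha * rho ^+ 2.
  rewrite /Rintegral integral_indic//.
  transitivity (fine (mu2 (B 0 rho))); last by rewrite mu2_B.
  congr (fine (mu2 _)).
  by apply/seteqP; split => p [] // h; split => //; move: h; rewrite !B0E => /lt_le_trans; apply.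
rewrite e; split; first by have h := integrableD (measurable_B 0 r) (i0 k) i2; exact: h.
by rewrite leb2_RintegralD// leb2_RintegralZl// e1 leb2_Rintegral_cst//; ring.
Qed.

Section bounds.
Variables (r : R) (a : C).
Hypotheses (r0 : 0 < r) (a0 : a != 0).

Let F (p : R * R) := ln (Num.max (cmod (c2 p)) (cmod a)) - ln (cmod a).
Let ca : 0 < cmod a. Proof. by rewrite cmod_gt0. Qed.

Let F0 p : 0 <= F p.
Proof. by rewrite subr_ge0 ler_ln ?posrE ?lt_max ?ca ?orbT// le_max lexx orbT. Qed.

Let mF : measurable_fun setT (fun p : R * R => ln (Num.max (cmod (c2 p)) (cmod a))).
Proof.
apply: measurableT_comp; first exact: measurable_ln.
by apply: measurable_maxr; [exact: measurable_cmod (@cmeasurable_c2 R)|exact: measurable_cst].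
Qed.

Let bF p : B 0 r p -> `|ln (Num.max (cmod (c2 p)) (cmod a))| <= `|ln (cmod a)| + `|ln (Num.max r (cmod a))|.
Proof.
rewrite B0E => pr; have h1 := F0 p; rewrite /F subr_ge0 in h1.
have h2 : ln (Num.max (cmod (c2 p)) (cmod a)) <= ln (Num.max r (cmod a)).
  rewrite ler_ln ?posrE ?lt_max ?ca ?orbT// ge_max !le_max lexx (ltW pr) orbT//.
rewrite ler_norml; have := ler_norm (ln (Num.max r (cmod a))); have := ler_norm (- ln (cmod a)).
rewrite normrN; have := normr_ge0 (ln (Num.max r (cmod a))); have := normr_ge0 (ln (cmod a)); lra.
Qed.

Let iL : mu2.-integrable (B 0 r) (EFin \o (fun p => ln (Num.max (cmod (c2 p)) (cmod a)))).
Proof.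
apply: (@integrable_bounded _ _ _ (`|ln (cmod a)| + `|ln (Num.max r (cmod a))|)) => //.
- exact: mu2_B_lty.
- exact: measurable_funTS.
Qed.

Let ik x : mu2.-integrable (B 0 r) (EFin \o (fun=> x)).
Proof. by apply: (@integrable_bounded _ _ _ `|x|) => //; exact: mu2_B_lty. Qed.

Let iF : mu2.-integrable (B 0 r) (EFin \o F).
Proof. by have h := integrableB (measurable_B 0 r) iL (ik (ln (cmod a))); exact: h. Qed.

Let KrE : Kr r a = \int[mu2]_(p in B 0 r) F p.
Proof.
rewrite /Kr /F.
rewrite (leb2_RintegralD (g := fun=> - ln (cmod a)) (measurable_B 0 r) iL (ik _)).
by rewrite leb2_Rintegral_cst//; ring.
Qed.

Lemma Kr_ge0 : 0 <= Kr r a.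
Proof.
rewrite KrE -(mul0r (alpha * r ^+ 2)) -(leb2_Rintegral_cst 0 0 r0).
by apply: leb2_le_Rintegral.
Qed.

Lemma Kr_far : r <= cmod a -> Kr r a = 0.
Proof. by move=> ra; rewrite /Kr mean_ln_max// subrr. Qed.

Lemma Kr_annulus_ge rho k : 0 <= k -> 0 < rho -> rho <= r ->
  (forall z, rho <= cmod z -> k <= ln (cmod z) - ln (cmod a)) ->
  k * (alpha * (r ^+ 2 - rho ^+ 2)) <= Kr r a.
Proof.
move=> k0 rho0 rr hk; have [i1 <-] := Rintegral_disc_annulus k r0 rho0 rr.
rewrite KrE; apply: leb2_le_Rintegral => // p pr; rewrite indicE.
case: (boolP (p \in _)); first by rewrite mulr1 subrr.
move=> pn; rewrite mulr0 subr0; have {}pn : rho <= cmod (c2 p).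
  by rewrite leNgt; apply: contra pn => h; rewrite inE B0E.
apply: le_trans (hk _ pn) _; rewrite /F lerD2r ler_ln ?posrE ?lt_max ?ca ?orbT ?le_max ?lexx//.
exact: lt_le_trans pn.
Qed.

(** The integrand lives on the annulus [|a| <= |z| < r], where it is at most [L = ln (1/|a|)]; the
    area of the annulus is at most [2 alpha L]. *)
Lemma Kr_le : r <= 1 -> cmod a < 1 -> Kr r a <= 2 * alpha * ln (cmod a)^-1 ^+ 2.
Proof.
move=> r1 a1; have al0 := @alpha_gt0 R.
have [ra|ar] := leP r (cmod a); first by rewrite Kr_far// mulr_ge0 ?sqr_ge0// mulr_ge0// ltW.
set L := ln (cmod a)^-1; have LE : L = - ln (cmod a) by rewrite /L lnV.
have L0 : 0 <= L by rewrite ln_ge0// invf_ge1// ltW.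
have [i1 e1] := Rintegral_disc_annulus L r0 ca (ltW ar).
apply: (@le_trans _ _ (L * (alpha * (r ^+ 2 - cmod a ^+ 2)))).
  rewrite KrE -e1; apply: leb2_le_Rintegral => // p; rewrite B0E => pr; rewrite /F indicE.
  case: (boolP (p \in _)).
    by rewrite inE B0E => h; rewrite mulr1 subrr max_r ?subrr// ltW.
  move=> pn; rewrite mulr0 subr0 LE gerDr.
  by rewrite ln_le0// ge_max (ltW a1) andbT; apply: ltW; exact: lt_le_trans r1.
have h : r ^+ 2 - cmod a ^+ 2 <= 2 * L.
  have : 1 - cmod a <= L by have := ln_le_subr1 ca; rewrite LE; lra.
  have : r ^+ 2 <= 1 by rewrite expr_le1// ltW.
  have : 0 <= (1 - cmod a) ^+ 2 by exact: sqr_ge0.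
  rewrite sqrrB; have := ca; nra.
rewrite expr2 (_ : 2 * alpha * (L * L) = L * (alpha * (2 * L))); last by ring.
by rewrite ler_wpM2l// ler_pM2l.
Qed.

Lemma lnV_le2 : 1 / 2 <= cmod a -> cmod a <= 1 -> ln (cmod a)^-1 <= 2 * (1 - cmod a).
Proof.
move=> a2 a1; have := @ln_le_subr1 (cmod a)^-1; rewrite invr_gt0 => /(_ ca) h.
apply: le_trans h _; have -> : (cmod a)^-1 - 1 = (1 - cmod a) / cmod a by field; rewrite gt_eqF.
rewrite mulrC ler_wpM2r ?subr_ge0// -[2]invrK lef_pV2 ?posrE ?invr_gt0//; lra.
Qed.

(** With [t = 1 - |a|], the annulus [1 - t/2 <= |z| < r] has area at least [alpha t / 4], and the
    integrand is at least [t / 2] there. As [ln (1/|a|) <= 2 t], the product [alpha t^2 / 8] yields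
    the constant [alpha / 32]. *)
Lemma Kr_ge : 1 / 2 <= cmod a -> cmod a < 1 -> 1 - (1 - cmod a) / 4 <= r -> r <= 1 ->
  alpha / 32 * ln (cmod a)^-1 ^+ 2 <= Kr r a.
Proof.
move=> a2 a1 ra r1; have al0 := @alpha_gt0 R.
pose t := 1 - cmod a; have t0 : 0 < t by rewrite /t; lra.
have t2 : t <= 1 / 2 by rewrite /t; lra.
have aE : cmod a = 1 - t by rewrite /t; lra.
apply: (@le_trans _ _ (t / 2 * (alpha * (r ^+ 2 - (1 - t / 2) ^+ 2)))); last first.
  apply: Kr_annulus_ge; [lra|lra|rewrite aE in ra; lra|].
  move=> z hz; have z0 : 0 < cmod z by lra.
  have hd : 0 < cmod a / cmod z by rewrite divr_gt0.
  have := ln_le_subr1 hd; rewrite ln_div ?posrE// => h.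
  have : cmod a / cmod z <= 1 - t / 2.
    rewrite ler_pdivrMr// aE; nra.
  lra.
have hl := lnV_le2 a2 (ltW a1); rewrite -/t in hl.
have l0 : 0 <= ln (cmod a)^-1 by rewrite ln_ge0// invf_ge1// ltW.
have h1 : ln (cmod a)^-1 ^+ 2 <= (2 * t) ^+ 2 by rewrite lerXn2r// nnegrE; lra.
have h2 : t / 4 <= r ^+ 2 - (1 - t / 2) ^+ 2 by rewrite aE in ra; nra.
apply: (@le_trans _ _ (alpha * (t / 2 * (t / 4)))).
  rewrite (_ : alpha * (t / 2 * (t / 4)) = alpha / 32 * (2 * t) ^+ 2); last by field.
  by rewrite ler_pM2l// divr_gt0.
by rewrite [leRHS]mulrCA ler_pM2l// ler_pM2l//; lra.
Qed.

(** Three quarters of the disc lie beyond radius [r / 2], where [|z| >= 2 |a|]. *)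
Lemma Kr_near : cmod a <= r / 4 -> alpha * r ^+ 2 * (3 / 4 * ln 2) <= Kr r a.
Proof.
move=> ar; have rh : 0 < r / 2 by rewrite divr_gt0.
have l0 : 0 <= ln (2 : R) by rewrite ln_ge0// ler1n.
have := @Kr_annulus_ge (r / 2) (ln 2) l0 rh.
have -> : ln 2 * (alpha * (r ^+ 2 - (r / 2) ^+ 2)) = alpha * r ^+ 2 * (3 / 4 * ln 2) by field.
apply; first by lra.
move=> z hz; have z0 : 0 < cmod z by lra.
by rewrite -ln_div ?posrE// ler_ln ?posrE ?divr_gt0// ler_pdivlMr//; lra.
Qed.

(** The averaging loss is the same integral [Kr] as the weight of a zero in Jensen's formula, here
    for the disc of values and the point [c - p0]. *)
Lemma avg_log (c p0 : C) A : c - p0 = a ->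
  (\int[mu2]_(p in B p0 r) (A - ln (cmod (c - c2 p)))%:E = (alpha * r ^+ 2 * (A - ln (cmod a)) - Kr r a)%:E)%E.
Proof.
move=> cE.
rewrite (integral_translate p0 r (f := fun z => (A - ln (cmod (c - z)))%:E)); last first.
  apply/measurable_EFinP/measurable_funB; first exact: measurable_cst.
  apply: measurableT_comp; first exact: measurable_ln.
  apply: measurable_cmod; apply: cmeasurableD; first exact: cmeasurable_cst.
  exact: cmeasurableN (@cmeasurable_c2 R).
have il := integrable_log_potential a0 r0.
have ih : mu2.-integrable (B 0 r) (EFin \o (fun p => A + -1 * ln (cmod (c2 p - a)))).
  have h1 := integrableZl (measurable_B 0 r) (-1) il.
  by have h2 := integrableD (measurable_B 0 r) (ik A) h1; exact: h2.
have -> : (\int[mu2]_(p in B 0 r) (A - ln (cmod (c - (c2 p + p0)%R)))%:E =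
  \int[mu2]_(p in B 0 r) ((A + -1 * ln (cmod (c2 p - a)))%R)%:E)%E.
  apply: eq_integral => p _; congr EFin; rewrite mulN1r; congr (_ - ln _).
  by rewrite -cE cmodBC; congr cmod; ring.
rewrite -(fineK (integrable_fin_num (measurable_B 0 r) ih)); congr EFin.
have -> : fine (\int[mu2]_(p in B 0 r) (EFin \o (fun p => A + -1 * ln (cmod (c2 p - a)))%R) p)%E =
  \int[mu2]_(p in B 0 r) (A + -1 * ln (cmod (c2 p - a))) by [].
rewrite leb2_RintegralD//; last by have h1 := integrableZl (measurable_B 0 r) (-1) il; exact: h1.
rewrite leb2_RintegralZl// (Rintegral_log_potential a0 r0) leb2_Rintegral_cst// /Kr; ring.
Qed.

End bounds.
End kernel.

(** * Tonelli's theorem on products of measurable sets *)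

Section tonelli.
Context {R : realType} {d1 d2 : measure_display} {T1 : measurableType d1} {T2 : measurableType d2}.
Variables (m1 : {sigma_finite_measure set T1 -> \bar R}) (m2 : {sigma_finite_measure set T2 -> \bar R}).

Lemma tonelli_on (D1 : set T1) (D2 : set T2) (f : T1 * T2 -> \bar R) :
  measurable D1 -> measurable D2 -> measurable_fun setT f -> (forall p, 0 <= f p)%E ->
  (\int[m1]_(x in D1) \int[m2]_(y in D2) f (x, y) = \int[m2]_(y in D2) \int[m1]_(x in D1) f (x, y))%E.
Proof.
move=> mD1 mD2 mf f0.
pose g := f \_ (D1 `*` D2).
have g0 p : (0 <= g p)%E by rewrite /g patchE; case: ifP.
have mg : measurable_fun setT g.
  by apply/(measurable_restrictT f (measurableX mD1 mD2)); exact: measurable_funTS.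
have := @fubini_tonelli _ _ _ _ _ m1 m2 g mg g0; rewrite /fubini_F /fubini_G => e.
transitivity (\int[m1]_x \int[m2]_y g (x, y))%E.
  rewrite integral_mkcond; apply: eq_integral => x _; rewrite patchE.
  case: ifPn => xD; last first.
    rewrite integral0_eq// => y _; rewrite /g patchE ifF//.
    by apply/negbTE; apply: contra xD => /set_mem[/= h _]; exact/mem_set.
  rewrite integral_mkcond; apply: eq_integral => y _; rewrite /g !patchE.
  by rewrite (_ : ((x, y) \in _) = (y \in D2))//; apply/idP/idP => [/set_mem[_ h]|/set_mem h]; apply/mem_set => //; split => //; exact: set_mem.
rewrite e [RHS]integral_mkcond; apply: eq_integral => y _; rewrite patchE.
case: ifPn => yD; last first.
  rewrite integral0_eq// => x _; rewrite /g patchE ifF//.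
  by apply/negbTE; apply: contra yD => /set_mem[/= _ h]; exact/mem_set.
rewrite [RHS]integral_mkcond; apply: eq_integral => x _; rewrite /g !patchE.
by rewrite (_ : ((x, y) \in _) = (x \in D1))//; apply/idP/idP => [/set_mem[h _]|/set_mem h]; apply/mem_set => //; split => //; exact: set_mem.
Qed.
Lemma measurable_inner1 (D2 : set T2) (f : T1 * T2 -> \bar R) :
  measurable D2 -> measurable_fun setT f -> (forall p, 0 <= f p)%E ->
  measurable_fun setT (fun x => \int[m2]_(y in D2) f (x, y))%E.
Proof.
move=> mD2 mf f0; pose g := f \_ ([set: T1] `*` D2).
have g0 p : (0 <= g p)%E by rewrite /g patchE; case: ifP.
have mg : measurable_fun setT g.
  by apply/(measurable_restrictT f (measurableX measurableT mD2)); exact: measurable_funTS.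
have : measurable_fun setT (fubini_F m2 g) by exact: measurable_fun_fubini_tonelli_F.
congr measurable_fun; apply/funext => x; rewrite /fubini_F [RHS]integral_mkcond.
apply: eq_integral => y _; rewrite /g !patchE.
by rewrite (_ : ((x, y) \in _) = (y \in D2))//; apply/idP/idP => [/set_mem[_ h]|/set_mem h]; apply/mem_set.
Qed.

Lemma measurable_inner2 (D1 : set T1) (f : T1 * T2 -> \bar R) :
  measurable D1 -> measurable_fun setT f -> (forall p, 0 <= f p)%E ->
  measurable_fun setT (fun y => \int[m1]_(x in D1) f (x, y))%E.
Proof.
move=> mD1 mf f0; pose g := f \_ (D1 `*` [set: T2]).
have g0 p : (0 <= g p)%E by rewrite /g patchE; case: ifP.
have mg : measurable_fun setT g.
  by apply/(measurable_restrictT f (measurableX mD1 measurableT)); exact: measurable_funTS.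
have : measurable_fun setT (fubini_G m1 g) by exact: measurable_fun_fubini_tonelli_G.
congr measurable_fun; apply/funext => y; rewrite /fubini_G [RHS]integral_mkcond.
apply: eq_integral => x _; rewrite /g !patchE.
by rewrite (_ : ((x, y) \in _) = (x \in D1))//; apply/idP/idP => [/set_mem[h _]|/set_mem h]; apply/mem_set.
Qed.

End tonelli.

(** * Averaged potentials *)

Section counting.
Context {R : realType}.
Local Notation C := R[i].
Local Open Scope complex_scope.
Implicit Types (z w a b c : C) (t : seq C).

Lemma sum_undup_count (F : C -> R) t :
  \sum_(b <- undup t) (count_mem b t)%:R * F b = \sum_(b <- t) F b.
Proof.
rewrite -(perm_big _ (perm_count_undup t)) /= big_flatten big_map; apply: eq_bigr => b _.
by rewrite big_nseq iter_addr_0 mulr_natl.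
Qed.

(** A zero list repeats each point according to its multiplicity; removing duplicates turns the
    repetitions into the weights of [N2]. *)
Lemma N2_ge (phi : C -> C) w t : w != phi 0 ->
  (forall b, b \in t -> [/\ cmod b < 1, phi b = w & mult phi b = count_mem b t]) ->
  ((\sum_(b <- t) ln (cmod b)^-1 ^+ 2)%:E <= N2 phi w)%E.
Proof.
move=> w0 ht; rewrite /N2 (negbTE w0); apply: esum_ge; exists [set` undup t].
  split; first exact: finite_seq.
  by move=> b /=; rewrite mem_undup => /ht[? ? _].
rewrite -(@fsbig_seq _ _ _ _ (undup t))//; last exact: undup_uniq.
rewrite sumEFin lee_fin -(sum_undup_count (fun b => ln (cmod b)^-1 ^+ 2)) big_seq [leRHS]big_seq.
by apply: ler_sum => b; rewrite mem_undup => /ht[_ _ ->].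
Qed.

Lemma N2_le (phi : C -> C) w (K : \bar R) : (0 <= K)%E ->
  (w != phi 0 -> forall X : seq C, uniq X -> (forall b, b \in X -> cmod b < 1 /\ phi b = w) ->
    ((\sum_(b <- X) (mult phi b)%:R * ln (cmod b)^-1 ^+ 2)%:E <= K)%E) -> (N2 phi w <= K)%E.
Proof.
move=> K0 h; rewrite /N2; case: eqVneq => [//|w0]; apply: ge_ereal_sup => _ [X [fX XZ] <-].
rewrite fsbig_finite//= sumEFin; apply: h => // [|b]; first exact: finmap.fset_uniq.
by rewrite in_fset_set// => /set_mem/XZ[].
Qed.

End counting.

Section potentials.
Context {R : realType}.
Local Notation C := R[i].
Local Notation mu2 := (@leb2 R).
Local Open Scope complex_scope.
Implicit Types (z w a b c zeta : C) (r s k M : R) (t : seq C).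

(* Truncation at [0] makes [U] nonnegative everywhere, so that Tonelli's theorem applies. *)
Definition U M c zeta : R := Num.max 0 (ln M - ln (cmod (c - zeta))).

Lemma U_ge0 M c zeta : 0 <= U M c zeta. Proof. by rewrite /U le_max lexx. Qed.

Lemma UE M c zeta : 1 <= M -> cmod (c - zeta) <= M -> U M c zeta = ln M - ln (cmod (c - zeta)).
Proof.
move=> M1 h; rewrite /U max_r// subr_ge0.
(* At the singularity the convention [ln 0 = 0] gives the finite value [ln M]. *)
have [->|c0] := eqVneq (c - zeta) 0; first by rewrite cmod0 ln0// ln_ge0.
by rewrite ler_ln// posrE ?cmod_gt0//; lra.
Qed.

Lemma measurable_U_comp (d : measure_display) (T : measurableType d) M (g : T -> C) (zeta : T -> C) :
  cmeasurable (fun y => g y - zeta y) -> measurable_fun setT (fun y => (U M (g y) (zeta y))%:E).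
Proof.
move=> mg; apply/measurable_EFinP; apply: measurable_maxr; first exact: measurable_cst.
apply: measurable_funB; first exact: measurable_cst.
by apply: measurableT_comp; [exact: measurable_ln|exact: measurable_cmod].
Qed.

Lemma measurable_U_right M c : measurable_fun setT (fun q => (U M c (c2 q))%:E).
Proof.
apply: measurable_U_comp; apply: cmeasurableD; first exact: cmeasurable_cst.
exact: cmeasurableN (@cmeasurable_c2 R).
Qed.

Lemma measurable_U_left M zeta (f : C -> C) : holo f ->
  measurable_fun setT (fun p => (U M (cut 1 f p) zeta)%:E).
Proof.
move=> hf; apply: (@measurable_U_comp _ _ M _ (fun=> zeta)); apply: cmeasurableD.
  exact: cmeasurable_cut1.
exact: cmeasurable_cst.
Qed.

Variable phi : C -> C.
Hypotheses (hphi : holo phi) (phi1 : forall z, cmod z < 1 -> cmod (phi z) < 1).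

Lemma measurable_U M : measurable_fun setT (fun q : (R * R) * (R * R) => (U M (cut 1 phi q.1) (c2 q.2))%:E).
Proof.
have mc : cmeasurable (fun q : (R * R) * (R * R) => cut 1 phi q.1 - c2 q.2).
  apply: cmeasurableD.
    have [h1 h2] := cmeasurable_cut1 hphi.
    by split; [apply: (measurableT_comp h1)|apply: (measurableT_comp h2)]; exact: measurable_fst.
  apply: cmeasurableN; have [h1 h2] := @cmeasurable_c2 R.
  by split; [apply: (measurableT_comp h1)|apply: (measurableT_comp h2)]; exact: measurable_snd.
exact: (measurable_U_comp M mc).
Qed.

Lemma cutE (z : R * R) : cmod (c2 z) < 1 -> cut 1 phi z = phi (c2 z).
Proof. by rewrite /cut => ->. Qed.

Definition pot r M zeta : \bar R := (\int[mu2]_(p in B 0 r) (U M (cut 1 phi p) zeta)%:E)%E.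

Lemma pot_ge0 r M zeta : (0 <= pot r M zeta)%E.
Proof. by apply: integral_ge0 => p _; rewrite lee_fin U_ge0. Qed.

Lemma measurable_pot r M : measurable_fun setT (fun p => pot r M (c2 p)).
Proof.
apply: (@measurable_inner2 R _ _ _ _ mu2 (B 0 r) (fun q => (U M (cut 1 phi q.1) (c2 q.2))%:E)) => //.
- exact: measurable_U.
- by move=> q; rewrite lee_fin U_ge0.
Qed.

Lemma pot_swap r s M p0 :
  (\int[mu2]_(q in B p0 s) pot r M (c2 q) =
   \int[mu2]_(p in B 0 r) \int[mu2]_(q in B p0 s) (U M (cut 1 phi p) (c2 q))%:E)%E.
Proof.
apply/esym; apply: (@tonelli_on R _ _ _ _ mu2 mu2 (B 0 r) (B p0 s) (fun q => (U M (cut 1 phi q.1) (c2 q.2))%:E)) => //.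
- exact: measurable_U.
- by move=> q; rewrite lee_fin U_ge0.
Qed.

(** The factorization is made on the larger disc of radius [(1 + r) / 2], so [t] contains every zero
    of modulus at most [r]. The zeros of modulus at least [r] that it may also contain have weight
    [Kr r b = 0]. *)
Lemma jensen_pot r M zeta : 0 < r -> r < 1 -> 1 <= M -> zeta != phi 0 ->
  (forall z, cmod z < 1 -> cmod (phi z - zeta) <= M) ->
  exists t q, [/\ holo q, forall u, phi u - zeta = \prod_(b <- t) (u - b) * q u,
    forall u, cmod u <= r -> phi u = zeta -> u \in t,
    forall b, b \in t -> [/\ cmod b < 1, phi b = zeta, b != 0 & mult phi b = count_mem b t] &
    (pot r M zeta + (\sum_(b <- t) Kr r b)%:E =
      (alpha * r ^+ 2 * (ln M - ln (cmod (phi 0 - zeta))))%:E)%E].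
Proof.
move=> r0 r1 M1 z0 hM; pose r2 := (1 + r) / 2.
have hf : holo (fun u => phi u - zeta).
  by move=> u u1; have [L hL] := hphi u1; eexists; exact: (cderD hL (cder_cst (- zeta) u)).
have f0 : phi 0 - zeta != 0 by rewrite subr_eq0 eq_sym.
have [r20 r21] : 0 < r2 /\ r2 < 1 by rewrite /r2; split; lra.
have [t [q [hq tr fE q0]]] := zero_factorization hf f0 r20 r21.
have t0 : 0 \notin t.
  apply/negP => t0; move: f0; rewrite fE mulf_eq0 negb_or prodf_seq_neq0.
  by move=> /andP[/allP/(_ _ t0)]; rewrite /= subrr eqxx.
exists t, q; split => //.
- move=> u ur uz; have := fE u; rewrite uz subrr => /esym/eqP; rewrite mulf_eq0 => /orP[|].
    by rewrite prodf_seq_eq0 => /hasP[b bt /=]; rewrite subr_eq0 => /eqP ->.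
  by rewrite (negbTE (q0 _ _))//; rewrite /r2; lra.
- move=> b bt; have b2 := tr b bt; have b1 : cmod b < 1 by lra.
  split => //; last by apply: (mult_count hq bt b1 _ fE); exact: q0.
    apply/eqP; rewrite -subr_eq0 fE mulf_eq0; apply/orP; left.
    by rewrite prodf_seq_eq0; apply/hasP; exists b; rewrite // subrr eqxx.
  by apply: contraNneq t0 => <-.
pose r3 := (r + r2) / 2.
have [r32 rr3] : r3 < r2 /\ r < r3 by rewrite /r3 /r2; split; lra.
have hq3 u : cmod u <= r3 -> exists L, cder q u L by move=> ur; apply: hq; lra.
have q03 u : cmod u <= r3 -> q u != 0 by move=> ur; apply: q0; lra.
rewrite -(@jensen_area R (fun u => phi u - zeta) q t r r3 (ln M) r0 rr3 hq3 q03 (fun u _ => fE u) t0).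
congr (_ + _)%E; apply: eq_integral => p; rewrite inE B0E => pr; congr EFin.
have p1 : cmod (c2 p) < 1 by lra.
by rewrite cutE// UE// hM.
Qed.

Lemma measurable_inner_U s M p0 :
  measurable_fun setT (fun p => \int[mu2]_(q in B p0 s) (U M (cut 1 phi p) (c2 q))%:E)%E.
Proof.
apply: (@measurable_inner1 R _ _ _ _ mu2 (B p0 s) (fun q => (U M (cut 1 phi q.1) (c2 q.2))%:E)) => //.
- exact: measurable_U.
- by move=> q; rewrite lee_fin U_ge0.
Qed.

Lemma inner_UE s M p0 c : 0 < s -> 1 <= M -> c != p0 ->
  (forall q, B p0 s q -> cmod (c - c2 q) <= M) ->
  (\int[mu2]_(q in B p0 s) (U M c (c2 q))%:E =
   (alpha * s ^+ 2 * (ln M - ln (cmod (c - p0))) - Kr s (c - p0))%:E)%E.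
Proof.
move=> s0 M1 cp hM; have a0 : c - p0 != 0 by rewrite subr_eq0.
rewrite -(avg_log s0 a0 (ln M) (erefl _)); apply: eq_integral => q; rewrite inE => qB.
by rewrite UE// hM.
Qed.

End potentials.

(** * Jensen's formula averaged over a disc of values *)

Section averaging.
Context {R : realType}.
Local Notation C := R[i].
Local Notation mu2 := (@leb2 R).
Local Open Scope complex_scope.
Variable phi : C -> C.
Hypotheses (hphi : holo phi) (phi1 : forall z, cmod z < 1 -> cmod (phi z) < 1).
Implicit Types (t : seq C) (zeta : C).

Definition zero_list r zeta t := exists q, [/\ holo q,
  forall u, phi u - zeta = \prod_(b <- t) (u - b) * q u,
  forall u, cmod u <= r -> phi u = zeta -> u \in t &
  forall b, b \in t -> [/\ cmod b < 1, phi b = zeta, b != 0 & mult phi b = count_mem b t]].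

Lemma zero_list_nil r zeta t : zero_list r zeta t -> 1 <= cmod zeta -> t = [::].
Proof.
case: t => // b t [q [_ _ _ h]] z1; have [b1 pb _ _] := h b (mem_head _ _).
by have := phi1 b1; rewrite pb ltNge z1.
Qed.

Lemma sum_Kr_ge0 r zeta t : 0 < r -> zero_list r zeta t -> 0 <= \sum_(b <- t) Kr r b.
Proof.
move=> r0 [q [_ _ _ h]]; rewrite big_seq; apply: sumr_ge0 => b /h[_ _ b0 _].
exact: Kr_ge0.
Qed.

Lemma sum_Kr_le_N2 r zeta t (K : R) : 0 < r -> r <= 1 -> 0 <= K -> zeta != phi 0 -> zero_list r zeta t ->
  (cmod zeta < 1 -> (N2 phi zeta <= K%:E)%E) -> \sum_(b <- t) Kr r b <= 2 * alpha * K.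
Proof.
move=> r0 r1 K0 z0 ht hK; have al := @alpha_gt0 R.
have [z1|z1] := leP 1 (cmod zeta).
  by rewrite (zero_list_nil ht z1) big_nil !mulr_ge0// ltW.
have [q [_ _ _ h]] := ht.
have hN : ((\sum_(b <- t) ln (cmod b)^-1 ^+ 2)%:E <= K%:E)%E.
  by apply: le_trans (hK z1); apply: N2_ge => // b /h[? ? _ ?].
rewrite lee_fin in hN.
apply: (@le_trans _ _ (\sum_(b <- t) 2 * alpha * ln (cmod b)^-1 ^+ 2)).
  rewrite big_seq [leRHS]big_seq; apply: ler_sum => b /h[b1 _ b0 _]; exact: Kr_le.
by rewrite -mulr_sumr ler_wpM2l// mulr_ge0// ltW.
Qed.

Variables (p0 : C) (s r M : R).
Hypotheses (s0 : 0 < s) (r0 : 0 < r) (r1 : r < 1) (M1 : 1 <= M) (far : s <= cmod (phi 0 - p0))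
  (hM : forall z zeta, cmod z < 1 -> cmod (zeta - p0) < s -> cmod (phi z - zeta) <= M).

Let L := ln M - ln (cmod (phi 0 - p0)).
Let al : 0 < alpha :> R. Proof. exact: alpha_gt0. Qed.
Let D (x : R) := alpha * x ^+ 2.
Let D0 x : 0 < x -> 0 < D x. Proof. by move=> x0; rewrite mulr_gt0// exprn_gt0. Qed.

Let neq0 zeta : cmod (zeta - p0) < s -> zeta != phi 0.
Proof. by move=> h; apply: contraTneq h => ->; rewrite -leNgt. Qed.

Let cp : cmod (p0 - p0) < s. Proof. by rewrite subrr cmod0. Qed.
Let c01 : cmod (0 : C) < 1. Proof. by rewrite cmod0. Qed.

Lemma jensen_zero_list zeta : cmod (zeta - p0) < s -> exists2 t, zero_list r zeta t &
  (pot phi r M zeta + (\sum_(b <- t) Kr r b)%:E =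
      (D r * (ln M - ln (cmod (phi 0 - zeta))))%:E)%E.
Proof.
move=> zs; have [t [q [h1 h2 h3 h4 h5]]] :=
  jensen_pot hphi r0 r1 M1 (neq0 zs) (fun z z1 => hM z1 zs).
by exists t => //; exists q.
Qed.

Let mB x y : measurable (B x y : set (R * R)). Proof. by []. Qed.

(** Jensen's identity integrated over [zeta] in [B p0 s]. By [far], averaging the logarithm at
    [phi 0] causes no loss and yields exactly [L]. The zero sums enter through a majorant [T], so
    that measurability in [zeta] is asked of [T] alone. *)
Lemma pot_average_ge (T : R * R -> \bar R) : measurable_fun setT T -> (forall q, 0 <= T q)%E ->
  (forall q t, cmod (c2 q - p0) < s -> zero_list r (c2 q) t -> ((\sum_(b <- t) Kr r b)%:E <= T q)%E) ->
  ((D r * (D s * L))%:E <= \int[mu2]_(q in B p0 s) pot phi r M (c2 q) + \int[mu2]_(q in B p0 s) T q)%E.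
Proof.
move=> mT T0 hT.
have mp := @measurable_pot _ phi hphi r M.
rewrite -(@ge0_integralD _ _ _ mu2 (B p0 s) (mB _ _)); last 4 first.
- by move=> q _; exact: pot_ge0.
- exact: measurable_funTS.
- by [].
- exact: measurable_funTS.
have e : ((D r * (D s * L))%:E = \int[mu2]_(q in B p0 s) ((D r)%:E * (U M (phi 0) (c2 q))%:E))%E.
  have mU : measurable_fun (B p0 s) (fun q => (U M (phi 0) (c2 q))%:E).
    by apply: measurable_funTS; exact: measurable_U_right.
  rewrite (@ge0_integralZl _ _ _ mu2 (B p0 s) (mB _ _)) ?lee_fin ?(ltW (D0 r0))//; last first.
    by move=> q _; rewrite lee_fin U_ge0.
  rewrite inner_UE//.
  - by rewrite (Kr_far s0 far) subr0 EFinM.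
  - by rewrite eq_sym neq0.
  - by move=> q qB; exact: hM.
rewrite e; apply: (@ge0_le_integral _ _ _ mu2 (B p0 s) (mB _ _)).
- by move=> q _; rewrite -EFinM lee_fin mulr_ge0 ?U_ge0// ltW// D0.
- by apply: measurable_funTS; apply: measurable_funeM; exact: measurable_U_right.
- by apply: measurable_funTS; exact: emeasurable_funD.
move=> q qB; have [t ht et] := jensen_zero_list qB.
rewrite UE//; last exact: hM.
by rewrite -EFinM -et leeD2l// hT.
Qed.

Let inner p := (\int[mu2]_(q in B p0 s) (U M (cut 1 phi p) (c2 q))%:E)%E.

Let innerE p : cmod (c2 p) < r -> phi (c2 p) != p0 ->
  inner p = (D s * U M (cut 1 phi p) p0 - Kr s (phi (c2 p) - p0))%:E.
Proof.
move=> pr pp; have p1 : cmod (c2 p) < 1 by exact: lt_trans r1.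
rewrite /inner cutE// inner_UE//; last by move=> q qB; exact: hM.
by rewrite UE//; exact: hM.
Qed.

(** The average of the potential over [B p0 s] is estimated twice. Pointwise in [z] it loses at
    least [c] on [W] compared with the centre, where Jensen's formula has no zeros. By
    [pot_average_ge] it can fall short only by the zero sums. The main terms [D r * D s * L] cancel,
    leaving the area of [W] against [K]. *)
Lemma average_near_le (K : R) : (forall z, cmod z < 1 -> phi z != p0) -> 0 <= K ->
  (forall zeta, cmod (zeta - p0) < s -> cmod zeta < 1 -> (N2 phi zeta <= K%:E)%E) ->
  ((3 / 4 * ln 2)%:E * mu2 (B 0 r `&` [set p | (cmod (cut 1 phi p - p0) <= s / 4)%R])
    <= (2 * alpha * K)%:E)%E.
Proof.
move=> hp0 K0 hK; set W := B 0 r `&` _.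
have mW : measurable W.
  apply: measurableI => //.
  have mc := measurable_cut_dist p0 hphi.
  rewrite (_ : [set p | _] = [set: _] `&` (fun p => cmod (cut 1 phi p - p0)) @^-1` `]-oo, (s / 4)]).
    by apply: mc => //; exact: measurable_itv.
  by rewrite setTI; apply/seteqP; split => p /=; rewrite in_itv.
pose c := D s * (3 / 4 * ln 2); have l2 : 0 <= ln (2 : R) by rewrite ln_ge0// ler1n.
have c0 : 0 <= c by rewrite !mulr_ge0// ltW// D0.
have [t0 ht0 et0] := jensen_zero_list cp.
have t0n : t0 = [::].
  case: t0 ht0 {et0} => // b t [q [_ _ _ h]]; have [b1 pb _ _] := h b (mem_head _ _).
  by have := hp0 b b1; rewrite pb eqxx.
rewrite t0n big_nil adde0 in et0.
have up : (\int[mu2]_(p in B 0 r) inner p + c%:E * mu2 W <= (D s)%:E * pot phi r M p0)%E.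
  have mi := @measurable_inner_U _ phi hphi s M p0.
  have i0 p : (0 <= inner p)%E by apply: integral_ge0 => q _; rewrite lee_fin U_ge0.
  have mI : measurable_fun setT (fun p => (c * (\1_W p : R))%:E).
    by apply/measurable_EFinP; apply: measurable_funM; [exact: measurable_cst|exact: measurable_indic].
  have eW : (c%:E * mu2 W = \int[mu2]_(p in B 0 r) (c * (\1_W p : R))%:E)%E.
    under [RHS]eq_integral do rewrite EFinM.
    rewrite (@ge0_integralZl _ _ _ mu2 (B 0 r) (mB _ _))//.
      by rewrite (integral_indic mu2 (mB 0 r) mW) setIC setIA setIid.
    by apply: measurable_funTS; apply/measurable_EFinP; exact: measurable_indic.
  rewrite eW /pot -(@ge0_integralD _ _ _ mu2 (B 0 r) (mB _ _)); last 4 first.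
  - by [].
  - exact: measurable_funTS.
  - by move=> p _; rewrite lee_fin mulr_ge0.
  - exact: measurable_funTS.
  have mUp := measurable_U_left M p0 hphi.
  rewrite -(@ge0_integralZl _ _ _ mu2 (B 0 r) (mB _ _)); last 3 first.
  - exact: measurable_funTS.
  - by move=> p _; rewrite lee_fin U_ge0.
  - by rewrite lee_fin ltW// D0.
  apply: (@ge0_le_integral _ _ _ mu2 (B 0 r) (mB _ _)).
  - by move=> p _; rewrite adde_ge0// lee_fin mulr_ge0.
  - by apply: measurable_funTS; exact: emeasurable_funD.
  - by apply: measurable_funTS; exact: measurable_funeM.
  move=> p; rewrite B0E => pr; have p1 : cmod (c2 p) < 1 by exact: lt_trans r1.
  have pp := hp0 _ p1.
  rewrite innerE// -EFinD -EFinM lee_fin.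
  have pa : phi (c2 p) - p0 != 0 by rewrite subr_eq0.
  have k0 := Kr_ge0 s0 pa.
  rewrite indicE; case: (boolP (p \in W)) => [/set_mem[_ /=]|_]; last by rewrite mulr0; lra.
  rewrite cutE// => pw; have := Kr_near s0 pa pw; rewrite mulr1 -/(D s) -/c; lra.
have K2 : 0 <= 2 * alpha * K by rewrite !mulr_ge0// ltW.
have := @pot_average_ge (fun=> (2 * alpha * K)%:E) (measurable_cst _) (fun=> K2).
have hT q t : cmod (c2 q - p0) < s -> zero_list r (c2 q) t -> ((\sum_(b <- t) Kr r b)%:E <= (2 * alpha * K)%:E)%E.
  move=> qB ht; rewrite lee_fin; apply: (sum_Kr_le_N2 r0 (ltW r1) K0 (neq0 qB) ht).
  exact: hK.
have ec : (\int[mu2]_(_ in B p0 s) (2 * alpha * K)%:E = (2 * alpha * K)%:E * mu2 (B p0 s))%E.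
  exact: integral_cst.
rewrite mu2_B// -/(D s) in ec; move=> /(_ hT); rewrite ec.
rewrite (pot_swap hphi) -/inner => lo.
move: up; rewrite et0 -/L; set I := (\int[mu2]_(p in B 0 r) inner p)%E in lo *.
have I0 : (0 <= I)%E by apply: integral_ge0 => p _; apply: integral_ge0 => q _; rewrite lee_fin U_ge0.
have Wfin : mu2 W \is a fin_num.
  rewrite ge0_fin_numE//; apply: le_lt_trans (mu2_B_lty 0 r0).
  by apply: le_measure; [exact/mem_set|exact/mem_set|move=> p []].
rewrite -(fineK Wfin) -!EFinM => up.
(* Finiteness allows the two estimates to be subtracted as real inequalities. *)
have Ifin : I \is a fin_num.
  rewrite ge0_fin_numE//; apply: le_lt_trans (ltry (D s * (D r * L))).
  by apply: le_trans up; rewrite leeDl// lee_fin mulr_ge0// fine_ge0.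
move: up lo; rewrite -(fineK Ifin) -!EFinD !lee_fin; set m := fine (mu2 W); set i := fine I => up lo.
have Ds := D0 s0; rewrite -(ler_pM2l Ds).
have -> : D s * (3 / 4 * ln 2 * m) = c * m by rewrite /c; ring.
lra.
Qed.

(** A sub-mean value property of the zero sums: the potential at [p0] dominates its average over the
    disc, while Jensen's main term is the same for both, so the zero sum at [p0] is dominated by the
    average of [T]. *)
Lemma zeros_average_le (T : R * R -> \bar R) : measurable_fun setT T -> (forall q, 0 <= T q)%E ->
  (forall q t, cmod (c2 q - p0) < s -> zero_list r (c2 q) t -> ((\sum_(b <- t) Kr r b)%:E <= T q)%E) ->
  exists2 t, zero_list r p0 t &
    ((alpha * s ^+ 2 * \sum_(b <- t) Kr r b)%:E <= \int[mu2]_(q in B p0 s) T q)%E.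
Proof.
move=> mT T0 hT; have lo := pot_average_ge mT T0 hT.
have [t ht et] := jensen_zero_list cp; exists t => //.
have up : (\int[mu2]_(p in B 0 r) inner p <= (D s)%:E * pot phi r M p0)%E.
  have mi := @measurable_inner_U _ phi hphi s M p0.
  have i0 p : (0 <= inner p)%E by apply: integral_ge0 => q _; rewrite lee_fin U_ge0.
  have mUp := measurable_U_left M p0 hphi.
  rewrite /pot -(@ge0_integralZl _ _ _ mu2 (B 0 r) (mB _ _)); last 3 first.
  - exact: measurable_funTS.
  - by move=> p _; rewrite lee_fin U_ge0.
  - by rewrite lee_fin ltW// D0.
  apply: (@ae_ge0_le_integral _ _ _ mu2 (B 0 r) (mB _ _)).
  - by [].
  - exact: measurable_funTS.
  - by move=> p _; rewrite -EFinM lee_fin mulr_ge0 ?U_ge0// ltW// D0.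
  - by apply: measurable_funTS; exact: measurable_funeM.
  (* The pointwise comparison is made where [phi z != p0]; the exceptional points of [B 0 r] lie in
     the finite list [t]. *)
  apply: (negligibleS _ (negligible_seq t)) => p /= /not_implyP[+ H].
  rewrite B0E => pr; have [q [_ _ hq _]] := ht.
  apply: hq; first exact: ltW.
  apply: contrapT => pp; apply: H; have {}pp : phi (c2 p) != p0 by apply/eqP.
  rewrite innerE// -EFinM lee_fin gerBl.
  by apply: Kr_ge0 => //; rewrite subr_eq0.
rewrite (pot_swap hphi) -/inner in lo.
have S0 := sum_Kr_ge0 r0 ht.
set S := \sum_(b <- t) _ in S0 et *; set P := pot _ _ _ _ in et up.
have Pfin : P \is a fin_num.
  rewrite ge0_fin_numE; last exact: pot_ge0.
  by apply: le_lt_trans (ltry (D r * L)); rewrite /L -et leeDl.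
rewrite -(fineK Pfin) -EFinD in et; case: et => et.
rewrite -(@leeD2lE _ (D s * fine P)%:E)// -EFinD.
apply: (@le_trans _ _ (D r * (D s * L))%:E).
  rewrite lee_fin (_ : D r * (D s * L) = D s * (D r * L)); last by ring.
  by rewrite /L -et le_eqVlt; apply/orP; left; apply/eqP; rewrite -/(D s); ring.
apply: (le_trans lo); apply: leeD => //.
by rewrite EFinM fineK.
Qed.

End averaging.

(** * Carleson windows *)

Section angles.
Context {R : realType}.
Local Notation C := R[i].
Local Open Scope complex_scope.
Implicit Types (u z xi : C) (t h x : R).

Lemma sin_le t : 0 <= t -> sin t <= t.
Proof.
move=> t0; have [c _ e] := @MVT_segment R sin cos 0 t t0 (fun x _ => is_derive_sin x)
  (continuous_subspaceT (@continuous_sin R)).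
rewrite sin0 !subr0 in e; rewrite e; have := cos_le1 c; nra.
Qed.

Lemma cos_ge t : 0 <= t -> 1 - t <= cos t.
Proof.
move=> t0; have [c _ e] := @MVT_segment R cos (fun x => - sin x) 0 t t0 (fun x _ => is_derive_cos x)
  (continuous_subspaceT (@continuous_cos R)).
rewrite cos0 !subr0 in e; have := sin_le1 c; nra.
Qed.

Lemma sin_ge_half t : 0 <= t <= pi -> 1 / 2 <= cos t -> t / 2 <= sin t.
Proof.
move=> /andP[t0 tpi] ct.
have [c ct' e] := @MVT_segment R sin cos 0 t t0 (fun x _ => is_derive_sin x)
  (continuous_subspaceT (@continuous_sin R)).
rewrite sin0 !subr0 in e; rewrite e.
move: ct'; rewrite in_itv/= => /andP[c0 c1].
have : cos t <= cos c.
  by rewrite leNgt ltr_cos ?in_itv/= ?t0 ?c0 ?(le_trans c1)// -leNgt.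
nra.
Qed.

Lemma Re_div_bounds u : u != 0 -> -1 <= complex.Re u / cmod u <= 1.
Proof.
rewrite -cmod_gt0 => u0; rewrite ler_pdivlMr// ler_pdivrMr// mulN1r mul1r -ler_norml.
exact: Re_le_cmod.
Qed.

Lemma norm_carg u : u != 0 -> `|carg u| = acos (complex.Re u / cmod u).
Proof.
move=> u0; have h := acos_ge0 (Re_div_bounds u0).
by rewrite /carg; case: ifP => _; rewrite ?normrN ger0_norm.
Qed.

Lemma norm_Im u : u != 0 -> `|complex.Im u| = cmod u * sin (acos (complex.Re u / cmod u)).
Proof.
move=> u0; have u00 : 0 < cmod u by rewrite cmod_gt0.
have hb := Re_div_bounds u0; set t := acos _.
have ts : 0 <= sin t by apply: sin_ge0_pi; rewrite acos_ge0// acos_lepi.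
have tc : cos t = complex.Re u / cmod u by rewrite acosK// in_itv.
apply/eqP; rewrite -(@eqrXn2 _ 2)// ?mulr_ge0//; apply/eqP.
rewrite exprMn sin2cos2 tc real_normK ?num_real// mulrBr mulr1 -exprMn mulrCA divff ?gt_eqF// mulr1.
by rewrite cmod_sqr addrC addKr.
Qed.

(** Removes [acos] from the angular condition, so that preimages of windows are described by
    inequalities between measurable functions. *)
Lemma carg_le_norm u t : u != 0 -> 0 <= t <= pi ->
  (`|carg u| <= t) = (cmod u * cos t <= complex.Re u).
Proof.
move=> u0 /andP[t0 tpi]; have u00 : 0 < cmod u by rewrite cmod_gt0.
have hb := Re_div_bounds u0.
have tc : cos (acos (complex.Re u / cmod u)) = complex.Re u / cmod u by rewrite acosK// in_itv.
rewrite norm_carg// [cmod u * cos t]mulrC -ler_pdivlMr// -[X in _ = (_ <= X)]tc !leNgt.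
by rewrite ltr_cos// in_itv/= ?t0 ?acos_ge0 ?acos_lepi.
Qed.

Lemma near1_of_carg u h : 0 <= h -> 1 - h <= cmod u -> cmod u <= 1 -> u != 0 -> `|carg u| <= pi * h ->
  cmod (u - 1) <= (1 + 2 * pi) * h.
Proof.
move=> h0 h1 h2 u0; have u00 : 0 < cmod u by rewrite cmod_gt0.
have hb := Re_div_bounds u0; rewrite norm_carg//; set t := acos _ => ht.
have t0 : 0 <= t by exact: acos_ge0.
have tc : complex.Re u = cmod u * cos t by rewrite acosK ?in_itv// mulrCA divff ?gt_eqF// mulr1.
have s1 := sin_le t0; have c1 := cos_ge t0; have c2 := cos_le1 t.
have ss : 0 <= sin t by apply: sin_ge0_pi; rewrite t0 acos_lepi.
apply: le_trans (cmod_le_ReIm _) _.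
rewrite ReD ReN ImD ImN/= oppr0 addr0 norm_Im// -/t.
have i1 : cmod u * sin t <= t by nra.
have i2 : `|complex.Re u - 1| <= h + t.
  rewrite tc ler_norml; apply/andP; split; nra.
lra.
Qed.

Lemma carg_of_near1 u h : 0 <= h -> h <= 1 / 2 -> cmod u <= 1 -> cmod (u - 1) <= h ->
  [/\ u != 0, 1 - h <= cmod u & `|carg u| <= 4 * h].
Proof.
move=> h0 h2 u1 uh.
have uge : 1 - h <= cmod u by have := cmodB_ge 1 (1 - u); rewrite subKr cmod1 cmodBC; lra.
have u00 : 0 < cmod u by lra.
have u0 : u != 0 by rewrite -cmod_gt0.
split => //; have hb := Re_div_bounds u0; rewrite norm_carg//; set t := acos _.
have t0 : 0 <= t by exact: acos_ge0.
have tpi : t <= pi by exact: acos_lepi.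
have tc : complex.Re u = cmod u * cos t by rewrite acosK ?in_itv// mulrCA divff ?gt_eqF// mulr1.
have hre : 1 - h <= complex.Re u.
  have := Re_le_cmod (u - 1); rewrite ReD ReN/= ler_norml => /andP[]; lra.
have him : cmod u * sin t <= h.
  rewrite -norm_Im//; have := Im_le_cmod (u - 1); rewrite ImD ImN/= oppr0 addr0; lra.
(* This excludes angles near [pi], where the sine is also small, and makes [sin t >= t / 2]
   available; with [|u| >= 1/2] this gives the factor [4]. *)
have ch : 1 / 2 <= cos t.
  rewrite leNgt; apply/negP => c; have : cmod u * cos t < 1 / 2.
    have [c0|c0] := leP 0 (cos t); nra.
  lra.
have := @sin_ge_half t; rewrite t0 tpi => /(_ isT ch) st.
nra.
Qed.

Lemma cmod_rot xi z : cmod xi = 1 -> cmod (z * conjc xi - 1) = cmod (z - xi).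
Proof.
move=> x1; have e : xi * conjc xi = 1.
  have : (cmod xi ^+ 2)%:C = 1 :> C by rewrite x1 expr1n.
  move=> <-; rewrite cmod_sqr; case: (xi) => a b; apply/eqP; rewrite eq_complex/=.
  by apply/andP; split; apply/eqP; ring.
by rewrite -e -mulrBl cmodM cmod_conj x1 mulr1.
Qed.

Lemma window_near xi z h : cmod xi = 1 -> 0 <= h -> h < 1 -> window xi h z ->
  cmod (z - xi) <= (1 + 2 * pi) * h.
Proof.
move=> x1 h0 h1 [z1 [zh zc]]; rewrite /disk/= in z1.
have cu : cmod (z * conjc xi) = cmod z by rewrite cmodM cmod_conj x1 mulr1.
rewrite -(cmod_rot z x1); apply: near1_of_carg; rewrite ?cu//; first exact: ltW.
by rewrite -cmod_gt0 cu; lra.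
Qed.

Lemma near_window xi z h : cmod xi = 1 -> 0 <= h -> h <= 1 / 2 -> cmod z < 1 -> cmod (z - xi) <= h ->
  window xi (4 * h) z.
Proof.
move=> x1 h0 h2 z1 zh.
have cu : cmod (z * conjc xi) = cmod z by rewrite cmodM cmod_conj x1 mulr1.
have [] := @carg_of_near1 (z * conjc xi) h h0 h2; rewrite ?cu ?(ltW z1)// ?cmod_rot//.
move=> _ h3 h4; split => //; split; first by lra.
apply: le_trans h4 _; have := @pi_ge2 R; nra.
Qed.

End angles.

(** * Measurability of preimages of windows *)

Section measurable_windows.
Context {R : realType}.
Local Notation C := R[i].
Local Open Scope complex_scope.
Variable phi : C -> C.
Hypotheses (hphi : holo phi) (phi1 : forall z, cmod z < 1 -> cmod (phi z) < 1).

Lemma measurable_le_fun (d : measure_display) (T : measurableType d) (f g : T -> R) :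
  measurable_fun setT f -> measurable_fun setT g -> measurable [set t | f t <= g t].
Proof.
move=> mf mg; have m := measurable_funB mg mf.
rewrite (_ : [set t | f t <= g t] = [set: T] `&` (g \- f) @^-1` `[0, +oo[).
  by apply: m => //; exact: measurable_itv.
by rewrite setTI; apply/seteqP; split => t /=; rewrite in_itv/= andbT subr_ge0.
Qed.

Lemma measurable_cut_near (p0 : C) (s : R) :
  measurable (B 0 1 `&` [set p : R * R | cmod (cut 1 phi p - p0) <= s]).
Proof.
apply: measurableI => //; apply: measurable_le_fun; last exact: measurable_cst.
exact: measurable_cut_dist.
Qed.

Lemma measurable_preimage_window xi (h : R) : cmod xi = 1 -> 0 <= h -> h < 1 ->
  measurable [set p : R * R | disk (c2 p) /\ window xi h (phi (c2 p))].
Proof.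
move=> x1 h0 h1; pose u p := cut 1 phi p * conjc xi.
have mu' : cmeasurable u by apply: cmeasurableM; [exact: cmeasurable_cut1|exact: cmeasurable_cst].
have cu p : cmod (u p) = cmod (cut 1 phi p) by rewrite cmodM cmod_conj x1 mulr1.
have pih : 0 <= pi * h <= pi by rewrite mulr_ge0 ?pi_ge0//= ler_piMr ?pi_ge0// ltW.
rewrite (_ : [set p | _] = B 0 1 `&` ([set p | 1 - h <= cmod (u p)] `&`
   [set p | cmod (u p) * cos (pi * h) <= complex.Re (u p)])).
  apply: measurableI => //; apply: measurableI.
    by apply: measurable_le_fun; [exact: measurable_cst|exact: measurable_cmod].
  apply: measurable_le_fun; last exact: mu'.1.
  by apply: measurable_funM; [exact: measurable_cmod|exact: measurable_cst].
apply/seteqP; split => p /=; rewrite B0E.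
  move=> [p1 [d1 [d2 d3]]]; have cE : cut 1 phi p = phi (c2 p) by exact: cutE.
  have ge : 1 - h <= cmod (u p) by rewrite cu cE.
  split => //; split => //; rewrite -carg_le_norm//; first by rewrite /u cE.
  by rewrite -cmod_gt0; lra.
move=> [p1 [d2 d3]]; have cE : cut 1 phi p = phi (c2 p) by exact: cutE.
split => //; split; first exact: phi1.
rewrite cu cE in d2; split => //.
rewrite -cE carg_le_norm//.
by rewrite -cmod_gt0 cu cE; lra.
Qed.

Lemma areaE (A : set C) : measurable [set p : R * R | A (c2 p)] ->
  area A = (leb2 [set p : R * R | A (c2 p)] * (pi^-1)%:E)%E.
Proof. by move=> mA; rewrite /area leb2E. Qed.

End measurable_windows.

(** * The two inequalities *)

Section harnack.
Context {R : realType}.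
Local Notation C := R[i].
Local Notation mu2 := (@leb2 R).
Local Open Scope complex_scope.
Variable phi : C -> C.
Hypotheses (hphi : holo phi) (phi1 : forall z, cmod z < 1 -> cmod (phi z) < 1).

(** [schwarz_lip] transported to the disc of centre [a] and radius [1 - |a|] by an affine map. *)
Lemma local_lip a v : cmod a < 1 -> cmod (v - a) <= (1 - cmod a) / 2 ->
  cmod (phi v - phi a) <= 16 * (1 - cmod (phi a)) * (cmod (v - a) / (1 - cmod a)).
Proof.
move=> a1 va; pose d := 1 - cmod a; have d0 : 0 < d by rewrite subr_gt0.
have dc : d%:C != 0 :> C by rewrite -cmod_gt0 cmod_real normr_gt0 gt_eqF.
pose psi u := phi (a + d%:C * u).
have ind u : cmod u < 1 -> cmod (a + d%:C * u) < 1.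
  move=> u1; apply: le_lt_trans (cmodD _ _) _; rewrite cmodM cmod_real gtr0_norm//.
  have : d * cmod u < d * 1 by rewrite ltr_pM2l.
  rewrite {2}/d; lra.
have hpsi u : cmod u < 1 -> exists L, cder psi u L.
  by move=> /ind/hphi[L hL]; eexists; exact: cder_affine hL.
have psi1 u : cmod u < 1 -> cmod (psi u) <= 1 by move=> /ind/phi1/ltW.
pose u := (v - a) / d%:C.
have cu : cmod u = cmod (v - a) / d by rewrite cmod_div cmod_real gtr0_norm.
have u2 : cmod u <= 1 / 2 by rewrite cu ler_pdivrMr//; rewrite /d; lra.
have := schwarz_lip hpsi psi1 u2; rewrite cu /psi mulr0 addr0 mulrC divfK//.
by rewrite [a + _]addrC subrK.
Qed.

(** The segment from [0] to [z] is covered by 32 steps of length at most [1/64]. At each,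
    [|w - a| / (1 - |a|) <= 1/32], so by [local_lip] the value moves by at most half of
    [1 - |phi a|], and the distance to the circle is at worst halved. *)
Lemma harnack_half z : cmod z <= 1 / 2 -> 2 ^- 32 * (1 - cmod (phi 0)) <= 1 - cmod (phi z).
Proof.
have c01 : 0 < 1 - cmod (phi 0) by rewrite subr_gt0; apply: phi1; rewrite cmod0.
have step n : (n <= 32)%N -> forall z, cmod z <= n%:R / 64 ->
    2 ^- n * (1 - cmod (phi 0)) <= 1 - cmod (phi z).
  elim: n => [_ w|n ih nn w wn].
    rewrite mul0r => w0; have -> : w = 0 by apply/eqP; rewrite -cmod_eq0 eq_le w0 cmod_ge0.
    by rewrite expr0 invr1 mul1r.
  have n32 : n.+1%:R <= 32 :> R by rewrite ler_nat.
  pose k : R := n%:R / n.+1%:R; have k0 : 0 <= k by rewrite divr_ge0.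
  have k1 : 1 - k = n.+1%:R^-1.
    by rewrite /k; have : n.+1%:R != 0 :> R by []; rewrite -natr1 => h; field.
  pose a := k%:C * w.
  have ca : cmod a = k * cmod w by rewrite cmodM cmod_real ger0_norm.
  have an : cmod a <= n%:R / 64.
    rewrite ca; apply: (@le_trans _ _ (k * (n.+1%:R / 64))); first by rewrite ler_wpM2l.
    by rewrite /k mulrA divfK.
  have wa : cmod (w - a) <= 1 / 64.
    have -> : w - a = (1 - k)%:C * w by rewrite /a rmorphB/= mulrBl mul1r.
    rewrite cmodM cmod_real k1 ger0_norm ?invr_ge0//.
    apply: (@le_trans _ _ (n.+1%:R^-1 * (n.+1%:R / 64))); first by rewrite ler_wpM2l.
    by rewrite mulrA mulVf.
  have a2 : cmod a <= 1 / 2.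
    have nn1 : n%:R <= n.+1%:R :> R by rewrite ler_nat.
    by apply: le_trans an _; lra.
  have a1 : cmod a < 1 by lra.
  have pa : 0 < 1 - cmod (phi a) by rewrite subr_gt0 phi1.
  have h := @local_lip a w a1 _.
  have {}h := h ltac:(lra).
  have hq : cmod (w - a) / (1 - cmod a) <= 1 / 32.
    by rewrite ler_pdivrMr ?subr_gt0//; lra.
  have h2 : 16 * (1 - cmod (phi a)) * (cmod (w - a) / (1 - cmod a)) <= (1 - cmod (phi a)) / 2.
    apply: (@le_trans _ _ (16 * (1 - cmod (phi a)) * (1 / 32))); last by lra.
    by rewrite ler_wpM2l// mulr_ge0// ltW.
  have := cmodB_ge (phi w) (phi w - phi a); rewrite subKr => h3.
  have iha := ih (ltnW nn) a an.
  rewrite exprS invfM -mulrA.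
  have := cmodD (phi w - phi a) (phi a); rewrite subrK; lra.
move=> z2; apply: step => //.
by apply: le_trans z2 _; rewrite ler_pdivlMr// (_ : 1 / 2 * 64 = 32)//; field.
Qed.

Section local_count.
Variables (zeta : C) (r m : R) (t : seq C).
Hypotheses (ht : zero_list phi r zeta t) (zm : 1 - cmod zeta <= m).

Let kap : R := 1 / 64.
Let nearby (a b : C) := cmod (a - b) < kap * (1 - cmod b).

(** The number [63] is [64 - 1], from passing from [1 - |b|] to [1 - |a|]; the bound [m / 4] is
    [local_lip] with [16 / 64]. The parameter [m] dominates [1 - |zeta|], so that one scale serves a
    whole disc of values [zeta]. *)
Lemma near_zero a b : b \in t -> nearby a b -> [/\ cmod a < 1, cmod (a - b) <= (1 - cmod a) / 63,
  1 - cmod a <= 65 / 64 * (1 - cmod b) & cmod (phi a - zeta) <= m / 4].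
Proof.
move=> bt; rewrite /nearby => ab; have [q [_ _ _ h]] := ht; have [b1 pb _ _] := h b bt.
have d1 := cmodB_ge a (a - b); have d2 := cmodB_ge b (b - a); rewrite !subKr in d1 d2.
have d3 := cmodD (a - b) b; rewrite subrK in d3.
have d4 := cmodD (b - a) a; rewrite subrK [cmod (b - a)]cmodBC in d4.
rewrite [cmod (b - a)]cmodBC in d2; move: ab; rewrite /kap => ab.
have b0 : 0 < 1 - cmod b by rewrite subr_gt0.
split; try lra.
have z1 : cmod zeta < 1 by rewrite -pb phi1.
have := @local_lip b a b1 _; rewrite pb => /(_ ltac:(lra)) hl.
apply: le_trans hl _.
have hq : cmod (a - b) / (1 - cmod b) <= 1 / 64 by rewrite ler_pdivrMr//; lra.
apply: (@le_trans _ _ (16 * (1 - cmod zeta) * (1 / 64))); last by have := zm; lra.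
by rewrite ler_wpM2l// mulr_ge0// subr_ge0 ltW.
Qed.

(** After recentring at [a], with [d = 1 - |a|], the [n] nearby zeros have modulus at most [d / 63],
    and [|phi - zeta| <= 8 m] on the circle of radius [d / 4]. Then [zero_count] gives [|phi a -
    zeta| <= 16 m (4/63)^n <= 16 m 2^-n]. *)
Lemma local_count a : (((count (nearby a) t)%:R)%:E <= dyad (cmod (phi a - zeta) / (16 * m))%R)%E.
Proof.
have [->|] := eqVneq (count (nearby a) t) 0%N; first exact: dyad_ge0.
rewrite -lt0n -has_count => /hasP[b0 b0t ab0].
have [q [hq fE _ hb]] := ht; have [b01 pb0 _ _] := hb b0 b0t.
have [a1 n1 n2 _] := near_zero b0t ab0.
have m0 : 0 < m by have := phi1 b01; have := zm; rewrite pb0; lra.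
pose d := 1 - cmod a; have d0 : 0 < d by rewrite subr_gt0.
pose s := [seq b - a | b <- t & nearby a b].
pose f u := phi (a + u) - zeta.
pose q' u := \prod_(b <- t | ~~ nearby a b) (a + u - b) * q (a + u).
have in1 u : cmod u <= d / 4 -> cmod (a + u) < 1.
  by move=> ud; have := cmodD a u; rewrite /d in ud; lra.
have hq' u : cmod u <= d / 4 -> exists L, cder q' u L.
  move=> ud; have [L hL] : exists L, cder (fun v => \prod_(b <- [seq b <- t | ~~ nearby a b]) (v - b) * q v) (a + 1 * u) L.
    apply: exists_cderM; first exact: exists_cder_prod.
    by apply: hq; rewrite mul1r; exact: in1.
  have := cder_affine hL; rewrite mulr1 => hL'; exists L.
  by apply: (cder_local ltr01) hL' => v _; rewrite mul1r big_filter.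
have fE' u : cmod u <= d / 4 -> f u = \prod_(b <- s) (u - b) * q' u.
  move=> _; rewrite /f fE /q' mulrA; congr (_ * _).
  rewrite (bigID (nearby a)) /=; congr (_ * _).
  by rewrite big_map big_filter; apply: eq_bigr => b _; ring.
have sr b : b \in s -> cmod b <= d / 63.
  move=> /mapP[c]; rewrite mem_filter => /andP[nc ct] ->.
  by have [_ h _ _] := near_zero ct nc; rewrite cmodBC.
have fM u : cmod u = d / 4 -> cmod (f u) <= 8 * m.
  move=> ud; have hb0 := @local_lip b0 (a + u) b01 _.
  have dd : cmod (a + u - b0) <= (1 - cmod b0) / 2.
    have := cmodD (a - b0) u; rewrite addrAC ud => h.
    move: ab0; rewrite /nearby /kap /d in ud h *; lra.
  have := hb0 dd; rewrite pb0 /f => hl; apply: le_trans hl _.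
  have b00 : 0 < 1 - cmod b0 by rewrite subr_gt0.
  have hq2 : cmod (a + u - b0) / (1 - cmod b0) <= 1 / 2 by rewrite ler_pdivrMr//; lra.
  have z1 : cmod zeta < 1 by rewrite -pb0 phi1.
  apply: (@le_trans _ _ (16 * (1 - cmod zeta) * (1 / 2))); last by have := zm; lra.
  by rewrite ler_wpM2l// mulr_ge0// subr_ge0 ltW.
have d63 : 0 <= d / 63 by rewrite divr_ge0// ltW.
have d4 : 0 < d / 4 by rewrite divr_gt0.
have := zero_count d63 d4 hq' fE' sr fM.
rewrite /f addr0 size_map size_filter => h.
(* [dyad] counts level [0] as well, so it exceeds the number of zeros by at least one. *)
apply: (@le_trans _ _ (count (nearby a) t).+1%:R%:E); first by rewrite lee_fin ler_nat.
apply: dyad_ge_nat; rewrite ler_pdivrMr ?mulr_gt0//.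
apply: le_trans h _; rewrite mulrC (_ : 2 * (8 * m) = 16 * m); last by ring.
have x0 : 0 <= d / 63 / (d / 4) by rewrite divr_ge0// ltW.
have x2 : d / 63 / (d / 4) <= 2^-1 by rewrite ler_pdivrMr//; lra.
apply: ler_wpM2r; first by rewrite mulr_ge0// ltW.
by rewrite -exprVn; apply: lerXn2r; rewrite ?nnegrE.
Qed.

Hypothesis t2 : forall b, b \in t -> 1 / 2 <= cmod b.
Hypotheses (r0 : 0 < r) (r1 : r <= 1).

(** By [Kr_le] and [lnV_le2], [Kr r b <= 8 alpha (1 - |b|)^2], which is [8 * 64 ^+ 2] times the area
    of the disc of radius [kap (1 - |b|)] about [b]. The sum of these areas is the integral of the
    local count, which vanishes outside the domain displayed. *)
Lemma sum_Kr_local : ((\sum_(b <- t) Kr r b)%:E <= (8 * 64 ^+ 2)%:E *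
  \int[mu2]_(p in B 0 1 `&` [set p | (cmod (cut 1 phi p - zeta) <= m / 4)%R])
     dyad (cmod (cut 1 phi p - zeta) / (16 * m))%R)%E.
Proof.
have al := @alpha_gt0 R; have [q [_ _ _ hb]] := ht.
set W := B 0 1 `&` _; have mW : measurable W by exact: measurable_cut_near.
have h1 : \sum_(b <- t) Kr r b <= 8 * 64 ^+ 2 * \sum_(b <- t) alpha * (kap * (1 - cmod b)) ^+ 2.
  rewrite mulr_sumr big_seq [leRHS]big_seq; apply: ler_sum => b bt.
  have [b1 _ b0 _] := hb b bt; apply: le_trans (Kr_le r0 b0 r1 b1) _.
  have l0 : 0 <= ln (cmod b)^-1 by rewrite ln_ge0// invf_ge1// ?(ltW b1)// cmod_gt0.
  have h2 : ln (cmod b)^-1 ^+ 2 <= (2 * (1 - cmod b)) ^+ 2.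
    have l1 := lnV_le2 b0 (t2 bt) (ltW b1).
    by apply: lerXn2r; rewrite ?nnegrE//; lra.
  apply: (@le_trans _ _ (2 * alpha * (2 * (1 - cmod b)) ^+ 2)).
    by rewrite ler_wpM2l// mulr_ge0// ltW.
  by rewrite /kap le_eqVlt; apply/orP; left; apply/eqP; field.
apply: (@le_trans _ _ (8 * 64 ^+ 2 * \sum_(b <- t) alpha * (kap * (1 - cmod b)) ^+ 2)%:E).
  by rewrite lee_fin.
rewrite [X in (X <= _)%E]EFinM; apply: lee_wpmul2l; first by rewrite lee_fin mulr_ge0.
pose n (p : R * R) := (\sum_(b <- t) (\1_(B b (kap * (1 - cmod b))) p : R))%:E.
have nE p : n p = ((count (nearby (c2 p)) t)%:R)%:E.
  rewrite /n; congr EFin; elim: (t) => [|b t' ih]; first by rewrite big_nil.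
  rewrite big_cons ih /= natrD; congr (_ + _); rewrite indicE /nearby.
  by rewrite (_ : (p \in _) = (cmod (c2 p - b) < kap * (1 - cmod b)))//; apply/idP/idP => [/set_mem//|h]; exact/mem_set.
have -> : ((\sum_(b <- t) alpha * (kap * (1 - cmod b)) ^+ 2)%:E = \int[mu2]_p n p)%E.
  rewrite /n -sumEFin; under [RHS]eq_integral do rewrite -sumEFin.
  rewrite (@ge0_integral_sum _ _ _ mu2 _ measurableT); last 2 first.
  - by move=> b; apply/measurable_EFinP; exact: measurable_indic.
  - by move=> b p _; rewrite lee_fin.
  rewrite big_seq [RHS]big_seq; apply: eq_bigr => b bt.
  rewrite integral_indic// setIT; apply/esym/mu2_B.
  by have [b1 _ _ _] := hb b bt; rewrite mulr_gt0 ?subr_gt0// divr_gt0.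
rewrite [leRHS]integral_mkcond; apply: (@ge0_le_integral _ _ _ mu2 _ measurableT).
- by move=> p _; rewrite nE lee_fin.
- apply/measurable_EFinP/measurable_sum => b; exact: measurable_indic.
- apply/(measurable_restrictT _ mW); apply: measurable_funTS.
  apply: (measurableT_comp measurable_dyad); apply: measurable_funM; last exact: measurable_cst.
  exact: measurable_cut_dist.
move=> p _; rewrite patchE nE; case: ifPn => pW.
  by move: pW => /set_mem[]; rewrite B0E => p1 _; rewrite cutE//; exact: local_count.
have [->//|] := eqVneq (count (nearby (c2 p)) t) 0%N.
rewrite -lt0n -has_count => /hasP[b bt pb]; have [a1 _ _ h4] := near_zero bt pb.
by exfalso; move/negP: pW; apply; apply/mem_set; split; [rewrite B0E|rewrite /= cutE].
Qed.

End local_count.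
End harnack.

(** * The two comparisons with areas for a fixed map *)

Section two_sided.
Context {R : realType}.
Local Notation C := R[i].
Local Notation mu2 := (@leb2 R).
Local Open Scope complex_scope.

Lemma measurable_dyad_dist (phi : C -> C) (k : R) : holo phi ->
  measurable_fun setT (fun q : (R * R) * (R * R) => dyad (cmod (cut 1 phi q.1 - c2 q.2) / k)).
Proof.
move=> hphi; apply: (measurableT_comp measurable_dyad); apply: measurable_funM; last exact: measurable_cst.
apply: measurable_cmod; apply: cmeasurableD.
  have [h1 h2] := cmeasurable_cut1 hphi.
  by split; [apply: (measurableT_comp h1)|apply: (measurableT_comp h2)]; exact: measurable_fst.
apply: cmeasurableN; have [h1 h2] := @cmeasurable_c2 R.
by split; [apply: (measurableT_comp h1)|apply: (measurableT_comp h2)]; exact: measurable_snd.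
Qed.

Lemma integral_dyad_disc (c w : C) (s d : R) : 0 < d ->
  (\int[mu2]_(q in B w s) dyad (cmod (c - c2 q) / d)%R <= (8 * alpha * d ^+ 2)%:E)%E.
Proof.
move=> d0; have al := @alpha_gt0 R.
rewrite (_ : 8 * alpha * d ^+ 2 = 2 * (4 * alpha * d ^+ 2)); last by ring.
have mf : measurable_fun setT (fun q : R * R => cmod (c - c2 q) / d).
  apply: measurable_funM; last exact: measurable_cst.
  apply: measurable_cmod; apply: cmeasurableD; first exact: cmeasurable_cst.
  exact: cmeasurableN (@cmeasurable_c2 R).
apply: (@ge0_integral_dyad R _ _ mu2 (B w s) (fun q => cmod (c - c2 q) / d)) => //.
  by rewrite mulr_ge0 ?sqr_ge0// mulr_ge0// ltW.
(* Doubling the radius puts the closed level inside an open disc; this is the factor [4] in the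
   constant. *)
move=> k; have e0 : 0 < 2 * (d * 2 ^- k) :> R by rewrite !mulr_gt0// invr_gt0 exprn_gt0.
apply: (@le_trans _ _ (mu2 (B c (2 * (d * 2 ^- k))%R))).
  apply: le_measure; [apply: mem_set|by apply: mem_set|].
    apply: measurableI => //; apply: measurable_le_fun => //; exact: measurable_cst.
  move=> q [_ /=]; rewrite ler_pdivrMr// /B/= cmodBC; lra.
rewrite mu2_B// lee_fin (_ : _ ^+ 2 = 4 * d ^+ 2 * (2 ^- k * 2 ^- k)); last by ring.
rewrite (_ : alpha * _ = 4 * alpha * d ^+ 2 * (2 ^- k * 2 ^- k)); last by ring.
apply: ler_wpM2l; first by rewrite mulr_ge0 ?sqr_ge0// mulr_ge0// ltW.
by rewrite ler_piMr ?invr_ge0 ?exprn_ge0// invf_le1 ?exprn_gt0// exprn_ege1// ler1n.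
Qed.

Lemma ler_sum_uniq_sub (T : eqType) (X Y : seq T) (F : T -> R) : uniq X -> uniq Y -> {subset X <= Y} ->
  (forall b, b \in Y -> 0 <= F b) -> \sum_(b <- X) F b <= \sum_(b <- Y) F b.
Proof.
move=> uX uY XY F0; have p : perm_eq X [seq b <- Y | b \in X].
  apply: uniq_perm => //; first exact: filter_uniq.
  by move=> b; rewrite mem_filter; case: (boolP (b \in X)) => // /XY ->.
rewrite (perm_big _ p) big_filter big_mkcond big_seq [leRHS]big_seq.
by apply: ler_sum => b bY; case: ifP => // _; exact: F0.
Qed.

Section fixed_map.
Variable phi : C -> C.
Hypotheses (hphi : holo phi) (phi1 : forall z, cmod z < 1 -> cmod (phi z) < 1).

Let c0 := 1 - cmod (phi 0).
Let c00 : 0 < c0. Proof. by rewrite subr_gt0 phi1// cmod0. Qed.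

(** The factors are, in order, the inverse of the constant of [Kr_ge], the ratio [(d / s)^2] for
    [s = d / 4], the constant of [sum_Kr_local], and [8 * 20^2] from [integral_dyad_disc] at scale
    [20 d]. *)
Definition upper_cst : R := 32 / alpha * (16 * (8 * 64 ^+ 2) * 3200).

Lemma upper_cst_gt0 : 0 < upper_cst.
Proof. by apply: mulr_gt0; [rewrite divr_gt0// alpha_gt0|lra]. Qed.

Lemma sum_zeros_le (w : C) (X : seq C) : cmod w < 1 -> w != phi 0 ->
  1 - cmod w < 2 ^- 32 * c0 / 2 -> uniq X -> (forall b, b \in X -> cmod b < 1 /\ phi b = w) ->
  ((\sum_(b <- X) (mult phi b)%:R * ln (cmod b)^-1 ^+ 2)%:E <=
   upper_cst%:E * mu2 (B 0 1 `&` [set p | (cmod (cut 1 phi p - w) <= 1 - cmod w)%R]))%E.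
Proof.
move=> w1 w0 wh uX hX; pose d := 1 - cmod w; have d0 : 0 < d by rewrite subr_gt0.
have al := @alpha_gt0 R.
have k1 : 2 ^- 32 <= 1 :> R by rewrite invf_le1 ?exprn_gt0// exprn_ege1// ler1n.
have dc : d < c0 / 2.
  have : 2 ^- 32 * c0 <= 1 * c0 by rewrite ler_wpM2r// ltW.
  by move: wh; rewrite -/d; lra.
(* If [|b| < 1/2], then [harnack_half] would keep [phi b] at distance at least [2 ^- 32 * c0] from
   the circle, contrary to the smallness of [d]. *)
have half zeta b : cmod b < 1 -> phi b = zeta -> 1 - cmod zeta <= 5 / 4 * d -> 1 / 2 <= cmod b.
  move=> b1 pb zd; rewrite leNgt; apply/negP => b2.
  have := harnack_half hphi phi1 (ltW b2); rewrite pb -/c0.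
  by move: wh; rewrite -/d; set k := 2 ^- 32 * c0; lra.
(* The radius depends on the finite set [X], so that [Kr_ge] applies to all its points; the final
   constant is independent of it. *)
have [r [r0 r1 rX]] : exists r : R, [/\ 0 < r, r < 1 & forall b, b \in X -> 1 - (1 - cmod b) / 4 <= r].
  elim: X {uX} hX => [_|b X ih hX]; first by exists (1 / 2); split => //; lra.
  have [|r [r0 r1 rX]] := ih; first by move=> a aX; apply: hX; rewrite inE aX orbT.
  have [b1 _] := hX b (mem_head _ _).
  exists (Num.max r (1 - (1 - cmod b) / 4)); split.
  - by rewrite lt_max r0.
  - by rewrite gt_max r1/=; lra.
  - by move=> a; rewrite inE le_max => /orP[/eqP ->|/rX ->//]; rewrite lexx orbT.
pose s := d / 4; have s0 : 0 < s by rewrite divr_gt0.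
have far : s <= cmod (phi 0 - w).
  have := cmodB_ge w (phi 0); rewrite cmodBC; move: dc; rewrite /s /c0 /d; lra.
have hM z zeta : cmod z < 1 -> cmod (zeta - w) < s -> cmod (phi z - zeta) <= 4.
  move=> /phi1 pz zs; have := cmodB (phi z) zeta; have := cmodD (zeta - w) w.
  rewrite subrK; move: zs; rewrite /s /d; have := cmod_ge0 w; lra.
set O := B 0 1 `&` _; have mO : measurable O by exact: measurable_cut_near.
(* For [zeta] in [B w s] one has [1 - |zeta| <= m] with [m = 5/4 * d], and [16 m = 20 d]. Since
   [m / 4 + s <= d], all the local domains of [sum_Kr_local] lie in [O]. *)
pose J (q : R * R) := (\int[mu2]_(p in O) dyad (cmod (cut 1 phi p - c2 q) / (20 * d))%R)%E.
have mD := measurable_dyad_dist (20 * d) hphi.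
have mJ : measurable_fun setT J.
  by apply: (@measurable_inner2 R _ _ _ _ mu2 O (fun q => dyad (cmod (cut 1 phi q.1 - c2 q.2) / (20 * d)))) => // q; exact: dyad_ge0.
have J0 q : (0 <= J q)%E by apply: integral_ge0 => p _; exact: dyad_ge0.
pose T q := ((8 * 64 ^+ 2)%:E * J q)%E.
have hT q t : cmod (c2 q - w) < s -> zero_list phi r (c2 q) t -> ((\sum_(b <- t) Kr r b)%:E <= T q)%E.
  move=> qs ht; have zd : 1 - cmod (c2 q) <= 5 / 4 * d.
    by have := cmodB_ge w (w - c2 q); rewrite subKr [cmod (w - _)]cmodBC; move: qs; rewrite /s /d; lra.
  have t2 b : b \in t -> 1 / 2 <= cmod b.
    by move=> bt; have [q' [_ _ _ h]] := ht; have [b1 pb _ _] := h b bt; exact: half pb zd.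
  apply: le_trans (sum_Kr_local hphi phi1 ht zd t2 r0 (ltW r1)) _.
  rewrite /T; apply: lee_wpmul2l => //; rewrite /J.
  rewrite (_ : 16 * (5 / 4 * d) = 20 * d); last by field.
  apply: (@ge0_subset_integral _ _ _ mu2).
  - exact: measurable_cut_near.
  - by [].
  - apply: measurable_funTS; apply: (measurableT_comp measurable_dyad); apply: measurable_funM; last exact: measurable_cst.
    exact: measurable_cut_dist.
  - by move=> p _; exact: dyad_ge0.
  move=> p [p1 /= pz]; split => //=; rewrite -/d.
  have := cmodD (cut 1 phi p - c2 q) (c2 q - w); rewrite addrA subrK.
  by move: qs; rewrite /s; lra.
have mT : measurable_fun setT T by exact: measurable_funeM.
have T0 q : (0 <= T q)%E by rewrite mule_ge0.
have M1 : 1 <= 4 :> R by rewrite ler1n.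
have [t ht hS] := zeros_average_le hphi s0 r0 r1 M1 far hM mT T0 hT.
have IT : (\int[mu2]_(q in B w s) T q <= (8 * 64 ^+ 2 * 3200 * (alpha * d ^+ 2))%:E * mu2 O)%E.
  rewrite /T (@ge0_integralZl _ _ _ mu2 (B w s)) ?lee_fin//; last first.
    exact: measurable_funTS.
  rewrite -[(8 * 64 ^+ 2 * 3200 * _)%R]mulrA (EFinM (8 * 64 ^+ 2)) -muleA; apply: lee_wpmul2l; first by rewrite lee_fin mulr_ge0.
  have sw : (\int[mu2]_(q in B w s) J q =
     \int[mu2]_(p in O) \int[mu2]_(q in B w s) dyad (cmod (cut 1 phi p - c2 q) / (20 * d))%R)%E.
    apply: esym; apply: (@tonelli_on R _ _ _ _ mu2 mu2 O (B w s) (fun q => dyad (cmod (cut 1 phi q.1 - c2 q.2) / (20 * d))) mO (measurable_B w s) mD).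
    by move=> q; exact: dyad_ge0.
  rewrite sw.
  have ec : (\int[mu2]_(_ in O) (3200 * (alpha * d ^+ 2))%:E = (3200 * (alpha * d ^+ 2))%:E * mu2 O)%E.
    exact: integral_cst.
  rewrite -ec; apply: (@ge0_le_integral _ _ _ mu2 O mO).
  - by move=> p _; apply: integral_ge0 => q _; exact: dyad_ge0.
  - apply: measurable_funTS.
    exact: (@measurable_inner1 R _ _ _ _ mu2 (B w s) (fun q => dyad (cmod (cut 1 phi q.1 - c2 q.2) / (20 * d))) (measurable_B w s) mD (fun=> dyad_ge0 _)).
  - exact: measurable_cst.
  move=> p _; apply: (le_trans (integral_dyad_disc _ _ _ _)); first by rewrite mulr_gt0.
  by rewrite lee_fin le_eqVlt; apply/orP; left; apply/eqP; ring.
have Ofin : mu2 O \is a fin_num.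
  rewrite ge0_fin_numE//; apply: le_lt_trans (mu2_B_lty 0 ltr01).
  by apply: le_measure; [exact/mem_set|exact/mem_set|move=> p []].
have {hS IT} := le_trans hS IT; rewrite -(fineK Ofin) -!EFinM !lee_fin.
set S := \sum_(b <- t) _; set m := fine _ => hS.
have Sm : S <= 16 * (8 * 64 ^+ 2) * 3200 * m.
  have ad : 0 < alpha * d ^+ 2 by rewrite mulr_gt0// exprn_gt0.
  rewrite -(ler_pM2l ad); move: hS.
  rewrite (_ : alpha * s ^+ 2 * S = alpha * d ^+ 2 * S / 16); last by rewrite /s; field.
  rewrite ler_pdivrMr// => hS; apply: le_trans hS _.
  by rewrite le_eqVlt; apply/orP; left; apply/eqP; ring.
have [q [_ _ hin hb]] := ht.
have kb b : b \in t -> 0 <= Kr r b by move=> /hb[_ _ b0 _]; exact: Kr_ge0.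
apply: (@le_trans _ _ (32 / alpha * S)); last first.
  have c32 : 0 < 32 / alpha :> R by rewrite divr_gt0.
  by rewrite /upper_cst -(mulrA (32 / alpha)) ler_pM2l.
rewrite /S -(sum_undup_count (fun b => Kr r b)) mulr_sumr.
have Xt b : b \in X -> b \in t.
  move=> bX; have [b1 pb] := hX b bX; apply: hin => //.
  by have h := rX b bX; clear -h b1 hphi phi1 c00; lra.
apply: (@le_trans _ _ (\sum_(b <- X) 32 / alpha * ((count_mem b t)%:R * Kr r b))).
  rewrite big_seq [leRHS]big_seq; apply: ler_sum => b bX; have [b1 pb] := hX b bX.
  have [_ _ b0 ->] := hb b (Xt b bX).
  rewrite [leRHS]mulrCA ler_wpM2l// -(@ler_pM2l _ (alpha / 32)) ?divr_gt0//.
  rewrite (_ : alpha / 32 * (32 / alpha * Kr r b) = Kr r b); last by field; rewrite gt_eqF.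
  apply: Kr_ge => //; [|exact: rX|exact: ltW].
  by apply: half pb _ => //; rewrite -/d; clear -d0 hphi phi1 c00; lra.
apply: ler_sum_uniq_sub => //; first exact: undup_uniq.
  by move=> b /Xt; rewrite mem_undup.
move=> b; rewrite mem_undup => /kb kb0.
by rewrite mulr_ge0// ?divr_ge0 ?mulr_ge0// ltW.
Qed.

(** By [window_near] a window of size [h] lies within [(1 + 2 pi) h] of [xi]; one more [h] leads to
    [(1 + h) xi], the centre [p0] used below. *)
Let kappa : R := 2 + 2 * pi.

(** [average_near_le] at [p0 = (1 + h) xi] with [s = 4 kappa h]: the window lies within [s / 4] of
    [p0], and the values of [B p0 s] have modulus above [1 - s]. The condition [s <= c0] keeps
    [phi 0] outside that disc. *)
Lemma area_window_le (xi : C) (h K : R) : cmod xi = 1 -> 0 < h -> h < 1 -> 4 * kappa * h <= c0 -> 0 <= K ->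
  (forall zeta, cmod zeta < 1 -> 1 - 4 * kappa * h <= cmod zeta -> (N2 phi zeta <= K%:E)%E) ->
  (area [set z | disk z /\ window xi h (phi z)] <= (2 * alpha / (3 / 4 * ln 2) * K / pi)%:E)%E.
Proof.
move=> x1 h0 h1 hc K0 hK; have al := @alpha_gt0 R; have ppi := @pi_gt0 R.
have mP := measurable_preimage_window hphi phi1 x1 (ltW h0) h1.
rewrite areaE// EFinM; apply: lee_wpmul2r; first by rewrite lee_fin invr_ge0 ltW.
have k0 : 0 < kappa by rewrite /kappa; lra.
pose s := 4 * kappa * h; have s0 : 0 < s by rewrite !mulr_gt0.
pose p0 := (1 + h)%:C * xi; have cp : cmod p0 = 1 + h.
  by rewrite cmodM x1 mulr1 cmod_real ger0_norm//; lra.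
have l2 : 0 < 3 / 4 * ln 2 :> R by rewrite mulr_gt0// ln_gt0// ltr1n.
have far : s <= cmod (phi 0 - p0).
  have := cmodB_ge p0 (phi 0); rewrite cmodBC cp; move: hc; rewrite -/s /c0; lra.
pose M := 3 + 4 * kappa.
have M1 : 1 <= M by rewrite /M; lra.
have hM z zeta : cmod z < 1 -> cmod (zeta - p0) < s -> cmod (phi z - zeta) <= M.
  move=> /phi1 pz zs; have := cmodB (phi z) zeta; have := cmodD (zeta - p0) p0; rewrite subrK cp.
  have : 4 * kappa * h <= 4 * kappa * 1 by rewrite ler_wpM2l ?ltW// mulr_gt0.
  rewrite -/s /M; lra.
have hp0 z : cmod z < 1 -> phi z != p0.
  by move=> /phi1 h'; apply: contraTneq h' => ->; rewrite cp -leNgt; lra.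
have hK' zeta : cmod (zeta - p0) < s -> cmod zeta < 1 -> (N2 phi zeta <= K%:E)%E.
  move=> zs z1; apply: hK => //; have := cmodB_ge p0 (p0 - zeta); rewrite subKr cp cmodBC -/s; lra.
apply/lee_addgt0Pr => e e0.
(* Points outside [B 0 r] add at most [alpha (1 - r^2) <= 2 alpha (1 - r) <= e]; the maximum with
   [1/2] keeps [r] positive. *)
pose r : R := Num.max (1 / 2) (1 - e / (2 * alpha)).
have r0 : 0 < r by rewrite lt_max; apply/orP; left; lra.
have r1 : r < 1 by rewrite gt_max; apply/andP; split; [lra|rewrite gtrBl divr_gt0// mulr_gt0].
have core := average_near_le hphi phi1 s0 r0 r1 M1 far hM hp0 K0 hK'.
set P := [set p | _]; set W := B 0 r `&` _ in core.
have mW : measurable W.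
  apply: measurableI => //; apply: measurable_le_fun; last exact: measurable_cst.
  exact: measurable_cut_dist.
have PW : P `<=` W `|` (B 0 1 `\` B 0 r).
  move=> p [p1 pw]; rewrite /disk/= in p1; have [pr|pr] := ltP (cmod (c2 p)) r.
    left; split; [by rewrite B0E|rewrite /= cutE//].
    have := window_near x1 (ltW h0) h1 pw; have := cmod_tri (phi (c2 p)) p0 xi.
    have -> : cmod (xi - p0) = h.
      have -> : xi - p0 = - (h%:C * xi) by rewrite /p0 rmorphD/= mulrDl mul1r opprD addrA subrr add0r.
      by rewrite cmodN cmodM x1 mulr1 cmod_real gtr0_norm.
    by rewrite /s /kappa; lra.
  by right; split; rewrite B0E//; apply/negP; rewrite -leNgt.
have mA : measurable (B 0 1 `\` B 0 r : set (R * R)) by exact: measurableD.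
have sub : (mu2 P <= mu2 W + mu2 (B 0 1 `\` B 0 r))%E.
  apply: le_trans (measureU2 _ mW mA).
  by apply: le_measure; [exact/mem_set|apply/mem_set; exact: measurableU|].
apply: (le_trans sub); apply: leeD.
  rewrite -(@lee_pmul2l _ (3 / 4 * ln 2)%:E) ?lte_fin//.
  apply: (le_trans core); rewrite -EFinM lee_fin mulrA [_ * (_ / _)]mulrC divfK ?gt_eqF//.
rewrite leb2D//; last 2 first.
- exact: mu2_B_lty ltr01.
- by move=> p; rewrite !B0E => /lt_trans; apply.
rewrite !mu2_B// -EFinB lee_fin expr1n mulr1.
have hr : 1 - r <= e / (2 * alpha) by rewrite lerBlDl -lerBlDr /r le_max lexx orbT.
rewrite ler_pdivlMr ?mulr_gt0// in hr.
have : (1 - r) * (1 - r) >= 0 by rewrite -expr2 sqr_ge0.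
rewrite expr2; nra.
Qed.

End fixed_map.
End two_sided.

Theorem theorem3p10 (R : realType) :
  exists C : R, 1 < C /\
  forall phi : R[i] -> R[i], analytic_selfmap phi ->
  exists h0 : R, 0 < h0 /\
  forall h : R, 0 < h -> h < 1 -> h < h0 ->
    ((C^-1)%:E * rho2 phi (h / C)
       <= ereal_sup [set N2 phi w | w in [set w | disk w /\ (1 - h <= cmod w)%R]])%E /\
    (ereal_sup [set N2 phi w | w in [set w | disk w /\ (1 - h <= cmod w)%R]]
       <= C%:E * rho2 phi (C * h))%E.
Proof.
have al := @alpha_gt0 R; have ppi := @pi_gt0 R.
pose kappa : R := 2 + 2 * pi; have k0 : 0 < kappa by rewrite /kappa; lra.
have l2 : 0 < 3 / 4 * ln 2 :> R by rewrite mulr_gt0// ln_gt0// ltr1n.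
pose A1 : R := 2 * alpha / (3 / 4 * ln 2) / pi.
pose A2 : R := upper_cst * pi.
have u0 := @upper_cst_gt0 R.
have A10 : 0 < A1 by rewrite /A1 divr_gt0// divr_gt0// mulr_gt0.
have A20 : 0 < A2 by rewrite mulr_gt0.
(* A sum of positive terms, so that it dominates each requirement: [4 kappa] for the averaging discs
   of the lower bound, [8] for the windows of the upper bound, and the multiplicative constants [A1]
   and [A2], which include the normalization of [area] by [pi]. *)
pose C := 9 + 4 * kappa + A1 + A2; exists C.
have C0 : 0 < C by rewrite /C; lra.
split; first by rewrite /C; lra.
move=> phi [dphi phiD].
have hphi : holo phi by move=> z z1; apply: derivable_cder; exact: dphi.
have phi1 z : cmod z < 1 -> cmod (phi z) < 1 by move=> z1; exact: phiD.
pose c0 := 1 - cmod (phi 0).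
have c00 : 0 < c0 by rewrite subr_gt0 phi1// cmod0.
pose k : R := 2 ^- 32.
have kk0 : 0 < k by rewrite invr_gt0 exprn_gt0.
have kk1 : k <= 1 by rewrite invf_le1 ?exprn_gt0// exprn_ege1// ler1n.
have kc : k * c0 <= c0 by rewrite ler_piMl// ltW.
(* The first bound makes [C * h < 1], so that windows of size [C * h] avoid the origin. The second
   keeps the preimages counted away from the centre, as [sum_zeros_le] requires. *)
exists (Num.min C^-1 (k * c0 / 2)); split; first by rewrite lt_min invr_gt0 C0 divr_gt0// mulr_gt0.
move=> h h0 h1; rewrite lt_min => /andP[hC hk].
have Ch : C * h < 1 by rewrite -ltr_pdivlMl// mulr1.
have Cn0 : C != 0 by rewrite gt_eqF.
split.
  rewrite lee_pdivrMl//; set S := ereal_sup _.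
  have N0 w : (0 <= N2 phi w)%E.
    rewrite /N2; case: ifP => // _; apply: esum_ge0 => z _.
    by rewrite lee_fin mulr_ge0// sqr_ge0.
  have S0 : (0 <= S)%E.
    apply: le_trans (N0 ((1 - h / 2)%:C)%C) _; apply: ereal_sup_ubound; exists ((1 - h / 2)%:C)%C => //.
    by rewrite /disk/= cmod_real ger0_norm; lra.
  have [->|Sfin] := eqVneq S +oo%E; first by rewrite mulry gtr0_sg// mul1e leey.
  have {}Sfin : S \is a fin_num by rewrite ge0_fin_numE// lt_neqAle Sfin leey.
  apply: ge_ereal_sup => _ [xi x1 <-].
  have hC0 : 0 < h / C by rewrite divr_gt0.
  have hC1 : 4 * kappa * (h / C) <= h.
    rewrite mulrA ler_pdivrMr// [leRHS]mulrC ler_pM2r// /C; lra.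
  have h2 : h / C < 1 by rewrite ltr_pdivrMr// mul1r /C; lra.
  apply: (le_trans (@area_window_le R phi hphi phi1 xi (h / C) (fine S) x1 hC0 h2 _ _ _)).
  - by apply: (le_trans hC1); rewrite -/c0; lra.
  - exact: fine_ge0.
  - move=> z z1 zh; rewrite fineK//; apply: ereal_sup_ubound; exists z => //.
    by split => //; apply: le_trans zh; rewrite lerD2l lerN2.
  rewrite -{2}(fineK Sfin) -EFinM lee_fin mulrAC -/A1 ler_wpM2r ?fine_ge0//.
  by rewrite /C; lra.
apply: ge_ereal_sup => _ [w [w1 wh] <-]; rewrite /disk/= in w1.
have rho0 : (0 <= rho2 phi (C * h))%E.
  have c1 : cmod (1 : R[i]) = 1 by exact: cmod1.
  apply: le_trans (ereal_sup_ubound _); last by exists 1.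
  by rewrite mule_ge0// lee_fin invr_ge0 ltW.
apply: N2_le; first by rewrite mule_ge0// lee_fin ltW.
move=> w0 X uX hX.
have w00 : 0 < cmod w by lra.
apply: le_trans (sum_zeros_le hphi phi1 w1 w0 _ uX hX) _.
  by apply: le_lt_trans hk; lra.
set O := B 0 1 `&` _.
pose xi := w / ((cmod w)%:C)%C.
have cwn : ((cmod w)%:C)%C != 0 :> R[i] by rewrite -cmod_gt0 cmod_real normr_gt0 gt_eqF.
have x1 : cmod xi = 1 by rewrite cmod_div cmod_real ger0_norm// divff// gt_eqF.
have wxi : cmod (w - xi) = 1 - cmod w.
  have -> : w - xi = ((cmod w - 1)%:C)%C * xi by rewrite /xi rmorphB rmorph1; field.
  by rewrite cmodM x1 mulr1 cmod_real distrC ger0_norm// subr_ge0 ltW.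
have Ch0 : 0 <= C * h by rewrite mulr_ge0// ltW.
have mP := measurable_preimage_window hphi phi1 x1 Ch0 Ch.
have C8 : 8 * h <= C * h by rewrite ler_pM2r// /C; lra.
have OP : (leb2 O <= leb2 [set p : R * R | disk (c2 p) /\ window xi (C * h) (phi (c2 p))])%E.
  apply: le_measure; [by apply: mem_set; exact: measurable_cut_near|exact/mem_set|].
  move=> p []; rewrite B0E => p1 /=; rewrite cutE// => pw; split => //.
  (* The radial projection [xi] is at distance [1 - |w|] from [w], so [|phi - w| <= 1 - |w|] gives
     twice that distance from [xi]; [near_window] turns it into a window of size
     [8 (1 - |w|) <= C h]. *)
  have d0 : 0 <= 2 * (1 - cmod w) by lra.
  have d1 : 2 * (1 - cmod w) <= 1 / 2 by lra.
  have [|q1 [q2 q3]] := near_window x1 d0 d1 (phi1 _ p1).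
    by have := cmod_tri (phi (c2 p)) xi w; rewrite wxi; lra.
  split => //; split; first by lra.
  by apply: le_trans q3 _; rewrite ler_pM2l//; lra.
apply: (@le_trans _ _ (upper_cst%:E * (pi%:E * rho2 phi (C * h)))%E).
  apply: lee_wpmul2l; first by rewrite lee_fin ltW.
  apply: (le_trans OP).
  rewrite -lee_pdivrMl// muleC.
  rewrite -(areaE (A := [set z | disk z /\ window xi (C * h) (phi z)]))//.
  by apply: ereal_sup_ubound; exists xi.
rewrite muleA -EFinM; apply: lee_wpmul2r => //.
by rewrite lee_fin -/A2 /C; lra.
Qed.
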